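(* Let $T\colon R^{p,0}_\omega\to R^{p,0}_\omega$ be a bounded linear operator and $0<\epsilon<1$. Then either $T$ or $I-T$ is a $\frac{4}{1-\epsilon}(p^*-1)^2\big(\frac{p^*}{2}\big)^{3/2}$-factor of the identity $I$ on $R^{p,0}_\omega$; that is, for $S=T$ or $S=I-T$ there exist bounded operators $A,B$ on $R^{p,0}_\omega$ with $ASB=I$ and $\|A\|\|B\|\le\frac{4}{1-\epsilon}(p^*-1)^2\big(\frac{p^*}{2}\big)^{3/2}$.
   Context: Fix $1<p<\infty$, $q=p/(p-1)$, $p^*=\max\{p,q\}$. All $L_r$ spaces are over $[0,1]$ with Lebesgue measure. A dyadic interval is $[(i-1)2^{-n},i2^{-n})$, $n\ge0$, $1\le i\le2^n$; $\mathcal D^n$ is the set of those of length $2^{-n}$ and $\mathcal D_n=\bigcup_{k=0}^n\mathcal D^k$. For a dyadic interval $I$, $I^+,I^-$ are its left and right halves and $h_I=\chi_{I^+}-\chi_{I^-}$. For each $n\in\mathbb N$ a family $(h^n_I)_{I\in\mathcal D_{n-1}}$ in $L_p$ is fixed with the same joint distribution as $(h_I)_{I\in\mathcal D_{n-1}}$, such that the $\sigma$-algebras $\sigma(h^n_I:I\in\mathcal D_{n-1})$, $n\in\mathbb N$, are independent. Let $\mathcal D_\omega=\{(n,I):n\in\mathbb N,I\in\mathcal D_{n-1}\}$. $R^{p,0}_\omega$ is the closed linear span of $\{h^n_I:(n,I)\in\mathcal D_\omega\}$ in $L_p$ (a distributional copy of the mean-zero hyperplane of the Bourgain–Rosenthal–Schechtman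 space $R^p_\omega$). *)

(* Defs.v *)
From HB Require Import structures.
From mathcomp Require Import all_boot all_order all_algebra.
From mathcomp Require Import all_classical all_reals all_analysis.

Set Implicit Arguments.
Unset Strict Implicit.
Unset Printing Implicit Defensive.

Import Order.TTheory GRing.Theory Num.Theory numFieldNormedType.Exports.
Local Open Scope classical_set_scope.
Local Open Scope ring_scope.

(* Scalars: an arbitrary realType R.
   L_p spaces are over [0,1] with Lebesgue measure; elements are represented
   by (Borel measurable) functions R -> R, identified up to a.e. equality on
   [0,1]. *)

Section Defs.
Context {R : realType}.

Definition mu01 : {measure set (measurableTypeR R) -> \bar R} :=
  mrestr (@lebesgue_measure R) (measurable_itv `[(0:R), 1]).

Definition pnorm (p : R) (f : R -> R) : \bar R :=
  Lnorm mu01 p%:E (EFin \o f).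

Definition aeq (f g : R -> R) : Prop := {ae mu01, forall x, f x = g x}.

Definition qconj (p : R) : R := p / (p - 1).
Definition pstar (p : R) : R := Num.max p (qconj p).

(* the Haar function h_I for the dyadic interval
   I = [i 2^-k, (i+1) 2^-k)  (0-based i < 2^k):  h_I = chi_{I^+} - chi_{I^-} *)
Definition haar (k i : nat) : R -> R := fun x =>
  \1_(`[ (i%:R / 2 ^+ k), ((2 * i + 1)%:R / 2 ^+ k.+1) [) x
  - \1_(`[ ((2 * i + 1)%:R / 2 ^+ k.+1), (i.+1%:R / 2 ^+ k) [) x.

(* a family (h^n_I) : h n k i = h^n_I with I the i-th dyadic interval of
   length 2^-k; valid indices (= D_omega): n >= 1, k <= n-1, i < 2^k. *)
Definition Domega (j : nat * nat * nat) : bool :=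
  let: (n, k, i) := j in [&& (0 < n)%N, (k < n)%N & (i < 2 ^ k)%N].

(* each block (h^n_I)_{I in D_{n-1}} has the same joint distribution as
   (h_I)_{I in D_{n-1}} (equality of the laws on all measurable rectangles) *)
Definition same_joint_dist (h : nat -> nat -> nat -> R -> R) : Prop :=
  forall n : nat, (0 < n)%N ->
  forall B : nat -> nat -> set R, (forall k i, measurable (B k i)) ->
  mu01 (\bigcap_(k in [set k | (k < n)%N])
          \bigcap_(i in [set i | (i < 2 ^ k)%N]) (h n k i @^-1` B k i))
  = mu01 (\bigcap_(k in [set k | (k < n)%N])
          \bigcap_(i in [set i | (i < 2 ^ k)%N]) (haar k i @^-1` B k i)).

Definition gen_sigma (h : nat -> nat -> nat -> R -> R) (n : nat) : set (set R) :=
  smallest (sigma_algebra `[(0:R), 1])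
    [set A | exists k i (B : set R), [/\ (k < n)%N, (i < 2 ^ k)%N,
        measurable B & A = `[(0:R), 1] `&` (h n k i @^-1` B)]].

Definition indep_blocks (h : nat -> nat -> nat -> R -> R) : Prop :=
  forall s : seq nat, uniq s -> all (fun n => (0 < n)%N) s ->
  forall A : nat -> set R, (forall n, n \in s -> gen_sigma h n (A n)) ->
  mu01 (\bigcap_(n in [set` s]) A n) = (\prod_(n <- s) mu01 (A n))%E.

Definition in_span (h : nat -> nat -> nat -> R -> R) (g : R -> R) : Prop :=
  exists (s : seq (nat * nat * nat)) (c : nat * nat * nat -> R),
    all Domega s /\
    g = (fun x => \sum_(j <- s) c j * h j.1.1 j.1.2 j.2 x).

Definition RpO (h : nat -> nat -> nat -> R -> R) (p : R) (f : R -> R) : Prop :=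
  measurable_fun setT f /\
  forall e : R, 0 < e -> exists g, in_span h g /\ (pnorm p (fun x => (f x - g x)%R) < e%:E)%E.

Definition bdd_op (h : nat -> nat -> nat -> R -> R) (p : R)
    (T : (R -> R) -> (R -> R)) (C : R) : Prop :=
  [/\ forall f, RpO h p f -> RpO h p (T f),
      forall f g (a b : R), RpO h p f -> RpO h p g ->
        aeq (T (fun x => a * f x + b * g x)) (fun x => a * T f x + b * T g x)
    & forall f, RpO h p f -> (pnorm p (T f) <= C%:E * pnorm p f)%E].

Definition IminusOp (T : (R -> R) -> (R -> R)) : (R -> R) -> (R -> R) :=
  fun f x => f x - T f x.

Definition fact_const (p eps : R) : R :=
  4 / (1 - eps) * (pstar p - 1) ^+ 2 * powR (pstar p / 2) (3 / 2).

End Defs.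

(* Main.v *)
From mathcomp Require Import all_fingroup.
Require Import Defs.
From HB Require Import structures.
From mathcomp Require Import all_boot all_order all_algebra.
From mathcomp Require Import all_classical all_reals all_analysis.
From mathcomp Require Import measurable_realfun.
From mathcomp Require Import ring lra zify.

Set Implicit Arguments.
Unset Strict Implicit.
Unset Printing Implicit Defensive.

Import Order.TTheory GRing.Theory Num.Theory numFieldNormedType.Exports.
Local Open Scope classical_set_scope.
Local Open Scope ring_scope.

(* A block of the space is a copy of the mean-zero functions on [2^(n+1)]
   points, and different blocks are independent.  If rho maps the points of a
   large block onto those of the n-th block with fibres of equal size, then
   v |-> v o rho is an isometric copy of the n-th block and averaging over the
   fibres is its left inverse; by Jensen's inequality one copy per block, taken
   in different blocks, gives an isometry B and a contraction A with A B = I.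
   Cut the large block into many groups and let rho permute each group by an
   independent uniform permutation before coarsening.  Since the symmetric group
   is 2-transitive, the expected matrix of A T B on the copy is a scalar lambda;
   all the fluctuations, as well as the interaction with the copies already
   chosen, have a variance which tends to 0 with the number of groups.  Choosing
   the copies one after the other, along a sequence where the scalars converge,
   makes A T B - lambda I of norm at most 1/4.  One of |lambda|, |1 - lambda| is
   at least 1/2, and a Neumann series then yields the factorization with constant
   4, which is at most the required one. *)

(** * Complete seminormed spaces *)

(** Two numbers govern the fluctuations. With [K] groups, a function bounded by 1 and carried by one
    group has norm at most [K^(-1/p)], and by Hölder's inequality a vector of norm 1 has L1 mass at
    most [K^(1/p - 1)] on one group; both tend to 0 because [1 < p < oo]. Each variance is
    controlled by a sum of squares, that is, by the largest term times the sum of the absolute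
    values, and one of the two numbers comes out as a factor. The scalar depends on the large block
    alone and not on the block that is copied into it, so one limit serves all the copies. A block
    has finite dimension, hence each stage has finitely many matrix entries to control, and
    Chebyshev's inequality finds one sample that is good for all of them. The constant 4 is the
    product of 2, a bound for the inverse of the scalar, and 2, the norm of the Neumann inverse.
    Elements are functions and not classes: identities between operators hold up to elements of
    seminorm 0, and operators are first given as relations on finite block sums. *)

Lemma zerofctE (T : Type) (R : pzRingType) (x : T) : (0 : T -> R) x = 0.
Proof. by []. Qed.

Ltac fring := apply/funext => ?; rewrite ?fctE ?zerofctE /GRing.scale/=; ring.

(** Equality modulo null elements is expressed by [snm (f - g) = 0]. The triangle inequality and
    homogeneity are asked on [sX] only, since the seminorm of a function of infinite norm will be a
    default value. Completeness is asked for geometric increments, the form in which limits are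
    constructed. *)
Record sspace (R : realType) := SSpace {
  sdom : Type;
  sX : (sdom -> R) -> Prop;
  snm : (sdom -> R) -> R;
  sX0 : sX 0;
  sX_lin : forall a b f g, sX f -> sX g -> sX (a *: f + b *: g);
  snm_ge0 : forall f, 0 <= snm f;
  snm_triangle : forall f g, sX f -> sX g -> snm (f + g) <= snm f + snm g;
  snmZ : forall a f, sX f -> snm (a *: f) = `|a| * snm f;
  s_complete : forall x : nat -> sdom -> R, (forall k, sX (x k)) ->
    (forall k, snm (x k.+1 - x k) <= 2^-1 ^+ k) ->
    exists2 y, sX y &
      forall e, 0 < e -> exists K, forall k, (K <= k)%N -> snm (y - x k) <= e }.

Arguments sX {R s}.
Arguments snm {R s}.

Section SemiNorm.
Context {R : realType} {S : sspace R}.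
Implicit Types f g : sdom S -> R.

Lemma sXD f g : sX f -> sX g -> sX (f + g).
Proof.
move=> Xf Xg; have -> : f + g = 1 *: f + 1 *: g by fring.
exact: sX_lin.
Qed.

Lemma sXB f g : sX f -> sX g -> sX (f - g).
Proof.
move=> Xf Xg; have -> : f - g = 1 *: f + (-1) *: g by fring.
exact: sX_lin.
Qed.

Lemma sXZ a f : sX f -> sX (a *: f).
Proof.
move=> Xf; have -> : a *: f = a *: f + 0 *: 0 by fring.
by apply: sX_lin => //; exact: sX0.
Qed.

Lemma sX_sum (I : Type) (r : seq I) (P : pred I) (F : I -> sdom S -> R) :
  (forall i, P i -> sX (F i)) -> sX (\sum_(i <- r | P i) F i).
Proof. by move=> XF; apply: big_ind => //; [exact: sX0|move=> *; exact: sXD]. Qed.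

Lemma snm0 : snm (0 : sdom S -> R) = 0.
Proof.
have -> : 0 = 0 *: (0 : sdom S -> R) by fring.
by rewrite snmZ ?normr0 ?mul0r//; exact: sX0.
Qed.

Lemma snmN f : sX f -> snm (- f) = snm f.
Proof.
move=> Xf; have -> : - f = (-1) *: f by fring.
by rewrite snmZ// normrN normr1 mul1r.
Qed.

Lemma snmB_le f g : sX f -> sX g -> snm (f - g) <= snm f + snm g.
Proof.
move=> Xf Xg; have -> : f - g = f + (-1) *: g by fring.
apply: le_trans (snm_triangle Xf (sXZ _ Xg)) _.
by rewrite snmZ// normrN normr1 mul1r.
Qed.

Lemma snmC f g : sX f -> sX g -> snm (f - g) = snm (g - f).
Proof.
move=> Xf Xg; rewrite -snmN; last exact: sXB.
by congr snm; fring.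
Qed.

Lemma snm_le_sub f g : sX f -> sX g -> snm f <= snm (f - g) + snm g.
Proof.
move=> Xf Xg; have {1}-> : f = (f - g) + g by fring.
by apply: snm_triangle => //; exact: sXB.
Qed.

Lemma snm_sum_le (I : Type) (r : seq I) (P : pred I) (F : I -> sdom S -> R) :
  (forall i, P i -> sX (F i)) ->
  snm (\sum_(i <- r | P i) F i) <= \sum_(i <- r | P i) snm (F i).
Proof.
move=> XF; elim: r => [|i r IH]; first by rewrite !big_nil snm0.
rewrite !big_cons; case: ifP => // Pi.
apply: le_trans (snm_triangle (XF _ Pi) (sX_sum _ XF)) _.
by rewrite lerD2l.
Qed.

End SemiNorm.

Lemma le_addM_gt0 (R : realType) (x y c : R) : 0 <= c ->
  (forall e, 0 < e -> x <= y + c * e) -> x <= y.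
Proof.
move=> c0 h; apply/ler_addgt0Pr => e e0.
have c1 : 0 < c + 1 by rewrite ltr_wpDl.
apply: le_trans (h (e / (c + 1)) (divr_gt0 e0 c1)) _.
rewrite lerD2l mulrCA ger_pMr// ler_pdivrMr// mul1r; lra.
Qed.

Definition bounded_op (R : realType) (S1 S2 : sspace R)
    (F : (sdom S1 -> R) -> (sdom S2 -> R)) (C : R) : Prop :=
  [/\ forall f, sX f -> sX (F f),
      forall f g (a b : R), sX f -> sX g ->
        snm (F (a *: f + b *: g) - (a *: F f + b *: F g)) = 0
    & forall f, sX f -> snm (F f) <= C * snm f].

(** * Extension of bounded linear relations by density and completeness *)

Section Extension.
Context {R : realType} (S1 S2 : sspace R).
Variables (G : (sdom S1 -> R) -> (sdom S2 -> R) -> Prop) (C : R).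
Hypothesis C0 : 0 <= C.
Hypothesis GX : forall x y, G x y -> [/\ sX x, sX y & snm y <= C * snm x].
Hypothesis Glin : forall a b x y x' y', G x y -> G x' y' ->
  G (a *: x + b *: x') (a *: y + b *: y').
Hypothesis Gdense : forall f, sX f -> forall e, 0 < e ->
  exists x y, G x y /\ snm (f - x) < e.

(** The closure of the graph [G]; the values of the extension are picked from it. *)
Let cl f y := sX y /\ forall e, 0 < e -> exists x y',
  [/\ G x y', snm (f - x) <= e & snm (y - y') <= e].

Let cl_total f : sX f -> exists y, cl f y.
Proof.
(* The divisor turns increments [2 * d k] of the arguments into increments at most [2^-k] of the
   values, as completeness requires. *)
move=> Xf; pose d k : R := 2^-1 ^+ k / (2 * (C + 1)).
have C1 : 0 < 2 * (C + 1) by rewrite mulr_gt0// ltr_wpDl.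
have d0 k : 0 < d k by rewrite divr_gt0// exprn_gt0// invr_gt0.
have /choice[xy xyP] : forall k, exists xy : (sdom S1 -> R) * (sdom S2 -> R),
    G xy.1 xy.2 /\ snm (f - xy.1) < d k.
  by move=> k; have [x [y ?]] := Gdense Xf (d0 k); exists (x, y).
have dS k : d k.+1 <= d k.
  rewrite /d ler_pM2r ?invr_gt0// exprS ger_pMl ?exprn_gt0 ?invr_gt0//; lra.
have [y Xy yl] : exists2 y, sX y & forall e, 0 < e -> exists K, forall k,
    (K <= k)%N -> snm (y - (xy k).2) <= e.
  apply: s_complete => [k|k]; first by have [/GX[]] := xyP k.
  have [Gk lk] := xyP k; have [Gk1 lk1] := xyP k.+1.
  have [Xk _ _] := GX Gk; have [Xk1 _ _] := GX Gk1.
  have -> : (xy k.+1).2 - (xy k).2 = 1 *: (xy k.+1).2 + (-1) *: (xy k).2 by fring.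
  have [_ _] := GX (Glin 1 (-1) Gk1 Gk); move=> /le_trans; apply.
  have -> : 1 *: (xy k.+1).1 + (-1) *: (xy k).1 =
    (f - (xy k).1) - (f - (xy k.+1).1) by fring.
  apply: (@le_trans _ _ (C * (2 * d k))).
    rewrite ler_wpM2l//; apply: le_trans (snmB_le (sXB Xf Xk) (sXB Xf Xk1)) _.
    by have := dS k; lra.
  rewrite /d; set u := _ ^+ k.
  have u0 : 0 <= u by rewrite /u exprn_ge0// invr_ge0.
  have -> : C * (2 * (u / (2 * (C + 1)))) = u * (C / (C + 1)).
    by field; rewrite gt_eqF//; lra.
  rewrite ler_piMr// ler_pdivrMr ?mul1r; lra.
exists y; split => // e e0; have [K hK] := yl e e0.
have [K2 hK2] : exists K2, d K2 <= e.
  exists (Num.bound (1 / e)).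
  have : 1 / e < (Num.bound (1 / e))%:R.
    by apply: archi_boundP; apply: divr_ge0 => //; exact: ltW.
  set n := Num.bound _ => hn.
  rewrite /d ler_pdivrMr//; apply: (@le_trans _ _ e); last first.
    by have := mulr_ge0 (ltW e0) C0; lra.
  have n2 : n%:R <= 2 ^+ n :> R.
    by rewrite -natrX ler_nat ltnW// ltn_expl.
  rewrite exprVn -[e]invrK lef_pV2 ?posrE ?exprn_gt0 ?invr_gt0//.
  by rewrite -[e^-1]mul1r; apply: le_trans n2; exact: ltW.
pose k := maxn K K2; have [Gk lk] := xyP k.
exists (xy k).1, (xy k).2; split => //; last by apply: hK; exact: leq_maxl.
apply: (le_trans (ltW lk)); apply: le_trans hK2.
have : (K2 <= k)%N by exact: leq_maxr.
elim: (k) => [|j IH]; first by rewrite leqn0 => /eqP->.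
by rewrite leq_eqVlt => /orP[/eqP->//|/IH]; exact: le_trans.
Qed.

(** Graph pairs near the three given pairs combine into one graph pair whose first entry is small,
    so its second entry is small by [GX]. For [a = 1], [b = 0] this says that the value over a
    vector is unique up to null elements. *)
Let cl_lin a b f g h y z w : sX f -> sX g -> h = a *: f + b *: g ->
  cl f y -> cl g z -> cl h w -> snm (w - (a *: y + b *: z)) = 0.
Proof.
move=> Xf Xg hE [Xy fy] [Xz gz] [Xw hw].
apply/eqP; rewrite eq_le snm_ge0 andbT.
have c0 : 0 <= (1 + C) * (1 + `|a| + `|b|).
  by rewrite mulr_ge0// ?addr_ge0.
apply: (le_addM_gt0 c0) => e e0; rewrite add0r.
have [x1 [y1 [G1 n1 m1]]] := fy _ e0.
have [x2 [y2 [G2 n2 m2]]] := gz _ e0.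
have [x3 [y3 [G3 n3 m3]]] := hw _ e0.
have Xh : sX h by rewrite hE; exact: sX_lin.
have [X1 Y1 _] := GX G1; have [X2 Y2 _] := GX G2; have [X3 Y3 _] := GX G3.
have [XX YY] := GX (Glin 1 (-1) G3 (Glin a b G1 G2)).
have [XL YL _] := GX (Glin a b G1 G2).
have -> : w - (a *: y + b *: z) = (w - y3) +
   ((1 *: y3 + (-1) *: (a *: y1 + b *: y2))
   - (a *: (y - y1) + b *: (z - y2))) by fring.
have X4 : sX (a *: (y - y1) + b *: (z - y2)) by apply: sX_lin; exact: sXB.
have N4 : snm (a *: (y - y1) + b *: (z - y2)) <= `|a| * e + `|b| * e.
  apply: le_trans (snm_triangle (sXZ _ (sXB Xy Y1)) (sXZ _ (sXB Xz Y2))) _.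
  rewrite !snmZ; [|exact: sXB..].
  by rewrite lerD// ler_wpM2l.
have N5 : snm (1 *: x3 + (-1) *: (a *: x1 + b *: x2)) <=
    e + (`|a| * e + `|b| * e).
  have -> : 1 *: x3 + (-1) *: (a *: x1 + b *: x2) =
    (a *: (f - x1) + b *: (g - x2)) - (h - x3) by rewrite hE; fring.
  apply: le_trans (snmB_le (sX_lin _ _ (sXB Xf X1) (sXB Xg X2)) (sXB Xh X3)) _.
  rewrite addrC lerD//.
  apply: le_trans (snm_triangle (sXZ _ (sXB Xf X1)) (sXZ _ (sXB Xg X2))) _.
  rewrite !snmZ; [|exact: sXB..].
  by rewrite lerD// ler_wpM2l.
move=> N6; have := le_trans N6 (ler_wpM2l C0 N5) => {}N6.
apply: le_trans (snm_triangle (sXB Xw Y3) (sXB YY X4)) _.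
have := snmB_le YY X4.
move: N4 N6 m3; set A := snm (_ - y3); set B := snm (_ - _); set D := snm _.
set E := snm _ => h1 h2 h3 h4.
apply: le_trans (lerD h3 (le_trans h4 (lerD h2 h1))) _.
rewrite le_eqVlt; apply/orP; left; apply/eqP; ring.
Qed.

(** [G] is a relation because a vector of the dense part may be written in several ways; the bound
    in [GX] makes its values agree up to null elements. Coordinates, copies, fibre averages and
    Neumann inverses are all obtained from this extension. *)
Lemma extend_graph : exists F, bounded_op F C /\
  forall x y, G x y -> snm (F x - y) = 0.
Proof.
have /choice[F FP] : forall f, exists y, sX f -> cl f y.
  move=> f; case: (pselect (sX f)) => [/cl_total[y cy]|nf].
    by exists y.
  by exists 0.
exists F; split; last first.
  move=> x y Gxy; have [Xx Xy _] := GX Gxy.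
  have cy : cl x y.
    split=> // e e0; exists x, y; split => //.
      have -> : x - x = 0 by fring.
 by rewrite snm0 ltW.
    have -> : y - y = 0 by fring.
 by rewrite snm0 ltW.
  have c00 : x = 1 *: x + 0 *: x by fring.
  have := cl_lin Xx Xx c00 cy cy (FP _ Xx).
  by have -> : 1 *: y + 0 *: y = y by fring.
split => [f /FP[]//|f g a b Xf Xg|f Xf].
  have Xh := sX_lin a b Xf Xg.
  exact: (cl_lin Xf Xg erefl (FP _ Xf) (FP _ Xg) (FP _ Xh)).
have [XF FF] := FP _ Xf.
apply: (@le_addM_gt0 _ _ _ (1 + C)); first by rewrite addr_ge0.
move=> e e0; have [x [y [Gxy n1 n2]]] := FF _ e0.
have [Xx Xy nyx] := GX Gxy.
apply: le_trans (snm_le_sub XF Xy) _.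
have h1 : snm x <= e + snm f.
  apply: le_trans (snm_le_sub Xx Xf) _; rewrite lerD2r.
  by rewrite snmC.
have := le_trans nyx (ler_wpM2l C0 h1).
lra.
Qed.

End Extension.

(** * Inversion of [I + E] for [E] of norm at most 1/2 *)

Section Neumann.
Context {R : realType} (S : sspace R).
Variables (E : (sdom S -> R) -> (sdom S -> R)).
Hypothesis bE : bounded_op E 2^-1.

Lemma neumann : exists W, bounded_op W 2 /\
  forall f, sX f -> snm (W (f + E f) - f) = 0.
Proof.
have [EX Elin Ebd] := bE.
(* The graph of the inverse of [I + E]. The bound 2 comes from [|y| <= |x| + |y| / 2]. *)
pose G (x y : sdom S -> R) := [/\ sX x, sX y & snm (x - (y + E y)) = 0].
have GX x y : G x y -> [/\ sX x, sX y & snm y <= 2 * snm x].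
  move=> [Xx Xy h]; split => //.
  have h1 : snm (y + E y) <= snm x.
    have := snm_le_sub (sXD Xy (EX _ Xy)) Xx.
    by rewrite snmC ?h ?add0r//; exact: sXD (EX _ _).
  have := snmB_le (sXD Xy (EX _ Xy)) (EX _ Xy).
  have -> : y + E y - E y = y by fring.
  have := Ebd _ Xy; lra.
have Glin a b x y x' y' : G x y -> G x' y' ->
    G (a *: x + b *: x') (a *: y + b *: y').
  move=> [Xx Xy h] [Xx' Xy' h']; split; [exact: sX_lin..|].
  apply/eqP; rewrite eq_le snm_ge0 andbT.
  have X1 := sXB Xx (sXD Xy (EX _ Xy)).
  have X2 := sXB Xx' (sXD Xy' (EX _ Xy')).
  have X3 := sXB (EX _ (sX_lin a b Xy Xy')) (sX_lin a b (EX _ Xy) (EX _ Xy')).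
  have -> : a *: x + b *: x' - (a *: y + b *: y' + E (a *: y + b *: y')) =
    (a *: (x - (y + E y)) + b *: (x' - (y' + E y'))) -
    (E (a *: y + b *: y') - (a *: E y + b *: E y')) by fring.
  apply: le_trans (snmB_le (sX_lin a b X1 X2) X3) _.
  rewrite Elin// addr0.
  apply: le_trans (snm_triangle (sXZ _ X1) (sXZ _ X2)) _.
  by rewrite !snmZ// h h' !mulr0 addr0.
have Gdense f : sX f -> forall e, 0 < e -> exists x y, G x y /\ snm (f - x) < e.
  (* Partial sums of the Neumann series. The defect [f - (y k + E (y k))] equals the increment
     [y k.+1 - y k], whose norm is at least halved at each step. *)
  move=> Xf e e0; pose y k := iter k (fun y => f - E y) 0.
  have Xy k : sX (y k).
    by elim: k => [|k IH]; [exact: sX0|exact: sXB (EX _ IH)].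
  have dy k : snm (y k.+1 - y k) <= 2^-1 ^+ k * snm (y 1%N - y 0%N).
    elim: k => [|k IH]; first by rewrite expr0 mul1r.
    have -> : y k.+2 - y k.+1 =
        (E (1 *: y k.+1 + (-1) *: y k) - (1 *: E (y k.+1) + (-1) *: E (y k)))
        - E (1 *: y k.+1 + (-1) *: y k) by rewrite {1}/y/= -/(y _); fring.
    have XL := sX_lin 1 (-1) (Xy k.+1) (Xy k).
    have XE := EX _ XL.
    apply: le_trans (snmB_le (sXB XE (sX_lin 1 (-1) (EX _ (Xy k.+1)) (EX _ (Xy k)))) XE) _.
    rewrite Elin// add0r; apply: le_trans (Ebd _ XL) _.
    have -> : 1 *: y k.+1 + (-1) *: y k = y k.+1 - y k by fring.
    by rewrite exprS -mulrA ler_pM2l ?invr_gt0.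
  set c := snm (y 1%N - y 0%N) in dy.
  have c0 : 0 <= c by exact: snm_ge0.
  have [k hk] : exists k, 2^-1 ^+ k * c < e.
    pose n := Num.bound (c / e).
    have hn : c / e < n%:R.
      by apply: archi_boundP; apply: divr_ge0 => //; exact: ltW.
    exists n; rewrite exprVn mulrC ltr_pdivrMr ?exprn_gt0//.
    rewrite mulrC -ltr_pdivrMr//; apply: lt_le_trans hn _.
    by rewrite -natrX ler_nat ltnW// ltn_expl.
  exists (y k + E (y k)), (y k); split.
    have XX := sXD (Xy k) (EX _ (Xy k)).
    split => //.
    have -> : y k + E (y k) - (y k + E (y k)) = 0 by fring.
    exact: snm0.
  have -> : f - (y k + E (y k)) = y k.+1 - y k by rewrite {3}/y/= -/(y k); fring.
  exact: le_lt_trans hk.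
have [W [bW WG]] := extend_graph (ler0n R 2) GX Glin Gdense.
exists W; split => // f Xf; apply: WG; split => //; first exact: sXD (EX _ _).
have -> : f + E f - (f + E f) = 0 by fring.
 by exact: snm0.
Qed.

End Neumann.

(** * Averages and norms of independent sums *)

Section Averages.
Context {R : realType}.
Implicit Types (f g v : nat -> R) (phi : R -> R).

Definition avg (m : nat) f : R := m%:R^-1 * \sum_(a < m) f a.

Definition mz (m : nat) f : Prop := \sum_(a < m) f a = 0.

Lemma eq_avg m f g : (forall a, (a < m)%N -> f a = g a) -> avg m f = avg m g.
Proof. by move=> fg; congr (_ * _); apply: eq_bigr => a _; exact: fg. Qed.

Lemma le_avg m f g : (forall a, (a < m)%N -> f a <= g a) -> avg m f <= avg m g.
Proof.
by move=> fg; rewrite ler_wpM2l ?invr_ge0//; apply: ler_sum => a _; exact: fg.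
Qed.

Lemma avg_cst m c : (0 < m)%N -> avg m (fun=> c) = c.
Proof.
move=> m0; rewrite /avg sumr_const card_ord -[c *+ m]mulr_natl mulrA mulVf ?mul1r//.
by rewrite pnatr_eq0 -lt0n.
Qed.

Lemma avgD m f g : avg m (fun a => f a + g a) = avg m f + avg m g.
Proof. by rewrite /avg big_split/= mulrDr. Qed.

Lemma avgZ m c f : avg m (fun a => c * f a) = c * avg m f.
Proof. by rewrite /avg -mulr_sumr mulrCA. Qed.

Lemma avgB m f g : avg m (fun a => f a - g a) = avg m f - avg m g.
Proof. by rewrite /avg sumrB mulrBr. Qed.

Lemma avg_sum m n (F : 'I_n -> nat -> R) :
  avg m (fun a => \sum_(i < n) F i a) = \sum_(i < n) avg m (F i).
Proof. by rewrite /avg exchange_big/= mulr_sumr. Qed.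

Lemma avg_ge0 m f : (forall a, (a < m)%N -> 0 <= f a) -> 0 <= avg m f.
Proof. by move=> f0; rewrite mulr_ge0 ?invr_ge0// sumr_ge0// => a _; exact: f0. Qed.

Lemma avg_mz m f : mz m f -> avg m f = 0.
Proof. by rewrite /avg => ->; rewrite mulr0. Qed.

Lemma norm_avg m f : `|avg m f| <= avg m (fun a => `|f a|).
Proof.
rewrite normrM ger0_norm ?invr_ge0// ler_wpM2l ?invr_ge0//.
exact: ler_norm_sum.
Qed.

Lemma mz_lin m (x y : R) f g : mz m f -> mz m g ->
  mz m (fun a => x * f a + y * g a).
Proof.
by rewrite /mz big_split/= -!mulr_sumr => -> ->; rewrite !mulr0 addr0.
Qed.

Lemma mz0 m : mz m (fun=> 0).
Proof. by rewrite /mz big1. Qed.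

(* Convexity is recorded as the existence of supporting lines, which is stable
   under translation and averaging. *)
Definition supported phi : Prop :=
  forall t0, exists s, forall t, phi t0 + s * (t - t0) <= phi t.

Lemma supported_shift phi x : supported phi -> supported (fun t => phi (t + x)).
Proof.
move=> sphi t0; have [s hs] := sphi (t0 + x); exists s => t.
by apply: le_trans (hs (t + x)); rewrite lerD2l opprD addrACA subrr addr0.
Qed.

Lemma supported_avg m (P : nat -> R -> R) :
  (forall a, supported (P a)) -> supported (fun t => avg m (P^~ t)).
Proof.
move=> sP t0; have /choice[s hs] := fun a => sP a t0.
exists (avg m s) => t; rewrite mulrC -avgZ -avgD; apply: le_avg => a _.
by apply: le_trans (hs a t); rewrite lerD2l mulrC.
Qed.

Lemma jensen m phi f : (0 < m)%N -> supported phi ->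
  phi (avg m f) <= avg m (fun a => phi (f a)).
Proof.
move=> m0 sphi; have [s hs] := sphi (avg m f).
apply: (@le_trans _ _ (avg m (fun a => phi (avg m f) + s * (f a - avg m f)))).
  rewrite avgD avg_cst// avgZ.
  have -> : avg m (fun a => f a - avg m f) = 0.
    by rewrite avgD avg_cst// subrr.
  by rewrite mulr0 addr0.
by apply: le_avg => a _; exact: hs.
Qed.

Lemma jensen_mz m phi f t : (0 < m)%N -> supported phi -> mz m f ->
  phi t <= avg m (fun a => phi (t + f a)).
Proof.
move=> m0 sphi mf.
have := @jensen m phi (fun a => t + f a) m0 sphi.
by rewrite avgD avg_cst// (avg_mz mf) addr0.
Qed.

Definition equidistributed (L m : nat) (rho : nat -> nat) : Prop :=
  (forall a, (a < L)%N -> (rho a < m)%N) /\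
  forall c, (c < m)%N -> \sum_(a < L) (rho a == c)%:R = L%:R / m%:R :> R.

(** For fibres of equal size this is the average of [f] over the fibre above [c], the conditional
    expectation given [rho]. *)
Definition cexp (L m : nat) (rho : nat -> nat) f (c : nat) : R :=
  m%:R * avg L (fun a => f a * (rho a == c)%:R).

Lemma sum_fibres L m rho f : (forall a, (a < L)%N -> (rho a < m)%N) ->
  \sum_(a < L) f a = \sum_(c < m) \sum_(a < L) f a * (rho a == c)%:R.
Proof.
move=> rm; rewrite exchange_big/=; apply: eq_bigr => a _.
rewrite -mulr_sumr (bigD1 (Ordinal (rm _ (ltn_ord a))))//= eqxx.
rewrite big1 ?addr0 ?mulr1// => c /eqP ca.
by case: eqP => // ac; case: ca; exact: val_inj.
Qed.

Lemma avg_comp L m rho v : (0 < L)%N -> equidistributed L m rho ->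
  avg L (fun a => v (rho a)) = avg m v.
Proof.
move=> L0 [rm req].
rewrite /avg (@sum_fibres L m rho (fun a => v (rho a)))//.
have -> : \sum_(c < m) \sum_(a < L) v (rho a) * (rho a == c)%:R =
    \sum_(c < m) v c * (L%:R / m%:R).
  apply: eq_bigr => c _; rewrite -(req c (ltn_ord c)) mulr_sumr; apply: eq_bigr => a _.
  by case: eqP => [->//|]; rewrite !mulr0.
have L0' : L%:R != 0 :> R by rewrite pnatr_eq0 -lt0n.
by rewrite -mulr_suml mulrCA [L%:R^-1 * _]mulrA mulVf// mul1r mulrC.
Qed.

Lemma cexp_comp L m rho v c : (0 < L)%N -> (0 < m)%N -> (c < m)%N ->
  equidistributed L m rho ->
  cexp L m rho (fun a => v (rho a)) c = v c.
Proof.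
move=> L0 m0 cm [rm req]; rewrite /cexp /avg.
have -> : \sum_(a < L) v (rho a) * (rho a == c)%:R = v c * (L%:R / m%:R).
  rewrite -(req _ cm) mulr_sumr; apply: eq_bigr => a _.
  by case: eqP => [->//|]; rewrite !mulr0.
by field; rewrite !pnatr_eq0 -!lt0n L0 m0.
Qed.

Lemma cexp_mz L m rho f : (forall a, (a < L)%N -> (rho a < m)%N) ->
  mz L f -> mz m (cexp L m rho f).
Proof.
move=> rm; rewrite /mz /cexp (@sum_fibres L m rho f)// => h.
by rewrite -mulr_sumr /avg -mulr_sumr h !mulr0.
Qed.

Lemma mz_comp L m rho v : (0 < L)%N -> (0 < m)%N -> equidistributed L m rho ->
  mz m v -> mz L (fun a => v (rho a)).
Proof.
move=> L0 m0 er mv; have := avg_comp v L0 er; rewrite (avg_mz mv) /avg.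
move/eqP; rewrite mulf_eq0 invr_eq0 pnatr_eq0 gtn_eqF//=.
by move/eqP.
Qed.

(** Jensen's inequality on each fibre, with the supporting line taken at the fibre average. The
    shift [t] holds the blocks that are already fixed. *)
Lemma jensen_fibres L m rho phi f t : (0 < L)%N -> (0 < m)%N ->
  equidistributed L m rho -> supported phi ->
  avg m (fun c => phi (t + cexp L m rho f c)) <= avg L (fun a => phi (t + f a)).
Proof.
move=> L0 m0 [rm req] sphi.
have L0' : L%:R != 0 :> R by rewrite pnatr_eq0 -lt0n.
have m0' : m%:R != 0 :> R by rewrite pnatr_eq0 -lt0n.
rewrite /avg [X in _ <= _ * X](@sum_fibres L m rho (fun a => phi (t + f a)))// !mulr_sumr.
apply: ler_sum => c _; set A := cexp _ _ _ _ _.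
have [s hs] := sphi (t + A).
have := ltn_ord c => cm.
rewrite -(@ler_pM2l _ L%:R) ?ltr0n// mulrA [X in _ <= X]mulrA mulfV// mul1r.
have -> : L%:R / m%:R * phi (t + A) =
   \sum_(a < L) (phi (t + A) + s * (t + f a - (t + A))) * (rho a == c)%:R.
  transitivity (\sum_(a < L) (phi (t + A) * (rho a == c)%:R +
      (s * (f a * (rho a == c)%:R) - s * A * (rho a == c)%:R))).
    rewrite !big_split/= sumrN -!mulr_sumr req// /A /cexp /avg.
    by field; rewrite L0' m0'.
  by apply: eq_bigr => a _; ring.
by apply: ler_sum => a _; rewrite ler_wpM2r.
Qed.

(** The slope at [t0] is the derivative [p |t0|^(p-1) sgn t0], and the inequality is Young's for
    [|t0|^(p-1)] and [|t|] with exponents [p / (p - 1)] and [p]. *)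
Lemma supported_powR (p : R) : 1 < p -> supported (fun t => `|t| `^ p).
Proof.
move=> p1 t0; have p0 : 0 < p by lra.
have p0' : p != 0 by rewrite gt_eqF.
exists (p * `|t0| `^ (p - 1) * Num.sg t0) => t.
have q0 : 0 < p / (p - 1) by rewrite divr_gt0//; lra.
have h : (p / (p - 1))^-1 + p^-1 = 1.
  by rewrite invf_div; field.
have := conjugate_powR (powR_ge0 `|t0| (p - 1)) (normr_ge0 t) q0 p0 h.
rewrite -powRrM.
have -> : (p - 1) * (p / (p - 1)) = p by field; lra.
rewrite invf_div => {}h.
have h2 : Num.sg t0 * t <= `|t|.
  case: (sgrP t0) => _; rewrite ?mul0r ?mul1r ?mulN1r//.
    exact: ler_norm.
  by rewrite -normrN ler_norm.
have h3 : `|t0| `^ (p - 1) * (Num.sg t0 * t0) = `|t0| `^ p.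
  by rewrite -normrEsg mulrC mulr_powRB1.
have h4 : `|t0| `^ (p - 1) * (Num.sg t0 * t) <= `|t0| `^ (p - 1) * `|t|.
  by rewrite ler_wpM2l ?powR_ge0.
have -> : p * `|t0| `^ (p - 1) * Num.sg t0 * (t - t0) =
  p * (`|t0| `^ (p - 1) * (Num.sg t0 * t)) -
  p * (`|t0| `^ (p - 1) * (Num.sg t0 * t0)) by ring.
rewrite h3.
have := le_trans h4 h; rewrite -(ler_pM2l p0) => h5.
rewrite addrA addrAC -lerBrDl opprB.
apply: (le_trans h5); rewrite le_eqVlt; apply/orP; left; apply/eqP.
by field.
Qed.

End Averages.

(** * Moments of sums of independent blocks *)

Section Phi.
Context {R : realType} (p : R).
Hypothesis p1 : 1 < p.
Implicit Types (G : nat -> nat -> R).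

(** Haar functions of levels at most [n] are constant on the [2^(n+1)] dyadic intervals of the next
    level, so block [n], counted from 0, lives on that many points. *)
Definition sz (n : nat) : nat := (2 ^ n.+1)%N.

Lemma sz_gt0 n : (0 < sz n)%N.
Proof. by rewrite expn_gt0. Qed.

(* [Phi G M t] is the expectation of [|t + sum_(n < M) G n (y n)| ^ p] for
   independent [y n] uniform in [0, sz n). *)
Fixpoint Phi G (M : nat) (t : R) : R :=
  if M is M'.+1 then avg (sz M') (fun a => Phi G M' (t + G M' a))
  else `|t| `^ p.

Definition mzG G : Prop := forall n, mz (sz n) (G n).

Lemma supported_Phi G M : supported (Phi G M).
Proof.
elim: M => [|M IH] /=; first exact: supported_powR.
by apply: supported_avg => a; exact: supported_shift.
Qed.

Lemma eq_Phi G G' M t :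
  (forall n a, (n < M)%N -> (a < sz n)%N -> G n a = G' n a) ->
  Phi G M t = Phi G' M t.
Proof.
elim: M t => //= M IH t GG; apply: eq_avg => a aM.
by rewrite GG// IH// => n b nM; apply: GG; exact: ltnW.
Qed.

Lemma Phi_leS G M t : mz (sz M) (G M) -> Phi G M t <= Phi G M.+1 t.
Proof. by move=> mG; apply: jensen_mz => //; [exact: sz_gt0|exact: supported_Phi]. Qed.

Lemma Phi_le G M M' t : mzG G -> (M <= M')%N -> Phi G M t <= Phi G M' t.
Proof.
move=> mG; elim: M' => [|M' IH]; first by rewrite leqn0 => /eqP->.
rewrite leq_eqVlt => /orP[/eqP->//|/IH h].
exact: le_trans h (Phi_leS _ _).
Qed.

Lemma Phi_zero G M M' t : (M <= M')%N ->
  (forall n a, (M <= n)%N -> (n < M')%N -> (a < sz n)%N -> G n a = 0) ->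
  Phi G M' t = Phi G M t.
Proof.
elim: M' => [|M' IH]; first by rewrite leqn0 => /eqP->.
rewrite leq_eqVlt => /orP[/eqP->//|MM'] G0 /=.
rewrite -IH//; last by move=> n a h1 h2; apply: G0 => //; exact: ltnW.
rewrite -[RHS](@avg_cst _ (sz M') _ (sz_gt0 M')); apply: eq_avg => a aM.
by rewrite G0// addr0.
Qed.

(** Discarding blocks is a conditional expectation: an independent mean-zero block can only raise a
    convex moment. *)
Lemma Phi_select G (P : pred nat) M t : mzG G ->
  Phi (fun n a => if P n then G n a else 0) M t <= Phi G M t.
Proof.
move=> mG; elim: M t => //= M IH t; case PM: (P M).
  by apply: le_avg => a _; exact: IH.
rewrite (@eq_avg _ _ _ (fun=> Phi (fun n a => if P n then G n a else 0) M t)).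
  rewrite avg_cst ?sz_gt0//; apply: le_trans (IH t) _.
  exact: Phi_leS.
by move=> a _; rewrite addr0.
Qed.

Lemma Phi_single (N : nat) (f : nat -> R) M : (N < M)%N ->
  Phi (fun n a => if n == N then f a else 0) M 0 =
  avg (sz N) (fun a => `|f a| `^ p).
Proof.
move=> NM; rewrite (@Phi_zero _ N.+1)//; last first.
  by move=> n a; rewrite ltn_neqAle eq_sym => /andP[/negbTE->].
rewrite /= eqxx; apply: eq_avg => a _; rewrite add0r.
rewrite (@Phi_zero _ 0)//= => n b _ nN _.
by rewrite ltn_eqF.
Qed.

(** For injective [N] the sum has at most one term; it avoids inverting [N]. *)
Definition upG (N : nat -> nat) (rho : nat -> nat -> nat) (M : nat) G
    (k a : nat) : R :=
  \sum_(n < M | N n == k) G n (rho n a).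

Definition downG (N : nat -> nat) (rho : nat -> nat -> nat) G (n : nat) :
    nat -> R :=
  cexp (sz (N n)) (sz n) (rho n) (G (N n)).

Section Copies.
Variables (N : nat -> nat) (rho : nat -> nat -> nat).
Hypothesis Nincr : forall i j, (i < j)%N -> (N i < N j)%N.
Hypothesis rhoE : forall n, @equidistributed R (sz (N n)) (sz n) (rho n).

Lemma N_inj i j : N i = N j -> i = j.
Proof.
by case: (ltngtP i j) => // /Nincr; rewrite ltn_neqAle => /andP[/eqP + _ H];
   rewrite H.
Qed.

Lemma N_ge n : (n <= N n)%N.
Proof. by elim: n => // n IH; apply: leq_ltn_trans IH (Nincr _). Qed.

Lemma upG_N M G n a : (n < M)%N -> upG N rho M G (N n) a = G n (rho n a).
Proof.
move=> nM; rewrite /upG (big_pred1 (Ordinal nM))// => i /=.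
by apply/eqP/eqP => [/N_inj ?|->//]; exact: val_inj.
Qed.

Lemma upG_notN M G k a : (forall n, (n < M)%N -> N n != k) ->
  upG N rho M G k a = 0.
Proof. by move=> h; rewrite /upG big_pred0// => i; apply/negbTE/h. Qed.

(** An equidistributed [rho n] carries the uniform law to the uniform law, so the copies are
    independent with the laws of the original blocks; the blocks in between vanish. *)
Lemma Phi_up G M k t : (forall n, (n < M)%N -> (N n < k)%N) ->
  Phi (upG N rho M G) k t = Phi G M t.
Proof.
elim: M k t => [|M IH] k t Nk.
  rewrite (@Phi_zero _ 0)// => n a _ _ _; exact: upG_notN.
rewrite (@Phi_zero _ (N M).+1)//; [|exact: Nk|]; last first.
  move=> n a Nn _ _; apply: upG_notN => i; rewrite ltnS leq_eqVlt.
  move=> /orP[/eqP->|/Nincr iM]; rewrite ltn_eqF//.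
  exact: ltn_trans iM Nn.
rewrite /=; under eq_avg => a aN.
  rewrite upG_N//.
  rewrite (@eq_Phi _ (upG N rho M G)); last first.
    move=> n b nN _; rewrite /upG big_mkcond [RHS]big_mkcond big_ord_recr/=.
    by rewrite gtn_eqF// addr0.
  rewrite IH; last by move=> n /Nincr.
  over.
by rewrite (@avg_comp _ _ (sz M) (rho M) (fun c => Phi G M (t + G M c)))// sz_gt0.
Qed.

(** Blocks outside the range of [N] are averaged out and the others are averaged over fibres;
    neither step raises a convex moment. *)
Lemma Phi_down G M k t : mzG G -> (forall n, (n < M)%N -> (N n < k)%N) ->
  Phi (downG N rho G) M t <= Phi G k t.
Proof.
move=> mG; elim: M k t => [|M IH] k t Nk.
  have /= := @Phi_le G 0 k t mG; exact.
apply: le_trans (@Phi_le G (N M).+1 k t mG (Nk _ (ltnSn _))) => /=.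
apply: le_trans (jensen_fibres (G (N M)) t (sz_gt0 _) (sz_gt0 M) (rhoE M)
  (supported_Phi _ _)).
by apply: le_avg => a _; apply: IH => n /Nincr.
Qed.

End Copies.

End Phi.

(** * Random permutations *)

Section RandomPermutations.
Context {R : realType} (K s : nat).
Hypothesis s1 : (1 < s)%N.

Local Notation perms := {perm 'I_s}.
Local Notation sample := {ffun 'I_K -> {perm 'I_s}}.
Implicit Types (g : sample) (v w : 'I_s -> R).

Let s0 : (0 < s)%N. Proof. exact: ltnW. Qed.

Let s0' : s%:R != 0 :> R. Proof. by rewrite pnatr_eq0 -lt0n. Qed.

Let perms0 : #|{: perms}|%:R != 0 :> R.
Proof. by rewrite pnatr_eq0 -lt0n; apply/card_gt0P; exists 1%g. Qed.

Definition ffset g k (sg : perms) : sample :=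
  [ffun i => if i == k then sg else g i].

(** Fubini in coordinate [k], by group invariance: multiplying this coordinate by [sg] permutes the
    samples, and summing over [sg] produces the vanishing inner sums. *)
Lemma sum_sample_eq0 k (F : sample -> R) :
  (forall g, \sum_sg F (ffset g k sg) = 0) -> \sum_(g : sample) F g = 0.
Proof.
move=> F0; pose h sg g := ffset g k (sg * g k)%g.
have hinj sg : injective (h sg).
  move=> g g' /ffunP gg; apply/ffunP => i; have := gg i; rewrite !ffunE.
  by case: eqP => [-> /mulgI|].
have E sg : \sum_(g : sample) F g = \sum_(g : sample) F (h sg g) by rewrite (reindex_inj (hinj sg)).
apply: (mulfI perms0); rewrite mulr0.
transitivity (\sum_(sg : perms) \sum_(g : sample) F (h sg g)).
  rewrite mulr_natl -sumr_const; apply: eq_bigr => sg _; exact: E.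
rewrite exchange_big big1//= => g _.
rewrite -[RHS](F0 g) [RHS](reindex_inj (mulIg (g k))).
by apply: eq_bigr.
Qed.

Lemma sum_sqr_independent (y : 'I_K -> perms -> R) :
  (forall k, \sum_sg y k sg = 0) ->
  \sum_(g : sample) (\sum_k y k (g k)) ^+ 2 = \sum_(g : sample) \sum_k y k (g k) ^+ 2.
Proof.
move=> y0.
transitivity (\sum_(g : sample) \sum_k \sum_l y k (g k) * y l (g l)).
  by apply: eq_bigr => g _; rewrite expr2 mulr_suml; apply: eq_bigr => k _;
     rewrite mulr_sumr.
rewrite exchange_big [RHS]exchange_big/=; apply: eq_bigr => k _.
rewrite exchange_big (bigD1 k)//= [X in _ + X]big1 ?addr0//.
move=> l lk; apply: (sum_sample_eq0 (k := k)) => g.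
under eq_bigr => sg _ do rewrite !ffunE eqxx (negbTE lk).
by rewrite -mulr_suml y0 mul0r.
Qed.

(** The terms have mean zero in each variable, so two of them are orthogonal unless they involve the
    same unordered pair of coordinates. The term of [(k, l)] meets only itself and that of [(l, k)],
    which costs the factor 2. *)
Lemma sum_sqr_degenerate (z : 'I_K -> 'I_K -> perms -> perms -> R) :
  (forall k l tau, \sum_sg z k l sg tau = 0) ->
  (forall k l sg, \sum_tau z k l sg tau = 0) ->
  \sum_(g : sample) (\sum_k \sum_(l | l != k) z k l (g k) (g l)) ^+ 2 <=
  2 * \sum_(g : sample) \sum_k \sum_l z k l (g k) (g l) ^+ 2.
Proof.
move=> z1 z2; pose x g (e : 'I_K * 'I_K) := z e.1 e.2 (g e.1) (g e.2).
pose sw (e : 'I_K * 'I_K) := (e.2, e.1).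
have xE g : \sum_k \sum_(l | l != k) z k l (g k) (g l) =
    \sum_(e : 'I_K * 'I_K | e.2 != e.1) x g e.
  by rewrite pair_big_dep/=; apply: eq_bigl => -[].
have vanish (e e' : 'I_K * 'I_K) : e.2 != e.1 -> e'.2 != e'.1 ->
    e' != e -> e' != sw e -> \sum_(g : sample) x g e * x g e' = 0.
  move: e e' => [k l] [k' l']; rewrite /sw/= => lk lk' n1 n2.
  (* As the unordered pairs differ, [k] or [l] does not occur in [e']; that coordinate is summed
     out. *)
  have [kk'|] := boolP ((k != k') && (k != l')).
    apply: (sum_sample_eq0 (k := k)) => g; rewrite /x/=.
    under eq_bigr => sg _.
      rewrite !ffunE eqxx (negbTE lk) ![_ == k]eq_sym.
      case/andP: kk' => /negbTE-> /negbTE->; over.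
    by rewrite -mulr_suml z1 mul0r.
  rewrite negb_and !negbK => kk'.
  have ll' : (l != k') && (l != l').
    apply/andP; split; apply/eqP => ll.
      move: kk'; rewrite -ll eq_sym (negbTE lk)/= => /eqP kl.
      by move: n2; rewrite -ll kl eqxx.
    move: kk'; rewrite -ll [k == l]eq_sym (negbTE lk) orbF => /eqP kk.
    by move: n1; rewrite -ll -kk eqxx.
  apply: (sum_sample_eq0 (k := l)) => g; rewrite /x/=.
  under eq_bigr => sg _.
    rewrite !ffunE eqxx [k == l]eq_sym (negbTE lk) ![_ == l]eq_sym.
    case/andP: ll' => /negbTE-> /negbTE->; over.
  by rewrite -mulr_suml z2 mul0r.
under eq_bigr do rewrite xE.
apply: (@le_trans _ _ (\sum_(g : sample) \sum_(e : 'I_K * 'I_K | e.2 != e.1)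
    (x g e * x g e + x g e * x g (sw e)))); first last.
  rewrite mulr_sumr; apply: ler_sum => g _; rewrite mulr_sumr.
  have -> : \sum_(i < K) 2 * \sum_(l < K) z i l (g i) (g l) ^+ 2 =
      2 * \sum_(e : 'I_K * 'I_K) x g e ^+ 2.
    by rewrite -mulr_sumr pair_bigA.
  have h2 : \sum_(e : 'I_K * 'I_K | e.2 != e.1) x g (sw e) ^+ 2 =
      \sum_(e : 'I_K * 'I_K | e.2 != e.1) x g e ^+ 2.
    rewrite [RHS](reindex_inj (h := sw)) /=; last by move=> [a b] [c d] [-> ->].
    by apply: eq_bigl => -[a b]/=; rewrite eq_sym.
  apply: (@le_trans _ _ (2 * \sum_(e : 'I_K * 'I_K | e.2 != e.1) x g e ^+ 2)).
    rewrite [X in _ <= X](_ : _ = \sum_(e : 'I_K * 'I_K | e.2 != e.1)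
      (x g e ^+ 2 + (x g e ^+ 2 + x g (sw e) ^+ 2) / 2)).
      apply: ler_sum => e _; have := sqr_ge0 (x g e - x g (sw e)).
      by rewrite !expr2; lra.
    by rewrite big_split/= -mulr_suml big_split/= h2; field.
  rewrite ler_wpM2l// [X in _ <= X](bigID (fun e : 'I_K * 'I_K => e.2 != e.1))/=.
  by rewrite lerDl sumr_ge0// => e _; exact: sqr_ge0.
rewrite le_eqVlt; apply/orP; left; apply/eqP.
under eq_bigr do rewrite expr2 mulr_suml.
rewrite exchange_big [RHS]exchange_big/=; apply: eq_bigr => e ee.
under eq_bigr do rewrite mulr_sumr.
rewrite exchange_big big_split/= (bigD1 e)//=; congr (_ + _).
have swe : sw e != e by apply: contra ee => /eqP/(congr1 fst)/= ->.
rewrite (bigD1 (sw e))/=; last by rewrite eq_sym ee.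
rewrite [X in _ + X]big1 ?addr0// => e' /andP[/andP[? ?] ?].
exact: vanish.
Qed.

(** By transitivity the sum does not depend on [c], and its total over all [c] is 0. *)
Lemma sum_perm_eq0 v c : \sum_x v x = 0 -> \sum_(sg : perms) v (sg c) = 0.
Proof.
move=> v0; have E d : \sum_(sg : perms) v (sg c) = \sum_(sg : perms) v (sg d).
  rewrite (reindex_inj (mulgI (tperm c d)))/=.
  by apply: eq_bigr => sg _; rewrite permM tpermL.
apply: (mulfI s0'); rewrite mulr0.
transitivity (\sum_(d < s) \sum_(sg : perms) v (sg d)).
  rewrite [RHS](eq_bigr (fun=> \sum_(sg : perms) v (sg c))).
    by rewrite sumr_const card_ord mulr_natl.
  by move=> d _; rewrite -E.
rewrite exchange_big big1//= => sg _.
by rewrite -[RHS]v0 [RHS](reindex_inj (@perm_inj _ sg)).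
Qed.

Lemma sum_linear_perm v (psi : 'I_K -> 'I_s -> R) (Y : R) : \sum_x v x = 0 ->
  (forall g, \sum_k (\sum_c psi k c * v (g k c)) ^+ 2 <= Y) ->
  \sum_(g : sample) (\sum_k \sum_c psi k c * v (g k c)) ^+ 2 <= #|{: sample}|%:R * Y.
Proof.
move=> v0 hY.
rewrite (sum_sqr_independent (y := fun k sg => \sum_c psi k c * v (sg c))).
  rewrite mulr_natl -sumr_const; apply: ler_sum => g _; exact: hY.
move=> k; rewrite exchange_big big1//= => c _.
by rewrite -mulr_sumr sum_perm_eq0 ?mulr0.
Qed.

(* The symmetric group is 2-transitive, so a bilinear form averaged over it is
   a multiple of the inner product on mean-zero vectors. *)
Definition avg_scalar (b : 'I_s -> 'I_s -> R) : R :=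
  s%:R^-1 * (\sum_c b c c - (s.-1)%:R^-1 * \sum_c \sum_(d | d != c) b c d).

(** The correlation [T c d] depends only on whether [c = d]. Its diagonal value is the inner product
    times the number of permutations over [s]; since the rows of [T] sum to 0, the other value is
    [-1 / (s - 1)] times this one. *)
Lemma sum_perm_bilinear (b : 'I_s -> 'I_s -> R) w v :
  \sum_x w x = 0 -> \sum_x v x = 0 ->
  \sum_(sg : perms) \sum_c \sum_d b c d * (w (sg c) * v (sg d)) =
  #|{: perms}|%:R * (avg_scalar b * \sum_x w x * v x).
Proof.
move=> w0 v0; pose T c d := \sum_(sg : perms) w (sg c) * v (sg d).
have TJ (pi : perms) c d : T c d = T (pi c) (pi d) :> R.
  rewrite {2}/T (reindex_inj (mulgI (pi^-1)%g))/=.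
  by apply: eq_bigr => sg _; rewrite !permM !permK.
have s1' : s.-1%:R != 0 :> R by rewrite pnatr_eq0 -lt0n -subn1 subn_gt0.
set ip := \sum_x w x * v x.
have Tdiag c : T c c = #|{: perms}|%:R / s%:R * ip.
  have E d : T c c = T d d by rewrite (TJ (tperm c d)) tpermL.
  apply: (mulfI s0').
  transitivity (\sum_(d < s) T d d).
    rewrite [RHS](eq_bigr (fun=> T c c)); last by move=> d _; rewrite -E.
    by rewrite sumr_const card_ord mulr_natl.
  rewrite /T exchange_big/=.
  transitivity (\sum_(sg : perms) ip).
    by apply: eq_bigr => sg _; rewrite /ip [RHS](reindex_inj (@perm_inj _ sg)).
  by rewrite sumr_const -mulr_natl; field.
have Toff c d : d != c -> T c d = - (s.-1%:R^-1 * (#|{: perms}|%:R / s%:R * ip)).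
  move=> dc; have E e : e != c -> T c d = T c e.
    by move=> ec; rewrite (TJ (tperm d e)) tpermL tpermD.
  apply: (mulfI s1'); rewrite mulrN mulVKf// -(Tdiag c).
  have : \sum_e T c e = 0.
    rewrite /T exchange_big big1//= => sg _; rewrite -mulr_sumr.
    by rewrite -[X in _ * X](reindex_inj (P := xpredT) (F := v) (@perm_inj _ sg)) v0 mulr0.
  rewrite (bigD1 c)//= => /eqP; rewrite addr_eq0 => /eqP->; rewrite opprK.
  under eq_bigr => e ec do rewrite -(E e ec).
  rewrite sumr_const mulr_natl; congr (_ *+ _).
  by have := cardC1 c; rewrite card_ord => <-; apply: eq_card => e; rewrite !inE.
rewrite exchange_big/=.
transitivity (\sum_c (b c c * T c c + \sum_(d | d != c) b c d * T c d)).
  apply: eq_bigr => c _; rewrite exchange_big (bigD1 c)//=.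
  by congr (_ + _); rewrite ?mulr_sumr//; apply: eq_bigr => d _; rewrite mulr_sumr.
rewrite big_split/=.
under eq_bigr do rewrite Tdiag.
under [X in _ + X]eq_bigr => c _.
  under eq_bigr => d dc do rewrite (Toff c d dc).
  rewrite -mulr_suml; over.
rewrite -!mulr_suml /avg_scalar.
by field; rewrite s0' s1'.
Qed.

Section Bilinear.
Variable theta : 'I_K -> 'I_s -> 'I_K -> 'I_s -> R.

Definition blk w v k l (sg tau : perms) : R :=
  \sum_c \sum_d theta k c l d * (w (sg c) * v (tau d)).

(** Only pairs [k = l] enter: for distinct groups the permutations are independent, and the mean
    vanishes on mean-zero vectors. *)
Definition mean_scalar : R := \sum_k avg_scalar (fun c d => theta k c k d).

Lemma blk_sum_perm w v : \sum_x w x = 0 -> \sum_x v x = 0 ->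
  \sum_k \sum_sg blk w v k k sg sg =
  #|{: perms}|%:R * (mean_scalar * \sum_x w x * v x).
Proof.
move=> w0 v0; rewrite /blk.
under eq_bigr => k _.
  rewrite (sum_perm_bilinear (fun c d => theta k c k d) w0 v0); over.
by rewrite -mulr_sumr -mulr_suml.
Qed.

(** The diagonal terms, once centred, are independent and contribute at most [Y]; the off-diagonal
    ones are degenerate and contribute at most [2 * Y]. The inequality [(D + O)^2 <= 2 D^2 + 2 O^2]
    then gives [2 + 4 = 6]. *)
Lemma sum_bilinear_perm w v (Y : R) : \sum_x w x = 0 -> \sum_x v x = 0 ->
  (forall g, \sum_k \sum_l blk w v k l (g k) (g l) ^+ 2 <= Y) ->
  \sum_(g : sample) (\sum_k \sum_l blk w v k l (g k) (g l)
      - mean_scalar * \sum_x w x * v x) ^+ 2 <=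
  #|{: sample}|%:R * (6 * Y).
Proof.
move=> w0 v0 hY; set ip := \sum_x w x * v x.
pose m k := #|{: perms}|%:R^-1 * \sum_sg blk w v k k sg sg.
have mE : \sum_k m k = mean_scalar * ip.
  by rewrite -mulr_sumr blk_sum_perm// mulKf.
pose y k sg := blk w v k k sg sg - m k.
have y0 k : \sum_sg y k sg = 0.
  rewrite /y big_split/= sumr_const -[X in _ + X]mulr_natl /m.
  by field.
pose D g := \sum_k y k (g k).
pose O g := \sum_k \sum_(l | l != k) blk w v k l (g k) (g l).
have split g : \sum_k \sum_l blk w v k l (g k) (g l) - mean_scalar * ip =
    D g + O g.
  rewrite -mE /D /O -sumrB -big_split/=; apply: eq_bigr => k _.
  by rewrite (bigD1 k)//= /y addrAC.
under eq_bigr do rewrite split.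
have cY : \sum_(g : sample) \sum_k \sum_l blk w v k l (g k) (g l) ^+ 2 <=
    #|{: sample}|%:R * Y.
  by rewrite mulr_natl -sumr_const; apply: ler_sum => g _; exact: hY.
have hO : \sum_(g : sample) O g ^+ 2 <= 2 * (#|{: sample}|%:R * Y).
  apply: le_trans (sum_sqr_degenerate _ _) _; last by rewrite ler_wpM2l.
  - move=> k l tau; rewrite /blk exchange_big big1//= => c _.
    rewrite exchange_big big1//= => d _.
    rewrite -mulr_sumr -mulr_suml.
    by rewrite sum_perm_eq0// mul0r mulr0.
  - move=> k l tau; rewrite /blk exchange_big big1//= => c _.
    rewrite exchange_big big1//= => d _.
    rewrite -mulr_sumr -mulr_sumr.
    by rewrite sum_perm_eq0// !mulr0.
have hD : \sum_(g : sample) D g ^+ 2 <= #|{: sample}|%:R * Y.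
  rewrite /D sum_sqr_independent//; apply: le_trans cY.
  rewrite exchange_big [X in _ <= X]exchange_big/=; apply: ler_sum => k _.
  apply: (@le_trans _ _ (\sum_(g : sample) blk w v k k (g k) (g k) ^+ 2)); last first.
    apply: ler_sum => g _; rewrite (bigD1 k)//= lerDl sumr_ge0// => l _.
    exact: sqr_ge0.
  have Ey : \sum_(g : sample) y k (g k) = 0.
    apply: (sum_sample_eq0 (k := k)) => g.
    by under eq_bigr => sg _ do rewrite !ffunE eqxx; exact: y0.
  have -> : \sum_(g : sample) blk w v k k (g k) (g k) ^+ 2 =
      \sum_(g : sample) (y k (g k) ^+ 2 + (2 * m k * y k (g k) + m k ^+ 2)).
    by apply: eq_bigr => g _; rewrite /y; ring.
  rewrite !big_split/= -mulr_sumr Ey mulr0 add0r lerDl sumr_ge0// => g _.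
  exact: sqr_ge0.
apply: (@le_trans _ _ (\sum_(g : sample) (2 * D g ^+ 2 + 2 * O g ^+ 2))).
  apply: ler_sum => g _; have := sqr_ge0 (D g - O g); rewrite !expr2; lra.
rewrite big_split/= -!mulr_sumr; lra.
Qed.

End Bilinear.

(** Chebyshev's inequality with a union bound: if every sample failed for some [i], the mean of the
    sum of squares over [i] would be at least [e ^+ 2]. *)
Lemma exists_all_small (I : finType) (W : I -> sample -> R) (Y e : R) : 0 < e ->
  (forall i, \sum_(g : sample) W i g ^+ 2 <= #|{: sample}|%:R * Y) ->
  #|I|%:R * Y < e ^+ 2 ->
  exists g, forall i, `|W i g| <= e.
Proof.
move=> e0 hW hY; apply: contrapT => no.
have c0 : 0 < #|{: sample}|%:R :> R.
  by rewrite ltr0n; apply/card_gt0P; exists [ffun=> 1%g].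
have big g : e ^+ 2 <= \sum_i W i g ^+ 2.
  have [i hi] : exists i, e < `|W i g|.
    apply: contrapT => nn; apply: no; exists g => i.
    by rewrite leNgt; apply/negP => hi; apply: nn; exists i.
  rewrite (bigD1 i)//=.
  apply: (@le_trans _ _ (W i g ^+ 2)).
    by rewrite -[X in _ <= X]real_normK ?num_real// lerXn2r ?nnegrE// ltW.
  by rewrite lerDl sumr_ge0// => j _; exact: sqr_ge0.
have : #|{: sample}|%:R * e ^+ 2 <= #|{: sample}|%:R * (#|I|%:R * Y).
  apply: (@le_trans _ _ (\sum_(g : sample) \sum_i W i g ^+ 2)).
    by rewrite mulr_natl -sumr_const; apply: ler_sum => g _; exact: big.
  rewrite exchange_big/=.
  apply: (@le_trans _ _ (\sum_(i : I) #|{: sample}|%:R * Y)).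
    by apply: ler_sum => i _; exact: hW.
  by rewrite sumr_const mulrCA -[X in X <= _]mulr_natl.
by rewrite ler_pM2l// leNgt hY.
Qed.

End RandomPermutations.

(** * Spaces with independent blocks *)

Section BoundedOp.
Context {R : realType} {S1 S2 : sspace R}.

Lemma snm_sub0 (S : sspace R) (f g : sdom S -> R) : sX f -> sX g ->
  snm (f - g) = 0 -> snm f = snm g.
Proof.
move=> Xf Xg h; apply/eqP; rewrite eq_le.
have := snm_le_sub Xf Xg; have := snm_le_sub Xg Xf.
by rewrite snmC// h !add0r => -> ->.
Qed.

Lemma bounded_opB (F : (sdom S1 -> R) -> sdom S2 -> R) C f g :
  bounded_op F C -> sX f -> sX g -> snm (F f - F g) <= C * snm (f - g).
Proof.
move=> [FX Flin Fbd] Xf Xg.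
have XL := sX_lin 1 (-1) Xf Xg.
have h := Flin f g 1 (-1) Xf Xg.
have e1 : 1 *: f + (-1) *: g = f - g by fring.
have e2 : 1 *: F f + (-1) *: F g = F f - F g by fring.
rewrite e1 e2 in h; rewrite -(snm_sub0 _ _ h).
- by apply: Fbd; exact: sXB.
- by apply: FX; exact: sXB.
- by apply: sXB; exact: FX.
Qed.

Lemma bounded_op_null (F : (sdom S1 -> R) -> sdom S2 -> R) C f g :
  bounded_op F C -> sX f -> sX g -> snm (f - g) = 0 -> snm (F f - F g) = 0.
Proof.
move=> bF Xf Xg h; apply/eqP; rewrite eq_le snm_ge0 andbT.
by apply: le_trans (bounded_opB bF Xf Xg) _; rewrite h mulr0.
Qed.

End BoundedOp.

Lemma bounded_op_comp {R : realType} {S1 S2 S3 : sspace R} (F : (sdom S1 -> R) -> sdom S2 -> R) C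
  (H : (sdom S2 -> R) -> sdom S3 -> R) D : 0 <= D ->
  bounded_op F C -> bounded_op H D -> bounded_op (fun f => H (F f)) (D * C).
Proof.
move=> D0 bF bH; have [FX Flin Fbd] := bF; have [HX Hlin Hbd] := bH; split.
- by move=> f Xf; apply/HX/FX.
- move=> f g a b Xf Xg; have XL := sX_lin a b Xf Xg.
  have XF := sX_lin a b (FX _ Xf) (FX _ Xg).
  have n1 := bounded_op_null bH (FX _ XL) XF (Flin _ _ a b Xf Xg).
  have n2 := Hlin _ _ a b (FX _ Xf) (FX _ Xg).
  apply/eqP; rewrite eq_le snm_ge0 andbT.
  set X := H (F (a *: f + b *: g)) in n1 *; set Y := H (a *: F f + b *: F g) in n1 n2.
  set Z := a *: H (F f) + b *: H (F g) in n2 *.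
  have -> : X - Z = (X - Y) + (Y - Z) by fring.
  have XX : sX X by exact/HX/FX.
  have XY : sX Y by exact: HX.
  have XZ : sX Z by apply: sX_lin; exact/HX/FX.
  by apply: le_trans (snm_triangle (sXB XX XY) (sXB XY XZ)) _; rewrite n1 n2 addr0.
- move=> f Xf; apply: le_trans (Hbd _ (FX _ Xf)) _.
  by rewrite -mulrA ler_wpM2l// Fbd.
Qed.

Section ScalarSpace.
Variable R : realType.

Lemma scalar_complete (x : nat -> unit -> R) :
  (forall k, `|(x k.+1 - x k) tt| <= 2^-1 ^+ k) ->
  exists2 y : unit -> R, True &
    forall e, 0 < e -> exists K, forall k, (K <= k)%N -> `|(y - x k) tt| <= e.
Proof.
move=> hx; pose d k := x k.+1 tt - x k tt.
have cd : cvgn (series d).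
  apply: normed_cvg; apply: (@series_le_cvg _ _ (geometric 1 2^-1)).
  - by move=> n; exact: normr_ge0.
  - by move=> n; rewrite /geometric/= mul1r exprn_ge0// invr_ge0.
  - by move=> n; rewrite /geometric/= mul1r; exact: hx.
  - apply: is_cvg_geometric_series; rewrite ger0_norm; lra.
exists (fun=> x 0%N tt + limn (series d)) => // e e0.
move/cvgrPdist_le : cd => /(_ _ e0)[K _ hK]; exists K => k Kk.
have := hK k Kk; rewrite /= seriesEnat/=.
have -> : \sum_(0 <= i < k) d i = x k tt - x 0%N tt.
  by rewrite /d telescope_sumr.
by rewrite !fctE opprB addrA [limn _ + _]addrC.
Qed.

(** The scalars as functions on one point, so that functionals too are obtained from
    [extend_graph]. *)
Definition scalar_space : sspace R.
Proof.
refine (@SSpace R unit (fun=> True) (fun f => `|f tt|) _ _ _ _ _ _) => //.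
- by move=> f g _ _; exact: ler_normD.
- by move=> a f _; rewrite -normrM.
- by move=> x _; exact: scalar_complete.
Defined.

End ScalarSpace.

Section BlockSpace.
Context {R : realType}.

(* A space with a dense sequence of blocks [u n], the n-th one modelled on
   mean-zero functions on [sz n] points, in which block sums have the p-norm
   they would have if the blocks were independent. *)
Record block_space (p : R) := BlockSpace {
  bspace :> sspace R;
  blk_u : nat -> (nat -> R) -> (sdom bspace -> R);
  blk_lin : forall n (x y : R) f g,
    blk_u n (fun a => x * f a + y * g a) = x *: blk_u n f + y *: blk_u n g;
  blk_ext : forall n f g, (forall a, (a < sz n)%N -> f a = g a) ->
    blk_u n f = blk_u n g;
  blk_X : forall n f, mz (sz n) f -> sX (blk_u n f);
  blk_law : forall M G, mzG G ->
    snm (\sum_(n < M) blk_u n (G n)) `^ p = Phi p G M 0;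
  blk_dense : forall f, sX f -> forall e, 0 < e -> exists M G,
    mzG G /\ snm (f - \sum_(n < M) blk_u n (G n)) < e }.

End BlockSpace.

(** * Coordinates with respect to the blocks *)

Section Blocks.
Context {R : realType} {p : R} (p1 : 1 < p) (S : block_space p).
Local Notation u := (blk_u (b := S)).
Implicit Types (f g : sdom S -> R) (G : nat -> nat -> R) (v : nat -> R).

Let p0 : 0 < p. Proof. exact: lt_trans ltr01 p1. Qed.

Definition SM (M : nat) G : sdom S -> R := \sum_(n < M) u n (G n).

(** For such arrays the block sum is unchanged when [M] grows, so sums of different lengths can be
    combined. *)
Definition fin (M : nat) G : Prop := mzG G /\ forall k a, (M <= k)%N -> G k a = 0.

Lemma le_of_powR (x y : R) : 0 <= x -> 0 <= y -> x `^ p <= y `^ p -> x <= y.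
Proof.
move=> x0 y0 xy.
have := @ge0_ler_powR _ p^-1 _ (x `^ p) (y `^ p).
rewrite !nnegrE !powR_ge0 xy -!powRrM mulfV ?gt_eqF// !powRr1//.
by apply=> //; rewrite invr_ge0 ltW.
Qed.

Lemma u_ext n v w : (forall a, (a < sz n)%N -> v a = w a) -> u n v = u n w.
Proof. exact: blk_ext. Qed.

Lemma u0 n v : (forall a, (a < sz n)%N -> v a = 0) -> u n v = 0.
Proof.
move=> v0; rewrite (u_ext (w := fun a => 0 * v a + 0 * v a)).
  by rewrite blk_lin; fring.
by move=> a an; rewrite v0// mulr0 addr0.
Qed.

Lemma uB n v w : u n (fun a => v a - w a) = u n v - u n w.
Proof.
rewrite (u_ext (w := fun a => 1 * v a + (-1) * w a)).
  by rewrite blk_lin; fring.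
by move=> a _; rewrite mul1r mulN1r.
Qed.

Lemma SM_X M G : mzG G -> sX (SM M G).
Proof. by move=> mG; apply: sX_sum => n _; exact: blk_X. Qed.

Lemma SM_law M G : mzG G -> snm (SM M G) `^ p = Phi p G M 0.
Proof. exact: blk_law. Qed.

Lemma eq_SM M G G' : (forall n a, (n < M)%N -> (a < sz n)%N -> G n a = G' n a) ->
  SM M G = SM M G'.
Proof. by move=> h; apply: eq_bigr => n _; apply: u_ext => a; exact: h. Qed.

Lemma SM_lin M x y G G' :
  SM M (fun n a => x * G n a + y * G' n a) = x *: SM M G + y *: SM M G'.
Proof.
rewrite /SM !scaler_sumr -big_split/=; apply: eq_bigr => n _.
exact: blk_lin.
Qed.

Lemma SM_widen M M' G : (M <= M')%N ->
  (forall n a, (M <= n)%N -> (n < M')%N -> (a < sz n)%N -> G n a = 0) ->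
  SM M' G = SM M G.
Proof.
elim: M' => [|M' IH]; first by rewrite leqn0 => /eqP->.
rewrite leq_eqVlt => /orP[/eqP->//|MM'] G0.
rewrite {1}/SM big_ord_recr/= u0 ?addr0; last by move=> a aM; exact: G0.
by apply: IH => // n a h1 h2; apply: G0 => //; exact: ltnW.
Qed.

Lemma SM_fin M M' G : fin M G -> (M <= M')%N -> SM M' G = SM M G.
Proof. by move=> [_ G0] MM'; apply: SM_widen => // n a h _ _; exact: G0. Qed.

Lemma SM_le M M' G G' : mzG G -> mzG G' -> Phi p G M 0 <= Phi p G' M' 0 ->
  snm (SM M G) <= snm (SM M' G').
Proof.
by move=> mG mG' h; apply: le_of_powR; rewrite ?snm_ge0// !SM_law.
Qed.

Definition single (n : nat) v : nat -> nat -> R :=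
  fun k a => if k == n then v a else 0.

Lemma single_fin n v : mz (sz n) v -> fin n.+1 (single n v).
Proof.
move=> mv; split => [k|k a nk]; rewrite /single.
  by case: eqP => [->//|_]; exact: mz0.
by rewrite gtn_eqF.
Qed.

Lemma SM_one M G n : (n < M)%N ->
  (forall k a, k != n -> (a < sz k)%N -> G k a = 0) -> SM M G = u n (G n).
Proof.
move=> nM G0; rewrite /SM (bigD1 (Ordinal nM))//= big1 ?addr0// => k kn.
by apply: u0 => a; apply: G0; apply: contra kn => /eqP kn; apply/eqP/val_inj.
Qed.

Lemma SM_single n v : SM n.+1 (single n v) = u n v.
Proof.
rewrite (@SM_one _ _ n)//; first by rewrite /single eqxx.
by move=> k a /negbTE kn _; rewrite /single kn.
Qed.

Lemma snm_u n v : mz (sz n) v -> snm (u n v) `^ p = avg (sz n) (fun a => `|v a| `^ p).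
Proof.
move=> mv; have [mG _] := single_fin mv.
by rewrite -SM_single SM_law// Phi_single.
Qed.

Lemma snm_u_le n v c : mz (sz n) v -> 0 <= c ->
  (forall a, (a < sz n)%N -> `|v a| <= c) -> snm (u n v) <= c.
Proof.
move=> mv c0 vc; apply: le_of_powR; rewrite ?snm_ge0// snm_u//.
rewrite -[X in _ <= X](@avg_cst _ (sz n) _ (sz_gt0 n)); apply: le_avg => a an.
by apply: ge0_ler_powR; rewrite ?nnegrE//; [exact: ltW|exact: vc].
Qed.

Lemma avg_norm_le n v (x : R) : 0 <= x ->
  avg (sz n) (fun a => `|v a| `^ p) <= x `^ p -> avg (sz n) (fun a => `|v a|) <= x.
Proof.
move=> x0 h; apply: le_of_powR => //; first by apply: avg_ge0.
apply: le_trans h.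
have := @jensen _ (sz n) _ (fun a => `|v a|) (sz_gt0 n) (supported_powR p1).
rewrite /= ger0_norm; last by apply: avg_ge0.
by move/le_trans; apply; apply: le_avg => a _; rewrite normr_id.
Qed.

Lemma pointwise_le n v (x : R) : 0 <= x ->
  avg (sz n) (fun a => `|v a| `^ p) <= x `^ p ->
  forall a, (a < sz n)%N -> `|v a| <= (sz n)%:R * x.
Proof.
move=> x0 h a an; have := avg_norm_le x0 h; rewrite /avg.
have s0 : 0 < (sz n)%:R :> R by rewrite ltr0n sz_gt0.
rewrite mulrC ler_pdivrMr// [x * _]mulrC; apply: le_trans.
by rewrite (bigD1 (Ordinal an))//= lerDl sumr_ge0.
Qed.

Lemma block_le M G n : mzG G -> (n < M)%N ->
  avg (sz n) (fun a => `|G n a| `^ p) <= snm (SM M G) `^ p.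
Proof.
move=> mG nM; rewrite SM_law//.
apply: le_trans (Phi_select p1 (pred1 n) M 0 mG); rewrite /=.
rewrite -(@Phi_single _ p n (G n) M nM) le_eqVlt; apply/orP; left; apply/eqP.
by apply: eq_Phi => k a _ _; case: eqP => // ->.
Qed.

Lemma fin_lin x y M M' G G' : fin M G -> fin M' G' ->
  fin (maxn M M') (fun n a => x * G n a + y * G' n a).
Proof.
move=> [mG G0] [mG' G0']; split => [n|k a].
  exact: mz_lin.
by rewrite geq_max => /andP[h1 h2]; rewrite G0// G0'// !mulr0 addr0.
Qed.

Lemma SM_fin_lin x y M M' G G' : fin M G -> fin M' G' ->
  SM (maxn M M') (fun n a => x * G n a + y * G' n a) =
  x *: SM M G + y *: SM M' G'.
Proof.
move=> fG fG'; rewrite SM_lin (SM_fin fG (leq_maxl _ _)).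
by rewrite (SM_fin fG' (leq_maxr _ _)).
Qed.

Lemma fin_dense f e : sX f -> 0 < e -> exists M G, fin M G /\ snm (f - SM M G) < e.
Proof.
move=> Xf e0; have [M [G [mG h]]] := blk_dense Xf e0.
exists M, (fun n a => if (n < M)%N then G n a else 0); split; first split.
- by move=> n; case: ltnP => _ //; exact: mz0.
- by move=> k a Mk; rewrite ltnNge Mk.
- rewrite (eq_SM (G' := G))//.
  by move=> n a ->.
Qed.

Lemma op_density (F : (sdom S -> R) -> (sdom S -> R)) C mu c : 0 <= C -> 0 <= c ->
  bounded_op F C ->
  (forall M G, fin M G -> snm (F (SM M G) - mu *: SM M G) <= c * snm (SM M G)) ->
  forall f, sX f -> snm (F f - mu *: f) <= c * snm f.
Proof.
move=> C0 c0 bF h f Xf; apply: (@le_addM_gt0 _ _ _ (C + `|mu| + c)).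
  by rewrite !addr_ge0.
move=> e e0; have [M [G [fG fe]]] := fin_dense Xf e0.
have [mG _] := fG; have XS := SM_X M mG.
have [FX _ _] := bF.
set x := SM M G in fe XS *.
have -> : F f - mu *: f = (F x - mu *: x) + ((F f - F x) - mu *: (f - x)) by fring.
have X1 := sXB (FX _ XS) (sXZ mu XS).
have X2 := sXB (FX _ Xf) (FX _ XS).
have X3 := sXZ mu (sXB Xf XS).
apply: le_trans (snm_triangle X1 (sXB X2 X3)) _.
have := snmB_le X2 X3; rewrite snmZ; last exact: sXB.
have := bounded_opB bF Xf XS; have := h _ _ fG; rewrite -/x.
have : snm x <= snm f + e.
  by apply: le_trans (snm_le_sub XS Xf) _; rewrite addrC lerD2l snmC// ltW.
move/(ler_wpM2l c0); have := ler_wpM2l C0 (ltW fe).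
have := ler_wpM2l (normr_ge0 mu) (ltW fe).
lra.
Qed.

(** On a finite sum, the value at a point of block [n] is at most [sz n] times the L1 average of the
    block, hence times its norm, and the block is a conditional expectation of the sum. The
    functional therefore extends by density. *)
Lemma coord_exists : exists c : (sdom S -> R) -> nat -> nat -> R,
  [/\ forall f g x y n a, sX f -> sX g -> (a < sz n)%N ->
        c (x *: f + y *: g) n a = x * c f n a + y * c g n a,
      forall f n a, sX f -> (a < sz n)%N -> `|c f n a| <= (sz n)%:R * snm f
    & forall M G n a, fin M G -> (a < sz n)%N -> c (SM M G) n a = G n a].
Proof.
pose T := scalar_space R.
have H (na : nat * nat) : exists F : (sdom S -> R) -> sdom T -> R,
    (na.2 < sz na.1)%N -> bounded_op (S1 := S) (S2 := T) F (sz na.1)%:R /\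
    forall M G, fin M G -> F (SM M G) tt = G na.1 na.2.
  case: na => n a /=; case: (ltnP a (sz n)) => [an|]; last by exists (fun _ _ => 0).
  pose Gr (x : sdom S -> R) (y : sdom T -> R) :=
    exists M G, [/\ fin M G, x = SM M G & y = (fun=> G n a)].
  have [||||F [bF FG]] := @extend_graph _ S T Gr (sz n)%:R; first by [].
  - move=> x y [M [G [fG -> ->]]]; have [mG G0] := fG; split => //.
      exact: SM_X.
    rewrite /=; case: (leqP M n) => [Mn|nM].
      by rewrite G0// normr0 mulr_ge0// snm_ge0.
    by apply: pointwise_le => //; [exact: snm_ge0|exact: block_le].
  - move=> x y x1 y1 x2 y2 [M [G [fG -> ->]]] [M' [G' [fG' -> ->]]].
    exists (maxn M M'), (fun n a => x * G n a + y * G' n a); split => //.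
      exact: fin_lin.
    by rewrite SM_fin_lin.
  - move=> f Xf e e0; have [M [G [fG fe]]] := fin_dense Xf e0.
    by exists (SM M G), (fun=> G n a); split => //; exists M, G.
  exists F => _; split => // M G fG.
  have /FG/eqP : Gr (SM M G) (fun=> G n a) by exists M, G.
  by rewrite /= normr_eq0 !fctE subr_eq0 => /eqP.
have [F FP] := choice H.
exists (fun f n a => F (n, a) f tt); split.
- move=> f g x y n a Xf Xg an; have [[_ + _] _] := FP (n, a) an.
  move=> /(_ f g x y Xf Xg)/eqP; rewrite /= normr_eq0.
  by rewrite !fctE subr_eq0 => /eqP.
- move=> f n a Xf an; have [[_ _ +] _] := FP (n, a) an.
  exact.
- by move=> M G n a fG an; have [_ +] := FP (n, a) an; exact.
Qed.

Definition bcoord : (sdom S -> R) -> nat -> nat -> R := projT1 (cid coord_exists).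

Lemma coord_lin f g x y n a : sX f -> sX g -> (a < sz n)%N ->
  bcoord (x *: f + y *: g) n a = x * bcoord f n a + y * bcoord g n a.
Proof. by rewrite /bcoord; case: cid => c [h ? ?]; exact: h. Qed.

Lemma coord_bound f n a : sX f -> (a < sz n)%N ->
  `|bcoord f n a| <= (sz n)%:R * snm f.
Proof. by rewrite /bcoord; case: cid => c [? h ?]; exact: h. Qed.

Lemma coord_SM M G n a : fin M G -> (a < sz n)%N -> bcoord (SM M G) n a = G n a.
Proof. by rewrite /bcoord; case: cid => c [? ? h]; exact: h. Qed.

Lemma coordB f g n a : sX f -> sX g -> (a < sz n)%N ->
  bcoord (f - g) n a = bcoord f n a - bcoord g n a.
Proof.
move=> Xf Xg an; have -> : f - g = 1 *: f + (-1) *: g by fring.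
by rewrite coord_lin// mul1r mulN1r.
Qed.

Lemma coord_null f g n a : sX f -> sX g -> snm (f - g) = 0 -> (a < sz n)%N ->
  bcoord f n a = bcoord g n a.
Proof.
move=> Xf Xg h an; apply/eqP; rewrite -subr_eq0 -normr_le0 -coordB//.
by apply: le_trans (coord_bound (sXB Xf Xg) an) _; rewrite h mulr0.
Qed.

Lemma coord_approx f e : sX f -> 0 < e -> exists M G, [/\ fin M G,
  snm (f - SM M G) < e & forall n a, (a < sz n)%N ->
    `|bcoord f n a - G n a| <= (sz n)%:R * e].
Proof.
move=> Xf e0; have [M [G [fG fe]]] := fin_dense Xf e0.
have [mG _] := fG; have XS := SM_X M mG.
exists M, G; split => // n a an.
rewrite -(coord_SM fG an) -coordB//.
by apply: le_trans (coord_bound (sXB Xf XS) an) _; rewrite ler_wpM2l// ltW.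
Qed.

Lemma coord_mz f : sX f -> mzG (bcoord f).
Proof.
move=> Xf n; apply/eqP; rewrite -normr_le0.
apply: (@le_addM_gt0 _ _ _ (\sum_(a < sz n) (sz n)%:R)).
  by rewrite sumr_ge0.
move=> e e0; have [M [G [[mG _] fe h]]] := coord_approx Xf e0.
have -> : \sum_(a < sz n) bcoord f n a = \sum_(a < sz n) (bcoord f n a - G n a).
  by rewrite sumrB mG subr0.
rewrite add0r mulr_suml; apply: le_trans (ler_norm_sum _ _ _) _.
by apply: ler_sum => a _; exact: h.
Qed.

(** Truncation of a finite sum is a conditional expectation; the bound passes to the limit because
    the finitely many coordinates involved are continuous. *)
Lemma coord_contract f M : sX f -> snm (SM M (bcoord f)) <= snm f.
Proof.
move=> Xf; apply: (@le_addM_gt0 _ _ _ (\sum_(n < M) (sz n)%:R + 1)).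
  by rewrite addr_ge0// sumr_ge0.
move=> e e0; have [M' [G [fG fe h]]] := coord_approx Xf e0.
have [mG G0] := fG; have mc := coord_mz Xf.
apply: le_trans (snm_le_sub (SM_X M mc) (SM_X M mG)) _.
have h1 : snm (SM M (bcoord f) - SM M G) <= (\sum_(n < M) (sz n)%:R) * e.
  rewrite /SM -sumrB mulr_suml.
  have X1 n : sX (u n (bcoord f n) - u n (G n)) by apply: sXB; exact: blk_X.
  apply: le_trans (snm_sum_le _ _) _ => //.
  apply: ler_sum => n _; rewrite -uB; apply: snm_u_le; last exact: h.
    by have := mz_lin 1 (-1) (mc n) (mG n); under eq_fun do rewrite mul1r mulN1r.
  by rewrite mulr_ge0// ltW.
have h2 : snm (SM M G) <= snm (SM M' G).
  apply: SM_le => //; case: (leqP M M') => MM'; first exact: Phi_le.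
  by rewrite (@Phi_zero _ _ _ M')// ?(ltnW MM')// => n a Mn _ _; exact: G0.
have h3 : snm (SM M' G) <= snm f + e.
  by apply: le_trans (snm_le_sub (SM_X M' mG) Xf) _;
    rewrite addrC lerD2l snmC ?ltW//; exact: SM_X.
have := lerD h1 (le_trans h2 h3); rewrite mulrDl mul1r; lra.
Qed.

(** Truncation fixes an approximating finite sum and contracts the remainder. *)
Lemma coord_converge f e : sX f -> 0 < e ->
  exists M, snm (f - SM M (bcoord f)) <= e.
Proof.
move=> Xf e0; have e20 : 0 < e / 2 by rewrite divr_gt0.
have [M [G [fG fe]]] := fin_dense Xf e20; exists M.
have [mG G0] := fG; have XS := SM_X M mG; have mc := coord_mz Xf.
have Xd := sXB Xf XS.
have h : snm (SM M G - SM M (bcoord f)) <= e / 2.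
  have -> : SM M G - SM M (bcoord f) = - SM M (bcoord (f - SM M G)).
    have -> : SM M G - SM M (bcoord f) =
      - (1 *: SM M (bcoord f) + (-1) *: SM M G) by fring.
    rewrite -SM_lin; congr (- _); apply: eq_SM => n a _ an.
    by rewrite coordB// coord_SM// mul1r mulN1r.
  rewrite snmN; last by apply: SM_X; exact: coord_mz.
  exact: le_trans (coord_contract M Xd) (ltW fe).
have -> : f - SM M (bcoord f) = (f - SM M G) + (SM M G - SM M (bcoord f)) by fring.
apply: le_trans (snm_triangle Xd (sXB XS (SM_X M mc))) _; lra.
Qed.

Lemma coord_avg_powR f n : sX f ->
  avg (sz n) (fun a => `|bcoord f n a| `^ p) <= snm f `^ p.
Proof.
move=> Xf; apply: le_trans (block_le (coord_mz Xf) (ltnSn n)) _.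
apply: ge0_ler_powR; rewrite ?nnegrE ?snm_ge0//; first exact: ltW.
exact: coord_contract.
Qed.

Lemma coord_avg f n : sX f -> avg (sz n) (fun a => `|bcoord f n a|) <= snm f.
Proof. by move=> Xf; apply: avg_norm_le; [exact: snm_ge0|exact: coord_avg_powR]. Qed.

(** * Embedding onto the copies and averaging over the fibres *)

Section CopyOperators.
Variables (N : nat -> nat) (rho : nat -> nat -> nat).
Hypothesis Nincr : forall i j, (i < j)%N -> (N i < N j)%N.
Hypothesis rhoE : forall n, @equidistributed R (sz (N n)) (sz n) (rho n).

Lemma upG_fin M G : fin M G -> fin (N M) (upG N rho M G).
Proof.
move=> [mG G0]; split => [k|k a Nk]; last first.
  apply: upG_notN => n nM; rewrite ltn_eqF//.
  exact: leq_trans (Nincr nM) Nk.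
rewrite /mz /upG exchange_big big1//= => n /eqP <-.
by apply: (@mz_comp _ _ (sz n) (rho n) (G n)); rewrite ?sz_gt0.
Qed.

Lemma upG_widen M M' G k a : fin M G -> (M <= M')%N ->
  upG N rho M' G k a = upG N rho M G k a.
Proof.
move=> [_ G0] MM'; rewrite /upG !(big_mkcond (fun i => N _ == k)).
rewrite -!(big_mkord xpredT (fun i => if N i == k then G i (rho i a) else 0)).
rewrite (big_cat_nat _ MM')//= [X in _ + X]big_nat_cond [X in _ + X]big1 ?addr0//.
by move=> i /andP[/andP[Mi _] _]; rewrite G0//; case: ifP.
Qed.

Lemma embed_exists : exists B : (sdom S -> R) -> sdom S -> R,
  bounded_op B 1 /\ forall M G, fin M G ->
    snm (B (SM M G) - SM (N M) (upG N rho M G)) = 0.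
Proof.
pose Gr (x y : sdom S -> R) :=
  exists M G, [/\ fin M G, x = SM M G & y = SM (N M) (upG N rho M G)].
have [||||B [bB BG]] := @extend_graph _ S S Gr 1; first by [].
- move=> x y [M [G [fG -> ->]]]; have [mG G0] := fG.
  have [mU _] := upG_fin fG.
  split; [exact: (SM_X M mG)|exact: (SM_X (N M) mU)|].
  rewrite mul1r; apply: SM_le => //.
  by rewrite (Phi_up _ Nincr rhoE)// => n; exact: Nincr.
- move=> x y x1 y1 x2 y2 [M [G [fG -> ->]]] [M' [G' [fG' -> ->]]].
  exists (maxn M M'), (fun n a => x * G n a + y * G' n a); split.
  + exact: fin_lin.
  + by rewrite SM_fin_lin.
  + have W : {homo N : i j / (i <= j)%N}.
      by move=> i j; rewrite leq_eqVlt => /orP[/eqP->//|/Nincr/ltnW].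
    rewrite -(SM_fin (upG_fin fG) (W _ _ (leq_maxl M M'))).
    rewrite -(SM_fin (upG_fin fG') (W _ _ (leq_maxr M M'))).
    rewrite -SM_lin; apply: eq_SM => k a _ _.
    rewrite -(upG_widen k a fG (leq_maxl M M')).
    rewrite -(upG_widen k a fG' (leq_maxr M M')).
    by rewrite /upG !mulr_sumr -big_split.
- move=> f Xf e e0; have [M [G [fG fe]]] := fin_dense Xf e0.
  by exists (SM M G), (SM (N M) (upG N rho M G)); split => //; exists M, G.
by exists B; split => // M G fG; apply: BG; exists M, G.
Qed.

(** The same bound [M] works because [n <= N n]. *)
Lemma downG_fin M G : fin M G -> fin M (downG N rho G).
Proof.
move=> [mG G0]; split => [n|k a Mk]; rewrite /downG.
  by apply: cexp_mz => //; have [] := rhoE n.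
rewrite /cexp /avg big1 ?mulr0// => i _.
by rewrite G0 ?mul0r// (leq_trans Mk)// N_ge.
Qed.

Lemma project_exists : exists A : (sdom S -> R) -> sdom S -> R,
  bounded_op A 1 /\ forall M G, fin M G ->
    snm (A (SM M G) - SM M (downG N rho G)) = 0.
Proof.
pose Gr (x y : sdom S -> R) :=
  exists M G, [/\ fin M G, x = SM M G & y = SM M (downG N rho G)].
have [||||A [bA AG]] := @extend_graph _ S S Gr 1; first by [].
- move=> x y [M [G [fG -> ->]]]; have [mG G0] := fG.
  have [mD _] := downG_fin fG.
  split; [exact: (SM_X M mG)|exact: (SM_X M mD)|].
  rewrite mul1r.
  rewrite -(SM_fin fG (N_ge Nincr M)); apply: SM_le => //.
  by apply: (Phi_down p1 Nincr rhoE) => // n; exact: Nincr.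
- move=> x y x1 y1 x2 y2 [M [G [fG -> ->]]] [M' [G' [fG' -> ->]]].
  exists (maxn M M'), (fun n a => x * G n a + y * G' n a); split.
  + exact: fin_lin.
  + by rewrite SM_fin_lin.
  + rewrite -(SM_fin (downG_fin fG) (leq_maxl M M')).
    rewrite -(SM_fin (downG_fin fG') (leq_maxr M M')).
    rewrite -SM_lin; apply: eq_SM => k a _ _.
    rewrite /downG /cexp [x * _]mulrCA [y * _]mulrCA -mulrDr; congr (_ * _).
    rewrite -!avgZ -avgD; apply: eq_avg => b _; ring.
- move=> f Xf e e0; have [M [G [fG fe]]] := fin_dense Xf e0.
  by exists (SM M G), (SM M (downG N rho G)); split => //; exists M, G.
by exists A; split => // M G fG; apply: AG; exists M, G.
Qed.

Definition embed := projT1 (cid embed_exists).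
Definition project := projT1 (cid project_exists).

Lemma embed_bounded : bounded_op embed 1.
Proof. by rewrite /embed; case: cid => B []. Qed.

Lemma project_bounded : bounded_op project 1.
Proof. by rewrite /project; case: cid => B []. Qed.

Lemma embed_SM M G : fin M G -> snm (embed (SM M G) - SM (N M) (upG N rho M G)) = 0.
Proof. by rewrite /embed; case: cid => B [] ? h; exact: h. Qed.

Lemma project_SM M G : fin M G -> snm (project (SM M G) - SM M (downG N rho G)) = 0.
Proof. by rewrite /project; case: cid => B [] ? h; exact: h. Qed.

Lemma embed_u n v : mz (sz n) v ->
  snm (embed (u n v) - u (N n) (fun a => v (rho n a))) = 0.
Proof.
move=> mv; have := embed_SM (single_fin mv); rewrite SM_single.
rewrite (@SM_one _ (upG _ _ _ _) (N n)); last first.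
- move=> k a kn _; rewrite /upG big1// => i ik; rewrite /single.
  by case: eqP => // iE; move: kn; rewrite -(eqP ik) iE eqxx.
- exact: Nincr.
have -> : u (N n) (upG N rho n.+1 (single n v) (N n)) =
    u (N n) (fun a => v (rho n a)); last by [].
by apply: u_ext => a _; rewrite upG_N// /single eqxx.
Qed.

(** Both sides are continuous in [f] and agree on finite sums. *)
Lemma project_coord f n c : sX f -> (c < sz n)%N ->
  bcoord (project f) n c = cexp (sz (N n)) (sz n) (rho n) (bcoord f (N n)) c.
Proof.
move=> Xf cn; have bA := project_bounded; have [AX _ _] := bA.
apply/eqP; rewrite -subr_eq0 -normr_le0.
apply: (@le_addM_gt0 _ _ _ ((sz n)%:R + (sz n)%:R * (sz (N n))%:R)).
  by rewrite addr_ge0// mulr_ge0.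
move=> e e0; have [M [G [fG fe h]]] := coord_approx Xf e0.
have [mG G0] := fG; have XS := SM_X M mG.
have [mD _] := downG_fin fG; have XD := SM_X M mD.
have e1 : bcoord (project (SM M G)) n c = downG N rho G n c.
  rewrite (coord_null (AX _ XS) XD (project_SM fG) cn).
  by rewrite coord_SM//; exact: downG_fin.
have h1 : `|bcoord (project f) n c - downG N rho G n c| <= (sz n)%:R * e.
  rewrite -e1 -coordB//; [|exact: AX..].
  apply: le_trans (coord_bound (sXB (AX _ Xf) (AX _ XS)) cn) _.
  rewrite ler_wpM2l//; apply: le_trans (bounded_opB bA Xf XS) _.
  by rewrite mul1r ltW.
have h2 : `|downG N rho G n c - cexp (sz (N n)) (sz n) (rho n) (bcoord f (N n)) c|
    <= (sz n)%:R * (sz (N n))%:R * e.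
  rewrite /downG /cexp -mulrBr normrM ger0_norm// -mulrA ler_wpM2l//.
  rewrite -avgB.
  apply: le_trans (norm_avg _ _) _.
  rewrite -[X in _ <= X](@avg_cst _ (sz (N n)) _ (sz_gt0 _)).
  apply: le_avg => a an; rewrite -mulrBl normrM distrC.
  rewrite -[X in _ <= X]mulr1; apply: ler_pM => //; first exact: h.
  by case: eqP; rewrite ?normr0 ?normr1.
rewrite add0r mulrDl.
rewrite -[bcoord _ _ _](subrK (downG N rho G n c)) -addrA.
by apply: le_trans (ler_normD _ _) _; exact: lerD.
Qed.

(** [op_density] with scalar 1 and error 0 reduces the identity to finite sums, where the fibre
    averages of [v o rho] are the values of [v]. *)
Lemma project_embed f : sX f -> snm (project (embed f) - f) = 0.
Proof.
move=> Xf; have bA := project_bounded; have bB := embed_bounded.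
have bAB := bounded_op_comp ler01 bB bA.
have [AX _ _] := bA; have [BX _ _] := bB.
apply/eqP; rewrite eq_le snm_ge0 andbT.
have h M G : fin M G -> snm (project (embed (SM M G)) - 1 *: SM M G) <=
    0 * snm (SM M G).
  move=> fG; have fU := upG_fin fG.
  have [mG G0] := fG; have [mU _] := fU; have XS := SM_X M mG.
  have XU := SM_X (N M) mU.
  have n1 := bounded_op_null bA (BX _ XS) XU (embed_SM fG).
  have n2 := project_SM fU.
  have E : SM (N M) (downG N rho (upG N rho M G)) = SM M G.
    rewrite -(SM_fin fG (N_ge Nincr M)); apply: eq_SM => n a _ an.
    case: (ltnP n M) => [nM|Mn].
      rewrite /downG -[RHS](@cexp_comp _ (sz (N n)) (sz n) (rho n)) ?sz_gt0//.
      congr (_ * _); apply: eq_avg => b _; by rewrite upG_N.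
    rewrite G0// /downG /cexp /avg big1 ?mulr0// => b _.
    rewrite upG_notN ?mul0r// => i iM; rewrite ltn_eqF//.
    exact: Nincr (leq_trans iM Mn).
  rewrite E in n2; rewrite mul0r.
  have -> : project (embed (SM M G)) - 1 *: SM M G =
    (project (embed (SM M G)) - project (SM (N M) (upG N rho M G))) +
    (project (SM (N M) (upG N rho M G)) - SM M G) by fring.
  apply: le_trans (snm_triangle _ _) _; last by rewrite n1 n2 addr0.
    by apply: sXB; apply: AX => //; exact: BX.
  by apply: sXB => //; exact: AX.
have c10 : 0 <= 1 * 1 :> R by rewrite mulr1.
have := op_density c10 (lexx 0) bAB h Xf.
have -> : project (embed f) - 1 *: f = project (embed f) - f by fring.
by rewrite mul0r.
Qed.

End CopyOperators.
End Blocks.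

(** * Compression to a copy of the space *)

Lemma bounded_op_sum_le {R : realType} {S1 S2 : sspace R}
    (F : (sdom S1 -> R) -> sdom S2 -> R) C (M : nat) (x : nat -> sdom S1 -> R) :
  bounded_op F C -> (forall i, sX (x i)) ->
  snm (F (\sum_(i < M) x i)) <= \sum_(i < M) snm (F (x i)).
Proof.
move=> bF Xx; have [FX Flin Fbd] := bF; elim: M => [|M IH].
  by rewrite !big_ord0; apply: le_trans (Fbd _ (sX0 _)) _; rewrite snm0 mulr0.
rewrite !big_ord_recr/=.
have Xs : sX (\sum_(i < M) x i) by exact: sX_sum.
have e1 : \sum_(i < M) x i + x M = 1 *: (\sum_(i < M) x i) + 1 *: x M by fring.
have := Flin _ _ 1 1 Xs (Xx M); rewrite -e1 => /snm_sub0 ->.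
- have -> : 1 *: F (\sum_(i < M) x i) + 1 *: F (x M) =
    F (\sum_(i < M) x i) + F (x M) by fring.
  by apply: le_trans (snm_triangle (FX _ Xs) (FX _ (Xx M))) _; rewrite lerD2r.
- by apply: FX; exact: sXD.
- by apply: sX_lin; exact: FX.
Qed.

Lemma bounded_op_lin {R : realType} {S1 S2 : sspace R}
    (F H : (sdom S1 -> R) -> sdom S2 -> R) C D x y :
  bounded_op F C -> bounded_op H D ->
  bounded_op (fun f => x *: F f + y *: H f) (`|x| * C + `|y| * D).
Proof.
move=> [FX Flin Fbd] [HX Hlin Hbd]; split.
- by move=> f Xf; apply: sX_lin; [exact: FX|exact: HX].
- move=> f g a b Xf Xg; have XL := sX_lin a b Xf Xg.
  have XF := sXB (FX _ XL) (sX_lin a b (FX _ Xf) (FX _ Xg)).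
  have XH := sXB (HX _ XL) (sX_lin a b (HX _ Xf) (HX _ Xg)).
  apply/eqP; rewrite eq_le snm_ge0 andbT.
  set F3 := F (a *: f + b *: g) in XF *; set H3 := H (a *: f + b *: g) in XH *.
  have -> : x *: F3 + y *: H3 - (a *: (x *: F f + y *: H f) +
      b *: (x *: F g + y *: H g)) =
    x *: (F3 - (a *: F f + b *: F g)) + y *: (H3 - (a *: H f + b *: H g)) by fring.
  apply: le_trans (snm_triangle (sXZ x XF) (sXZ y XH)) _.
  by rewrite !snmZ// Flin// Hlin// !mulr0 addr0.
- move=> f Xf; apply: le_trans (snm_triangle (sXZ x (FX _ Xf)) (sXZ y (HX _ Xf))) _.
  rewrite !snmZ; [|exact: HX|exact: FX].
  by rewrite mulrDl -!mulrA lerD// ler_wpM2l// ?Fbd// Hbd.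
Qed.

Lemma bounded_op_id {R : realType} {S : sspace R} : bounded_op (S1 := S) (fun f => f) 1.
Proof.
split => [//|f g a b Xf Xg|f Xf]; last by rewrite mul1r.
have -> : a *: f + b *: g - (a *: f + b *: g) = 0 by fring.
exact: snm0.
Qed.

(** * Centred indicators as test functions *)

Section Centered.
Context {R : realType}.
Implicit Types (f v : nat -> R).

(** The projection of the indicator of [b] to the mean-zero functions. A mean-zero [v] is the
    combination of these vectors with its own values as coefficients, and pairing with them
    evaluates it; so they can serve as sources and as tests. *)
Definition cen (m b : nat) : nat -> R := fun c => (c == b)%:R - m%:R^-1.

Lemma sum_delta m b f : (b < m)%N -> \sum_(c < m) f c * (c == b :> nat)%:R = f b :> R.
Proof.
move=> bm; rewrite (bigD1 (Ordinal bm))//= eqxx mulr1 big1 ?addr0// => c cb.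
by case: eqP => [cE|_]; [move: cb; rewrite -val_eqE/= cE eqxx|rewrite mulr0].
Qed.

Lemma cen_mz m b : (b < m)%N -> mz m (cen m b).
Proof.
move=> bm; rewrite /mz /cen sumrB sumr_const card_ord.
have -> : \sum_(c < m) (c == b :> nat)%:R = \sum_(c < m) 1 * (c == b :> nat)%:R :> R.
  by apply: eq_bigr => c _; rewrite mul1r.
rewrite (@sum_delta m b (fun=> 1))// -[X in _ - X]mulr_natl mulfV ?subrr//.
by rewrite pnatr_eq0 -lt0n (leq_ltn_trans _ bm).
Qed.

Lemma cen_expand m v c : mz m v -> (c < m)%N ->
  v c = \sum_(b < m) v b * cen m b c.
Proof.
move=> mv cm; rewrite /cen.
have -> : \sum_(b < m) v b * ((c == b)%:R - m%:R^-1) =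
    \sum_(b < m) v b * (b == c :> nat)%:R - (\sum_(b < m) v b) * m%:R^-1.
  rewrite mulr_suml -sumrB; apply: eq_bigr => b _.
  by rewrite mulrBr [c == b]eq_sym.
by rewrite mv mul0r subr0 sum_delta.
Qed.

Lemma cen_le1 m b c : (0 < m)%N -> `|cen m b c| <= 1.
Proof.
move=> m0; have h : 0 <= (m%:R^-1 : R) <= 1.
  by rewrite invr_ge0 ler0n/= invf_le1 ?ltr0n// ler1n.
rewrite /cen ler_norml; case: eqP => _ /=; lra.
Qed.

Lemma avg_cen m f c : mz m f -> (c < m)%N ->
  m%:R * avg m (fun a => f a * cen m c a) = f c.
Proof.
move=> mf cm; rewrite /avg mulVKf; last first.
  by rewrite pnatr_eq0 -lt0n (leq_ltn_trans _ cm).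
rewrite /cen; under eq_bigr do rewrite mulrBr.
by rewrite sumrB -mulr_suml mf mul0r subr0 sum_delta.
Qed.

Lemma cexp_cen L m rho f c : mz L f ->
  cexp L m rho f c = m%:R * avg L (fun a => f a * cen m c (rho a)).
Proof.
move=> mf; rewrite /cexp /cen; congr (_ * _).
under [RHS]eq_avg => a _ do rewrite mulrBr.
rewrite avgB; set X := avg L (fun a => f a * m%:R^-1).
have -> : X = 0 by rewrite /X /avg -mulr_suml mf mul0r mulr0.
by rewrite subr0.
Qed.

End Centered.

(** * From small matrix entries to a small operator *)

Section ErrorBound.
Context {R : realType} {p : R} (p1 : 1 < p) (S : block_space p).
Variables (T : (sdom S -> R) -> (sdom S -> R)) (C : R).
Hypotheses (C0 : 0 <= C) (bT : bounded_op T C).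
Local Notation u := (blk_u (b := S)).
Local Notation bcoord := (bcoord p1).

Let TX f : sX f -> sX (T f). Proof. by have [h _ _] := bT; exact: h. Qed.

Lemma coordT_lin N v w x y N' a : mz (sz N) v -> mz (sz N) w -> (a < sz N')%N ->
  bcoord (T (u N (fun b => x * v b + y * w b))) N' a =
  x * bcoord (T (u N v)) N' a + y * bcoord (T (u N w)) N' a.
Proof.
move=> mv mw aN; have Xv := blk_X S mv; have Xw := blk_X S mw.
have [_ Tlin _] := bT.
rewrite blk_lin (coord_null p1 _ _ (Tlin _ _ x y Xv Xw) aN).
- by rewrite coord_lin//; exact: TX.
- by apply: TX; exact: sX_lin.
- by apply: sX_lin; exact: TX.
Qed.

Lemma coordT_sum N n (x : nat -> R) (F : nat -> nat -> R) N' a :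
  (forall i, (i < n)%N -> mz (sz N) (F i)) -> (a < sz N')%N ->
  bcoord (T (u N (fun b => \sum_(i < n) x i * F i b))) N' a =
  \sum_(i < n) x i * bcoord (T (u N (F i))) N' a.
Proof.
elim: n => [|n IH] mF aN.
  rewrite big_ord0.
  have -> : u N (fun b => \sum_(i < 0) x i * F i b) =
      u N (fun b => 0 * (fun=> 0) b + 0 * (fun=> 0) b).
    by apply: u_ext => b _; rewrite big_ord0 mulr0 addr0.
  by rewrite coordT_lin ?mul0r ?addr0//; exact: mz0.
have mF' i : (i < n)%N -> mz (sz N) (F i) by move=> ni; apply: mF; exact: ltnW.
rewrite big_ord_recr/= -IH//.
have -> : u N (fun b => \sum_(i < n.+1) x i * F i b) =
    u N (fun b => 1 * (\sum_(i < n) x i * F i b) + x n * F n b).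
  by apply: u_ext => b _; rewrite big_ord_recr/= mul1r.
rewrite coordT_lin ?mul1r//; last exact: mF.
rewrite /mz exchange_big big1//= => i _; rewrite -mulr_sumr.
by have := mF' _ (ltn_ord i); rewrite /mz => ->; rewrite mulr0.
Qed.

(** The matrix entry of [T] between the copy of [v] in block [N] and the copy of [w] in block [N'],
    for the averaged pairing. *)
Definition Zform N' (rho' : nat -> nat) w N (rho : nat -> nat) v : R :=
  avg (sz N') (fun a => bcoord (T (u N (fun b => v (rho b)))) N' a * w (rho' a)).

(* Summable over all pairs of blocks, even against [sz i * sz j]. *)
Definition etol (J : nat) : R := (16 * 4 ^+ J.+1 * 4 ^+ J)^-1.

(** With [J = maxn i j], the sizes multiply to [4 * 2^i * 2^j], and [(2^i * 2^j)^2 <= 16^J] is what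
    the powers of 4 in [etol] absorb. *)
Lemma etol_bound i j :
  (sz j)%:R * (sz i)%:R * etol (maxn i j) <= 16^-1 * 2^-1 ^+ i * 2^-1 ^+ j.
Proof.
rewrite /etol !exprVn -!invfM /sz !natrX.
have x2 k : 0 < 2 ^+ k :> R by rewrite exprn_gt0.
have x4 k : 0 < 4 ^+ k :> R by rewrite exprn_gt0.
rewrite ler_pdivrMr ?mulr_gt0// [X in _ <= X]mulrC ler_pdivlMr ?mulr_gt0//.
have E k : 4 ^+ k = 2 ^+ k * 2 ^+ k :> R.
  by rewrite -exprMn; congr (_ ^+ _); lra.
rewrite !E !exprS.
have hi : 2 ^+ i <= 2 ^+ maxn i j :> R by rewrite ler_eXn2l ?leq_maxl//; lra.
have hj : 2 ^+ j <= 2 ^+ maxn i j :> R by rewrite ler_eXn2l ?leq_maxr//; lra.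
have h1 : 2 ^+ i * 2 ^+ j <= 2 ^+ maxn i j * 2 ^+ maxn i j :> R.
  by apply: ler_pM => //; exact: ltW.
have h2 : (2 ^+ i * 2 ^+ j) * (2 ^+ i * 2 ^+ j) <=
  (2 ^+ maxn i j * 2 ^+ maxn i j) * (2 ^+ maxn i j * 2 ^+ maxn i j) :> R.
  by apply: ler_pM => //; rewrite mulr_ge0// ltW.
lra.
Qed.

Variables (N : nat -> nat) (rho : nat -> nat -> nat) (lam : R).
Hypothesis Nincr : forall i j, (i < j)%N -> (N i < N j)%N.
Hypothesis rhoE : forall n, @equidistributed R (sz (N n)) (sz n) (rho n).
Hypothesis Zsmall : forall i j b b', (b < sz i)%N -> (b' < sz j)%N ->
  `|Zform (N j) (rho j) (cen (sz j) b') (N i) (rho i) (cen (sz i) b) -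
    (if i == j then lam * avg (sz i) (fun c => cen (sz i) b c * cen (sz i) b' c) else 0)|
  <= etol (maxn i j).

Local Notation A := (project p1 (S := S) Nincr rhoE).
Local Notation B := (embed p1 (S := S) Nincr rhoE).

Let AX f : sX f -> sX (A f).
Proof. by have [h _ _] := project_bounded p1 S Nincr rhoE; exact: h. Qed.
Let BX f : sX f -> sX (B f).
Proof. by have [h _ _] := embed_bounded p1 S Nincr rhoE; exact: h. Qed.

(** Expanding [v] in centred indicators, and writing the fibre average as a pairing with one,
    expresses the compression through the tested entries alone. *)
Lemma compressed_coord i v j b' : mz (sz i) v -> (b' < sz j)%N ->
  bcoord (A (T (B (u i v)))) j b' = (sz j)%:R * \sum_(b < sz i)
    v b * Zform (N j) (rho j) (cen (sz j) b') (N i) (rho i) (cen (sz i) b).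
Proof.
move=> mv bj; have Xu := blk_X S mv.
rewrite project_coord//; last exact/TX/BX.
have mvr : mz (sz (N i)) (fun a => v (rho i a)).
  by apply: (@mz_comp _ _ (sz i) (rho i) v); rewrite ?sz_gt0.
have XN := blk_X S mvr.
rewrite cexp_cen; last by apply: coord_mz; exact/TX/BX.
congr (_ * _); rewrite /Zform.
transitivity (avg (sz (N j)) (fun a => \sum_(b < sz i)
    v b * (bcoord (T (u (N i) (fun c => cen (sz i) b (rho i c)))) (N j) a *
      cen (sz j) b' (rho j a)))).
  apply: eq_avg => a aN.
  have e1 := bounded_op_null bT (BX Xu) XN (embed_u p1 S Nincr rhoE mv).
  rewrite (coord_null p1 (TX (BX Xu)) (TX XN) e1 aN).
  have -> : u (N i) (fun a => v (rho i a)) =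
      u (N i) (fun a => \sum_(b < sz i) v b * cen (sz i) b (rho i a)).
    apply: u_ext => c cN; rewrite -cen_expand//.
    by have [h _] := rhoE i; exact: h.
  rewrite (@coordT_sum (N i) (sz i) v (fun b c => cen (sz i) b (rho i c)))//.
    by rewrite mulr_suml; apply: eq_bigr => b _; rewrite mulrA.
  move=> b bi; apply: (@mz_comp _ _ (sz i) (rho i) (cen (sz i) b)); rewrite ?sz_gt0//.
  exact: cen_mz.
by rewrite avg_sum; apply: eq_bigr => b _; rewrite avgZ.
Qed.

(** The values of [|v|] sum to at most [sz i] times the norm, so each coordinate of the error in
    block [j] is at most [16^-1 2^-i 2^-j] times the norm; the sum over [j] doubles [16^-1]. *)
Lemma block_error i v : mz (sz i) v ->
  snm (A (T (B (u i v))) - lam *: u i v) <= 8^-1 * 2^-1 ^+ i * snm (u i v).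
Proof.
move=> mv; have Xu := blk_X S mv.
have Xw : sX (A (T (B (u i v))) - lam *: u i v).
  by apply: sXB; [exact/AX/TX/BX|exact: sXZ].
set w := A _ - _ in Xw *; set n0 := snm (u i v).
have n00 : 0 <= n0 by exact: snm_ge0.
have cw j b' : (b' < sz j)%N ->
    `|bcoord w j b'| <= 16^-1 * 2^-1 ^+ i * 2^-1 ^+ j * n0.
  move=> bj; rewrite /w.
  have -> : A (T (B (u i v))) - lam *: u i v =
     1 *: A (T (B (u i v))) + (- lam) *: u i v by fring.
  rewrite coord_lin//; last by exact/AX/TX/BX.
  rewrite mul1r compressed_coord//.
  have -> : bcoord (u i v) j b' = if j == i then v b' else 0.
    by rewrite -SM_single (coord_SM p1 S (single_fin mv)).
  (* The scalar part is expressed through the same test pairs: the Gram matrix of the centred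
     indicators, times [sz j], reproduces [v]. *)
  have -> : (- lam) * (if j == i then v b' else 0) = - ((sz j)%:R *
      \sum_(b < sz i) v b * (if i == j then
          lam * avg (sz i) (fun c => cen (sz i) b c * cen (sz i) b' c) else 0)).
    rewrite eq_sym; case: eqP => [ij|_]; last first.
      by rewrite mulr0 big1 ?mulr0 ?oppr0// => b _; rewrite mulr0.
    subst j; rewrite mulNr; congr (- _).
    under eq_bigr do rewrite mulrCA.
    rewrite -mulr_sumr mulrCA; congr (_ * _).
    rewrite -{1}(avg_cen mv bj); congr (_ * _).
    rewrite -(eq_bigr _ (fun b _ => avgZ _ _ _)) -avg_sum.
    apply: eq_avg => c ci; rewrite (cen_expand mv ci) mulr_suml.
    by apply: eq_bigr => b _; rewrite mulrA.
  rewrite -mulrBr -sumrB normrM ger0_norm//.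
  apply: (@le_trans _ _ ((sz j)%:R * (\sum_(b < sz i) `|v b| * etol (maxn i j)))).
    rewrite ler_wpM2l//; apply: le_trans (ler_norm_sum _ _ _) _.
    apply: ler_sum => b _; rewrite -mulrBr normrM ler_wpM2l//.
    exact: Zsmall.
  have h1 : \sum_(b < sz i) `|v b| <= (sz i)%:R * n0.
    have := @avg_norm_le _ _ p1 i v n0 n00; rewrite -(snm_u S mv) => /(_ (lexx _)).
    by rewrite /avg mulrC ler_pdivrMr ?ltr0n ?sz_gt0// mulrC.
  have e0 : 0 <= etol (maxn i j) by rewrite invr_ge0 !mulr_ge0.
  rewrite -mulr_suml.
  apply: (@le_trans _ _ ((sz j)%:R * ((sz i)%:R * n0 * etol (maxn i j)))).
    by rewrite ler_wpM2l// ler_wpM2r.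
  have := ler_wpM2r n00 (etol_bound i j); lra.
apply: (@le_addM_gt0 _ _ _ 1) => // e e0; rewrite mul1r.
have [M hM] := coord_converge p1 Xw e0.
have mc := coord_mz p1 Xw.
have XSM := SM_X S M mc.
apply: le_trans (snm_le_sub Xw XSM) _; rewrite addrC lerD//.
have Xc j : sX (u j (bcoord w j)) by exact: blk_X.
apply: le_trans (snm_sum_le _ _) _ => //.
apply: (@le_trans _ _ (\sum_(j < M) 16^-1 * 2^-1 ^+ i * n0 * 2^-1 ^+ j)).
  apply: ler_sum => j _; rewrite mulrAC; apply: snm_u_le => //.
    by rewrite !mulr_ge0// ?invr_ge0// exprn_ge0// invr_ge0.
  by move=> b bj; exact: cw.
rewrite -mulr_sumr.
have geo : \sum_(j < M) 2^-1 ^+ j <= 2 :> R.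
  suff -> : \sum_(j < M) 2^-1 ^+ j = 2 - 2 * 2^-1 ^+ M :> R.
    by rewrite gerBl mulr_ge0// exprn_ge0// invr_ge0.
  elim: (M) => [|k IH]; first by rewrite big_ord0 expr0; lra.
  by rewrite big_ord_recr/= IH exprS; lra.
have c0 : 0 <= 16^-1 * 2^-1 ^+ i * n0.
  by rewrite !mulr_ge0// ?invr_ge0// exprn_ge0// invr_ge0.
have := ler_wpM2l c0 geo; lra.
Qed.

(** Each block has norm at most that of the whole sum, and the relative errors [8^-1 2^-i] add up to
    at most [4^-1]. *)
Lemma almost_scalar f : sX f ->
  snm (A (T (B f)) - lam *: f) <= 4^-1 * snm f.
Proof.
have bA := project_bounded p1 S Nincr rhoE.
have bB := embed_bounded p1 S Nincr rhoE.
have bV := bounded_op_comp ler01 (bounded_op_comp C0 bB bT) bA.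
have c1 : 0 <= 1 * (C * 1) :> R by rewrite !mulr_ge0.
have c4 : 0 <= 4^-1 :> R by rewrite invr_ge0.
apply: (op_density (mu := lam) c1 c4 bV) => M G [mG G0].
have bW := bounded_op_lin 1 (- lam) bV (@bounded_op_id _ S).
have WE g : A (T (B g)) - lam *: g = 1 *: A (T (B g)) + (- lam) *: g by fring.
rewrite WE.
have Xu n : sX (u n (G n)) by exact: blk_X.
apply: le_trans (bounded_op_sum_le M bW Xu) _.
have nle (n : 'I_M) : snm (u n (G n)) <= snm (SM (S := S) M G).
  by apply: (le_of_powR p1); rewrite ?snm_ge0// snm_u//; exact: block_le.
apply: (@le_trans _ _ (\sum_(n < M) 8^-1 * 2^-1 ^+ n * snm (SM (S := S) M G))).
  apply: ler_sum => n _; rewrite -WE; apply: le_trans (block_error (mG n)) _.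
  by rewrite ler_wpM2l// mulr_ge0// ?exprn_ge0 ?invr_ge0.
rewrite -mulr_suml -mulr_sumr ler_wpM2r ?snm_ge0//.
suff -> : \sum_(j < M) 2^-1 ^+ j = 2 - 2 * 2^-1 ^+ M :> R.
  have : 0 <= 2^-1 ^+ M :> R by rewrite exprn_ge0// invr_ge0.
  lra.
elim: (M) => [|k IH]; first by rewrite big_ord0 expr0; lra.
by rewrite big_ord_recr/= IH exprS; lra.
Qed.

End ErrorBound.

(** * Random copies of a block *)

Lemma sum_mul {R : realType} (F : nat -> R) K s :
  \sum_(a < K * s) F a = \sum_(k < K) \sum_(c < s) F (k * s + c)%N.
Proof.
elim: K => [|K IH]; first by rewrite mul0n !big_ord0.
rewrite big_ord_recr/= -IH -!(big_mkord xpredT F) -(big_mkord xpredT (fun c => F (K * s + c)%N)).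
rewrite (@big_cat_nat _ _ _ (K * s))//=; last by rewrite mulSn leq_addl.
congr (_ + _); rewrite -{1}[(K * s)%N]add0n big_addn mulSn addnK.
by apply: eq_bigr => i _; rewrite addnC.
Qed.

(** The largest term times the sum: the mechanism behind all the variance bounds below. *)
Lemma sum_sqr_le {R : realType} (I : finType) (x q : I -> R) (M B : R) :
  (forall i, `|x i| <= q i) -> (forall i, q i <= M) -> 0 <= M -> \sum_i q i <= B ->
  \sum_i x i ^+ 2 <= M * B.
Proof.
move=> xq qM M0 qB; apply: le_trans (ler_wpM2l M0 qB); rewrite mulr_sumr.
apply: ler_sum => i _; rewrite -real_normK ?num_real// expr2.
by apply: ler_pM => //; exact: le_trans (qM i).
Qed.

Section Stage.
Context {R : realType} {p : R} (p1 : 1 < p) (S : block_space p).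
Variables (T : (sdom S -> R) -> (sdom S -> R)) (C : R).
Hypotheses (C0 : 0 <= C) (bT : bounded_op T C).
Local Notation u := (blk_u (b := S)).
Local Notation bcoord := (bcoord p1).
Local Notation Zf := (Zform p1 T).

Let TX f : sX f -> sX (T f). Proof. by have [h _ _] := bT; exact: h. Qed.
Let Tbd f : sX f -> snm (T f) <= C * snm f. Proof. by have [_ _ h] := bT; exact: h. Qed.
Let p0 : 0 < p. Proof. exact: lt_trans ltr01 p1. Qed.

Variable m : nat.
Local Notation N := (2 * m)%N.
Local Notation K := (2 ^ m)%N.
Local Notation s := (sz m).
Local Notation sample := {ffun 'I_K -> {perm 'I_s}}.

(** Block [2 * m] splits into [2^m] groups of [2^(m+1)] points, so that both the number of groups
    and the finest block that fits into a group grow with [m]. *)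
Lemma szNE : sz N = (K * s)%N.
Proof. by rewrite /sz -expnD mul2n -addnn addnS. Qed.

Let s1 : (1 < s)%N. Proof. by rewrite /sz expnS -{1}[2%N]muln1 leq_mul2l expn_gt0. Qed.
Let K0' : 0 < K%:R :> R. Proof. by rewrite ltr0n expn_gt0. Qed.
Let s0' : 0 < s%:R :> R. Proof. by rewrite ltr0n sz_gt0. Qed.
Let L0' : 0 < (sz N)%:R :> R. Proof. by rewrite ltr0n sz_gt0. Qed.
Let LE : (sz N)%:R = K%:R * s%:R :> R. Proof. by rewrite szNE natrM. Qed.

(** A point [a] is position [a %% s] of group [a %/ s]; the value 0 out of range is a default. *)
Definition act (g : sample) (a : nat) : nat :=
  if (insub (a %/ s)%N : option 'I_K) is Some k then
    if (insub (a %% s)%N : option 'I_s) is Some c then g k c : nat else 0%N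
  else 0%N.

Lemma group_div (k : nat) (c : 'I_s) : ((k * s + c) %/ s)%N = k.
Proof. by rewrite divnMDl ?sz_gt0// divn_small// addn0. Qed.

Lemma act_group (g : sample) (k : 'I_K) (c : 'I_s) : act g (k * s + c) = g k c.
Proof.
by rewrite /act group_div modnMDl modn_small// !valK.
Qed.

Lemma act_lt (g : sample) a : (act g a < s)%N.
Proof.
by rewrite /act; case: insubP => [k _ _|_]; rewrite ?sz_gt0//;
   case: insubP => [c _ _|_]; rewrite ?sz_gt0.
Qed.

Lemma group_lt (k : 'I_K) (c : 'I_s) : (k * s + c < sz N)%N.
Proof.
rewrite szNE; apply: (@leq_trans (k.+1 * s)); last by rewrite leq_mul2r ltn_ord orbT.
by rewrite mulSn addnC ltn_add2r.
Qed.

Lemma sumN (F : nat -> R) :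
  \sum_(a < sz N) F a = \sum_(k < K) \sum_(c < s) F (k * s + c)%N.
Proof. by rewrite szNE sum_mul. Qed.

Lemma sum_part (k : 'I_K) (F : nat -> R) :
  \sum_(a < sz N) (if (a %/ s == k)%N then F a else 0) =
  \sum_(c < s) F (k * s + c)%N.
Proof.
rewrite (sumN (fun a => if (a %/ s == k)%N then F a else 0)) (bigD1 k)//=.
rewrite [X in _ + X]big1 ?addr0.
  by apply: eq_bigr => c _; rewrite group_div eqxx.
move=> l lk; apply: big1 => c _; rewrite group_div.
by move: lk; rewrite -val_eqE => /negbTE->.
Qed.

(** * The random copy of block [j] *)

Section Level.
Variables (j : nat) (jm : (j <= m)%N).
Local Notation t := (2 ^ (m - j))%N.

Let sE : s = (sz j * t)%N.
Proof. by rewrite /sz -expnD addSn subnKC. Qed.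
Let t0 : (0 < t)%N. Proof. by rewrite expn_gt0. Qed.

(** After the permutation, runs of [t = 2^(m-j)] consecutive points are merged, which leaves the
    [sz j] points of block [j]. *)
Definition crho (g : sample) (a : nat) : nat := (act g a %/ t)%N.

(** Test functions of all levels become functions on the same [s] points, so the same random form
    handles every [j]. *)
Definition lift (v : nat -> R) : 'I_s -> R := fun x => v (x %/ t)%N.

Lemma crho_group g (k : 'I_K) (c : 'I_s) v : v (crho g (k * s + c)) = lift v (g k c).
Proof. by rewrite /crho act_group. Qed.

Lemma lift_sumE (v : nat -> R) : \sum_x lift v x = t%:R * \sum_(c < sz j) v c.
Proof.
rewrite /lift (eq_bigr (fun x : 'I_s => (fun a => v (a %/ t)%N) x))//.
have -> : \sum_(i < s) v (i %/ t)%N = \sum_(i < sz j * t) v (i %/ t)%N.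
  by rewrite sE.
rewrite (sum_mul (fun a => v (a %/ t)%N)) mulr_sumr; apply: eq_bigr => k _.
rewrite (eq_bigr (fun=> v k)); first by rewrite sumr_const card_ord mulr_natl.
by move=> c _; rewrite divnMDl// divn_small// addn0.
Qed.

Lemma lift_sum v : mz (sz j) v -> \sum_x lift v x = 0.
Proof. by move=> mv; rewrite lift_sumE mv mulr0. Qed.

Lemma lift_ip (w v : nat -> R) : \sum_x lift w x * lift v x =
  s%:R * avg (sz j) (fun c => w c * v c).
Proof.
rewrite (lift_sumE (fun c => w c * v c)) /avg mulrA; congr (_ * _).
rewrite sE natrM mulrAC mulfV ?mul1r// pnatr_eq0 -lt0n; exact: sz_gt0.
Qed.

Lemma crho_equidistributed g : @equidistributed R (sz N) (sz j) (crho g).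
Proof.
split => [a _|c cj].
  by rewrite /crho ltn_divLR// -sE act_lt.
rewrite (sumN (fun a => (crho g a == c)%:R)).
transitivity (\sum_(k < K) \sum_(x < s) lift (fun b => (b == c)%:R) x).
  apply: eq_bigr => k _; rewrite [RHS](reindex_inj (@perm_inj _ (g k))).
  by apply: eq_bigr => x _; rewrite (crho_group g k x (fun b => (b == c)%:R)).
rewrite sumr_const card_ord lift_sumE.
have -> : \sum_(b < sz j) (b == c :> nat)%:R = \sum_(b < sz j) 1 * (b == c :> nat)%:R :> R.
  by apply: eq_bigr => b _; rewrite mul1r.
rewrite (sum_delta (fun=> 1) cj) mulr1 LE sE natrM mulrA -mulr_natl.
by field; rewrite pnatr_eq0 -lt0n sz_gt0.
Qed.

Lemma crho_mz g (v : nat -> R) : mz (sz j) v -> mz (sz N) (fun a => v (crho g a)).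
Proof.
move=> mv; apply: (@mz_comp _ _ (sz j) (crho g) v); rewrite ?sz_gt0//.
exact: crho_equidistributed.
Qed.

Definition gpart (g : sample) (v : nat -> R) (l : nat) : nat -> R :=
  fun a => if (a %/ s == l)%N then v (crho g a) else 0.

(** Each group by itself is spread evenly over block [j], so the restriction of the copy to one
    group already has mean zero. *)
Lemma part_mz g v (l : 'I_K) : mz (sz j) v -> mz (sz N) (gpart g v l).
Proof.
move=> mv; rewrite /mz /gpart (sum_part l (fun a => v (crho g a))).
rewrite -[RHS](lift_sum mv) [RHS](reindex_inj (@perm_inj _ (g l))).
by apply: eq_bigr => c _; rewrite crho_group.
Qed.

End Level.

(** This is [K^(1/p)]; its inverse is the L_p norm of the indicator of one group. *)
Definition kap : R := (2 `^ p^-1) ^+ m.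

Lemma kap_gt0 : 0 < kap.
Proof. by rewrite exprn_gt0// powR_gt0. Qed.

Lemma powR_kap : kap `^ p = K%:R.
Proof.
have E (n : nat) (x : R) : 0 <= x -> (x ^+ n) `^ p = (x `^ p) ^+ n.
  move=> x0; elim: n => [|n IH]; first by rewrite !expr0 powR1.
  by rewrite !exprS powRM ?exprn_ge0// IH.
by rewrite /kap E ?powR_ge0// -powRrM mulVf ?gt_eqF// powRr1// natrX.
Qed.

Lemma group_norm (l : 'I_K) v : mz (sz N) v ->
  (forall a, (a < sz N)%N -> `|v a| <= 1) ->
  (forall a, (a %/ s != l)%N -> v a = 0) -> snm (u N v) <= kap^-1.
Proof.
move=> mv v1 vl; apply: (le_of_powR p1).
- exact: snm_ge0.
- by rewrite invr_ge0 ltW// kap_gt0.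
rewrite snm_u//.
have -> : kap^-1 `^ p = K%:R^-1.
  apply: (mulfI (x := kap `^ p)); first by rewrite powR_kap gt_eqF.
  rewrite -powRM ?invr_ge0 ?(ltW kap_gt0)// mulfV ?gt_eqF ?kap_gt0// powR1.
  by rewrite powR_kap mulfV// gt_eqF.
rewrite /avg (eq_bigr (fun a : 'I_(sz N) =>
   if (a %/ s == l)%N then `|v a| `^ p else 0)); last first.
  move=> a _; case: ifP => // /negbT al.
  by rewrite vl// normr0 powR0// gt_eqF.
rewrite (sum_part l (fun a => `|v a| `^ p)).
apply: (@le_trans _ _ ((sz N)%:R^-1 * \sum_(c < s) 1)).
  rewrite ler_wpM2l ?invr_ge0//; apply: ler_sum => c _.
  apply: (@le_trans _ _ (1 `^ p)); last by rewrite powR1.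
  apply: ge0_ler_powR; rewrite ?nnegrE//; first exact: ltW.
  by apply: v1; exact: group_lt.
rewrite sumr_const card_ord LE le_eqVlt; apply/orP; left; apply/eqP.
by field; rewrite !gt_eqF.
Qed.

(** The L1 mass on group [k] of the component of [x] in block [N]. *)
Definition gsum (x : sdom S -> R) (k : nat) : R :=
  (sz N)%:R^-1 * \sum_(c < s) `|bcoord x N (k * s + c)%N|.

(** Jensen's inequality inside the group, whose share of the p-th moment is at most the whole;
    [kap / K] is [K^(1/p - 1)]. *)
Lemma gsum_le x (k : 'I_K) : sX x -> gsum x k <= kap / K%:R * snm x.
Proof.
move=> Xx; set y := fun c => bcoord x N (k * s + c)%N.
have -> : gsum x k = avg s (fun c => `|y c|) / K%:R.
  by rewrite /gsum /avg LE; field; rewrite !gt_eqF.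
rewrite [X in _ <= X]mulrAC ler_pM2r ?invr_gt0//.
apply: (le_of_powR p1).
- exact: avg_ge0.
- by rewrite mulr_ge0 ?snm_ge0// ltW// kap_gt0.
have := @jensen _ s _ (fun c => `|y c|) (sz_gt0 m) (supported_powR p1).
rewrite /= ger0_norm; last exact: avg_ge0.
move/le_trans; apply.
rewrite powRM ?snm_ge0 ?(ltW kap_gt0)// powR_kap.
apply: le_trans (ler_wpM2l (ltW K0') (coord_avg_powR p1 N Xx)).
rewrite /avg LE mulrA invfM mulrA mulfV ?gt_eqF// mul1r ler_wpM2l ?invr_ge0//.
rewrite (sumN (fun a => `|bcoord x N a| `^ p)) (bigD1 k)//=.
under eq_bigr do rewrite normr_id.
by rewrite lerDl sumr_ge0// => i _; rewrite sumr_ge0// => c _; exact: powR_ge0.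
Qed.

Lemma sum_gsum_le x : sX x -> \sum_(k < K) gsum x k <= snm x.
Proof.
move=> Xx; apply: le_trans (coord_avg p1 N Xx).
by rewrite /avg (sumN (fun a => `|bcoord x N a|)) mulr_sumr.
Qed.

Lemma coordT_expand v N' a : mz (sz N) v -> (a < sz N')%N ->
  bcoord (T (u N v)) N' a = \sum_(l < K) \sum_(d < s)
    v (l * s + d)%N * bcoord (T (u N (cen (sz N) (l * s + d)))) N' a.
Proof.
move=> mv aN; rewrite -(sumN (fun b => v b * bcoord (T (u N (cen (sz N) b))) N' a)).
rewrite -(coordT_sum p1 bT)//; last by move=> i; exact: cen_mz.
by congr (bcoord (T _) _ _); apply: u_ext => b bN; exact: cen_expand.
Qed.

(** The matrix of [T] on block [N], with rows and columns split into group and position, normalized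
    for the averaged pairing. *)
Definition theta (k : 'I_K) (c : 'I_s) (l : 'I_K) (d : 'I_s) : R :=
  (sz N)%:R^-1 * bcoord (T (u N (cen (sz N) (l * s + d)))) N (k * s + c).

(** The factor [s] turns the sum over the [s] points into the average over block [j], see [lift_ip].
    No [j] occurs: all levels share this scalar. *)
Definition lam_m : R := mean_scalar theta * s%:R.

(** * Variances of the matrix entries *)

Section Tests.
Variables (j : nat) (jm : (j <= m)%N) (w v : nat -> R).
Hypotheses (mw : mz (sz j) w) (mv : mz (sz j) v).
Hypotheses (w1 : forall c, `|w c| <= 1) (v1 : forall c, `|v c| <= 1).
Local Notation rho g := (crho j g).
Local Notation part g := (gpart j g v).
Implicit Type g : sample.

Lemma part_le1 g (l a : nat) : `|part g l a| <= 1.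
Proof. by rewrite /gpart; case: ifP => _ //; rewrite normr0. Qed.

Lemma snm_part g (l : 'I_K) : snm (u N (part g l)) <= kap^-1.
Proof.
apply: (@group_norm l); first exact: part_mz.
- by move=> a _; exact: part_le1.
- by move=> a /negbTE al; rewrite /gpart al.
Qed.

Lemma coordT_part g (l : 'I_K) N' a : (a < sz N')%N ->
  bcoord (T (u N (part g l))) N' a = \sum_(d < s)
    lift j v (g l d) * bcoord (T (u N (cen (sz N) (l * s + d)))) N' a.
Proof.
move=> aN; rewrite coordT_expand//; last exact: part_mz.
rewrite (bigD1 l)//= [X in _ + X]big1 ?addr0.
  by apply: eq_bigr => d _; rewrite /gpart group_div eqxx crho_group.
move=> k kl; apply: big1 => d _; rewrite /gpart group_div.
by move: kl; rewrite -val_eqE => /negbTE->; rewrite mul0r.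
Qed.

Lemma Zf_self g : Zf N (rho g) w N (rho g) v =
  \sum_k \sum_l blk theta (lift j w) (lift j v) k l (g k) (g l).
Proof.
rewrite /Zform /avg (sumN (fun a => bcoord (T (u N (fun b => v (rho g b)))) N a * w (rho g a))) mulr_sumr.
apply: eq_bigr => k _; rewrite /blk exchange_big mulr_sumr/=; apply: eq_bigr => c _.
rewrite coordT_expand; [|exact: crho_mz|exact: group_lt].
rewrite crho_group mulr_suml mulr_sumr; apply: eq_bigr => l _.
rewrite mulr_suml mulr_sumr; apply: eq_bigr => d _.
by rewrite crho_group /theta; ring.
Qed.

(** The term couples, on group [k], the image of the part of the copy in group [l] with a test
    function bounded by 1. *)
Lemma blk_le g (k l : 'I_K) :
  `|blk theta (lift j w) (lift j v) k l (g k) (g l)| <=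
  gsum (T (u N (part g l))) k.
Proof.
have -> : blk theta (lift j w) (lift j v) k l (g k) (g l) = (sz N)%:R^-1 *
    \sum_(c < s) bcoord (T (u N (part g l))) N (k * s + c)%N * lift j w (g k c).
  rewrite /blk mulr_sumr; apply: eq_bigr => c _.
  rewrite coordT_part; last exact: group_lt.
  rewrite mulr_suml mulr_sumr; apply: eq_bigr => d _; rewrite /theta; ring.
rewrite normrM ger0_norm ?invr_ge0// ler_wpM2l ?invr_ge0//.
apply: le_trans (ler_norm_sum _ _ _) _; apply: ler_sum => c _.
by rewrite normrM ler_piMr// /lift.
Qed.

Let Xpart g (l : 'I_K) : sX (u N (part g l)).
Proof. by apply: blk_X; exact: part_mz. Qed.

Let Tpart g (l : 'I_K) : snm (T (u N (part g l))) <= C / kap.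
Proof. by apply: le_trans (Tbd (Xpart g l)) _; rewrite ler_wpM2l// snm_part. Qed.

Lemma gsum_part g (k l : 'I_K) : gsum (T (u N (part g l))) k <= C / K%:R.
Proof.
apply: le_trans (gsum_le k (TX (Xpart g l))) _.
apply: (@le_trans _ _ (kap / K%:R * (C / kap))).
  by rewrite ler_wpM2l// divr_ge0// ltW// kap_gt0.
by rewrite le_eqVlt; apply/orP; left; apply/eqP; field; rewrite !gt_eqF// kap_gt0.
Qed.

(** A single term is at most [C / K], the terms with fixed [l] sum to at most [C / kap], and there
    are [K] values of [l]. *)
Lemma blk_sqr_le g :
  \sum_k \sum_l blk theta (lift j w) (lift j v) k l (g k) (g l) ^+ 2 <= C ^+ 2 / kap.
Proof.
rewrite pair_bigA/=.
have -> : C ^+ 2 / kap = (C / K%:R) * (K%:R * (C / kap)).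
  by field; rewrite !gt_eqF// kap_gt0.
apply: (@sum_sqr_le _ _ _ (fun kl : 'I_K * 'I_K => gsum (T (u N (part g kl.2))) kl.1)).
- by move=> [k l]; exact: blk_le.
- by move=> [k l]; exact: gsum_part.
- by rewrite divr_ge0.
rewrite -(pair_bigA _ (fun k l : 'I_K => gsum (T (u N (part g l))) k))/= exchange_big/=.
apply: (@le_trans _ _ (\sum_(l < K) C / kap)); last by rewrite sumr_const card_ord mulr_natl.
apply: ler_sum => l _; exact: le_trans (sum_gsum_le (TX (Xpart g l))) (Tpart g l).
Qed.

Lemma self_variance : \sum_(g : sample) (Zf N (rho g) w N (rho g) v -
    lam_m * avg (sz j) (fun c => w c * v c)) ^+ 2 <=
  #|{: sample}|%:R * (6 * (C ^+ 2 / kap)).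
Proof.
apply: le_trans (sum_bilinear_perm (Y := C ^+ 2 / kap) s1 (lift_sum jm mw)
  (lift_sum jm mv) blk_sqr_le).
rewrite le_eqVlt; apply/orP; left; apply/eqP; apply: eq_bigr => g _.
by rewrite Zf_self lift_ip// /lam_m mulrA.
Qed.

(** The scalar comes from the terms with [k = l] only, so it may be computed with one permutation
    common to all groups; each of the [K] terms is then at most [C / K]. *)
Lemma lam_m_le : `|lam_m * avg (sz j) (fun c => w c * v c)| <= C.
Proof.
have P0 : 0 < #|{: {perm 'I_s}}|%:R :> R.
  by rewrite ltr0n; apply/card_gt0P; exists 1%g.
rewrite /lam_m -mulrA -lift_ip// -(ler_pM2l P0) -{1}[#|_|%:R]ger0_norm//.
rewrite -normrM -(blk_sum_perm s1 theta (lift_sum jm mw) (lift_sum jm mv)).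
rewrite exchange_big/=; apply: le_trans (ler_norm_sum _ _ _) _.
rewrite mulr_natl -sumr_const; apply: ler_sum => sg _.
apply: le_trans (ler_norm_sum _ _ _) _.
apply: (@le_trans _ _ (\sum_(k < K) C / K%:R)); last first.
  by rewrite sumr_const card_ord -[X in X <= _]mulr_natl mulrCA mulfV ?mulr1// gt_eqF.
apply: ler_sum => k _.
have := le_trans (blk_le [ffun=> sg] k k) (gsum_part _ k k).
by rewrite !ffunE.
Qed.

(** Here [x] stands for the image of an older copy, tested against the new one. Its mass is at most
    [C * kap / K] on each group and at most [C] in total. *)
Lemma new_target_variance (x : sdom S -> R) : sX x -> snm x <= C ->
  \sum_(g : sample) (avg (sz N) (fun a => bcoord x N a * v (rho g a))) ^+ 2 <=
  #|{: sample}|%:R * (C ^+ 2 * (kap / K%:R)).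
Proof.
move=> Xx xC.
pose psi (k : 'I_K) (c : 'I_s) := (sz N)%:R^-1 * bcoord x N (k * s + c)%N.
have E g : avg (sz N) (fun a => bcoord x N a * v (rho g a)) =
    \sum_k \sum_c psi k c * lift j v (g k c).
  rewrite /avg (sumN (fun a => bcoord x N a * v (rho g a))) mulr_sumr.
  apply: eq_bigr => k _; rewrite mulr_sumr; apply: eq_bigr => c _.
  by rewrite crho_group mulrA.
under eq_bigr do rewrite E.
apply: sum_linear_perm => //; first exact: lift_sum.
move=> g; have -> : C ^+ 2 * (kap / K%:R) = (kap / K%:R * C) * C by ring.
apply: (@sum_sqr_le _ _ _ (fun k : 'I_K => gsum x k)).
- move=> k; apply: le_trans (ler_norm_sum _ _ _) _.
  rewrite /gsum mulr_sumr; apply: ler_sum => c _.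
  rewrite normrM /psi normrM ger0_norm ?invr_ge0// ler_piMr ?mulr_ge0 ?invr_ge0//.
  by rewrite /lift.
- move=> k; apply: le_trans (gsum_le k Xx) _.
  by rewrite ler_wpM2l// divr_ge0// ltW// kap_gt0.
- by rewrite mulr_ge0// divr_ge0// ltW// kap_gt0.
- exact: le_trans (sum_gsum_le Xx) xC.
Qed.

(** The pairing of the new image with a fixed test is a functional of norm at most [C]. On the part
    in one group it is at most [C / kap]; the sum of its absolute values over the groups is its
    value at a signed sum of the parts, a function bounded by 1. *)
Lemma new_source_variance N' (w' : nat -> R) : (forall a, `|w' a| <= 1) ->
  \sum_(g : sample) (avg (sz N') (fun a =>
      bcoord (T (u N (fun b => v (rho g b)))) N' a * w' a)) ^+ 2 <=
  #|{: sample}|%:R * (C ^+ 2 / kap).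
Proof.
move=> w'1.
pose Lam f := avg (sz N') (fun a => bcoord (T (u N f)) N' a * w' a).
have Lam_le f : mz (sz N) f -> `|Lam f| <= C * snm (u N f).
  move=> mf; have Xf := blk_X S mf.
  apply: le_trans (norm_avg _ _) _; apply: le_trans (Tbd Xf).
  apply: le_trans (coord_avg p1 N' (TX Xf)); apply: le_avg => a _.
  by rewrite normrM ler_piMr.
pose psi (k : 'I_K) (c : 'I_s) := Lam (cen (sz N) (k * s + c)).
have E g : avg (sz N') (fun a => bcoord (T (u N (fun b => v (rho g b)))) N' a * w' a) =
    \sum_k \sum_c psi k c * lift j v (g k c).
  transitivity (avg (sz N') (fun a => \sum_(k < K) \sum_(c < s) lift j v (g k c) *
      (bcoord (T (u N (cen (sz N) (k * s + c)))) N' a * w' a))).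
    apply: eq_avg => a aN; rewrite coordT_expand//; last exact: crho_mz.
    rewrite mulr_suml; apply: eq_bigr => k _; rewrite mulr_suml.
    by apply: eq_bigr => c _; rewrite crho_group mulrA.
  rewrite avg_sum; apply: eq_bigr => k _; rewrite avg_sum; apply: eq_bigr => c _.
  by rewrite avgZ mulrC.
have Epart g (l : 'I_K) : Lam (part g l) = \sum_c psi l c * lift j v (g l c).
  transitivity (avg (sz N') (fun a => \sum_(c < s) lift j v (g l c) *
      (bcoord (T (u N (cen (sz N) (l * s + c)))) N' a * w' a))).
    apply: eq_avg => a aN; rewrite coordT_part// mulr_suml.
    by apply: eq_bigr => c _; rewrite mulrA.
  by rewrite avg_sum; apply: eq_bigr => c _; rewrite avgZ mulrC.
under eq_bigr do rewrite E.
apply: sum_linear_perm => //; first exact: lift_sum.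
move=> g; under eq_bigr do rewrite -Epart.
have -> : C ^+ 2 / kap = (C / kap) * C by ring.
apply: (@sum_sqr_le _ _ _ (fun l : 'I_K => `|Lam (part g l)|)) => //.
- move=> l; apply: le_trans (Lam_le _ _) _; first exact: part_mz.
  by rewrite ler_wpM2l// snm_part.
- by rewrite divr_ge0// ltW// kap_gt0.
pose sg (l : nat) := Num.sg (Lam (part g l)).
pose f a := \sum_(l < K) sg l * part g l a.
have mf : mz (sz N) f.
  rewrite /mz exchange_big big1//= => l _; rewrite -mulr_sumr.
  by rewrite (part_mz _ _ _ mv) ?mulr0.
have f1 a : (a < sz N)%N -> `|f a| <= 1.
  move=> aN; have ak : (a %/ s < K)%N by rewrite ltn_divLR ?sz_gt0// -szNE.
  rewrite /f (bigD1 (Ordinal ak))//= [X in _ + X]big1 ?addr0; last first.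
    by move=> l; rewrite -val_eqE/= eq_sym => /negbTE al; rewrite /gpart al mulr0.
  rewrite normrM -[X in _ <= X]mulr1; apply: ler_pM => //; last exact: part_le1.
  by rewrite normr_sg; case: eqP.
have -> : \sum_(l < K) `|Lam (part g l)| = Lam f.
  transitivity (\sum_(l < K) sg l * Lam (part g l)).
    by apply: eq_bigr => l _; rewrite -normrEsg.
  transitivity (avg (sz N') (fun a => \sum_(l < K) sg l *
      (bcoord (T (u N (part g l))) N' a * w' a))).
    by rewrite avg_sum; apply: eq_bigr => l _; rewrite avgZ.
  apply: eq_avg => a aN.
  rewrite (coordT_sum p1 bT sg (F := fun l => part g l))//.
    by rewrite mulr_suml; apply: eq_bigr => l _; rewrite mulrA.
  by move=> l lK; exact: (part_mz jm g (Ordinal lK) mv).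
apply: le_trans (ler_norm _) _; apply: le_trans (Lam_le _ mf) _.
by rewrite ler_piMr//; apply: (snm_u_le p1).
Qed.

End Tests.
End Stage.

(** * Choice of the copies and factorization *)

(** Recursive choice where each step sees the earlier ones. The list [L n] stores them and is read
    beyond its end with the default [x0]; the second hypothesis makes those entries harmless. *)
Lemma history_choice (X : Type) (x0 : X) (P : nat -> (nat -> X) -> X -> Prop) :
  (forall j h, exists x, P j h x) ->
  (forall j h h' x, (forall i, (i < j)%N -> h i = h' i) -> P j h x -> P j h' x) ->
  exists f, forall j, P j f (f j).
Proof.
move=> Pex Pext.
have [F FP] := choice (fun jh : nat * (nat -> X) => Pex jh.1 jh.2).
pose L := fix L n := if n is n'.+1 then rcons (L n') (F (n', nth x0 (L n'))) else [::].
have sL n : size (L n) = n by elim: n => //= n IH; rewrite size_rcons IH.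
have nL n k i : (i < n)%N -> nth x0 (L (n + k)%N) i = nth x0 (L n) i.
  move=> ni; elim: k => [|k IH]; first by rewrite addn0.
  by rewrite addnS/= nth_rcons sL (leq_trans ni (leq_addr _ _)).
pose f j := nth x0 (L j.+1) j.
exists f => j.
have -> : f j = F (j, nth x0 (L j)) by rewrite /f/= nth_rcons sL ltnn eqxx.
apply: (Pext j (nth x0 (L j))); last exact: (FP (j, _)).
by move=> i ij; rewrite /f -(subnKC ij) nL.
Qed.

Lemma cluster_point {R : realType} (x : nat -> R) (c : R) : (forall n, `|x n| <= c) ->
  exists l, forall e n, 0 < e -> exists2 m, (n <= m)%N & `|l - x m| <= e.
Proof.
move=> xc; have [l [_ /cluster_eventuallyP h]] :
    exists l, (`[- c, c]%classic `&` cluster (x n @[n --> \oo])) l.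
  apply: segment_compact; exists 0%N => // n _ /=.
  by rewrite in_itv/= -ler_norml.
by exists l => e n e0; exact: h.
Qed.

(** [kap] is the m-th power of [x = 2^(1/p)], and [1 < x < 2], so the powers of [x^-1] and of
    [x / 2] both tend to 0. *)
Lemma kap_small {R : realType} (p : R) (d : R) : 1 < p -> 0 < d ->
  exists m0, forall m, (m0 <= m)%N -> (@kap R p m)^-1 + @kap R p m / (2 ^ m)%:R < d.
Proof.
move=> p1 d0; have d20 : 0 < d / 2 by rewrite divr_gt0.
have p0 : 0 < p by exact: lt_trans p1.
set x := 2 `^ p^-1 : R.
have lt1 r : 0 < r -> 1 < 2 `^ r :> R.
  move=> r0; rewrite -[X in X < _](_ : 1 `^ r = 1); last by rewrite powR1.
  by apply: gt0_ltr_powR; rewrite ?nnegrE//; lra.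
have x1 : 1 < x by apply: lt1; rewrite invr_gt0.
have x2 : x < 2.
  have h : 2 < 2 `^ p :> R.
    by rewrite -(mulr_powRB1 (x := 2) (p := p))// ltr_pMr// lt1//; lra.
  have -> : 2 = (2 `^ p) `^ p^-1 :> R by rewrite -powRrM mulfV ?gt_eqF// powRr1.
  by apply: gt0_ltr_powR; rewrite ?nnegrE ?invr_gt0// powR_ge0.
have geo (z : R) : 0 <= z -> z < 1 -> exists m0, forall m, (m0 <= m)%N -> z ^+ m < d / 2.
  move=> z0 z1; have : `|z| < 1 by rewrite ger0_norm.
  move=> /cvg_expr/cvgrPdist_lt/(_ _ d20)[m0 _ hm]; exists m0 => m mm.
  by have := hm m mm; rewrite /= sub0r normrN ger0_norm// exprn_ge0.
have [m1 h1] : exists m0, forall m, (m0 <= m)%N -> x^-1 ^+ m < d / 2.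
  by apply: geo; rewrite ?invr_ge0 ?invf_lt1//; lra.
have [m2 h2] : exists m0, forall m, (m0 <= m)%N -> (x / 2) ^+ m < d / 2.
  by apply: geo; lra.
exists (maxn m1 m2) => m; rewrite geq_max => /andP[/h1 + /h2].
by rewrite /kap -/x natrX exprVn exprMn exprVn; lra.
Qed.

(** * Selection of the copies *)

Section Select.
Context {R : realType} {p : R} (p1 : 1 < p) (S : block_space p).
Variables (T : (sdom S -> R) -> (sdom S -> R)) (C : R).
Hypotheses (C0 : 0 <= C) (bT : bounded_op T C).
Local Notation u := (blk_u (b := S)).
Local Notation bcoord := (bcoord p1).
Local Notation Zf := (Zform p1 T).
Local Notation lam_m := (lam_m p1 T).

Let TX f : sX f -> sX (T f). Proof. by have [h _ _] := bT; exact: h. Qed.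
Let Tbd f : sX f -> snm (T f) <= C * snm f. Proof. by have [_ _ h] := bT; exact: h. Qed.

(** Tested on the block of two points, where a centred indicator takes the values 1/2 and -1/2 and
    has mean square 1/4. *)
Lemma lam_m_bounded m : `|lam_m m| <= 4 * C.
Proof.
have mc : mz (sz 0) (cen (sz 0) 0 : nat -> R) by apply: cen_mz; exact: sz_gt0.
have c1 c : `|cen (sz 0) 0 c| <= 1 :> R by exact: cen_le1.
have := lam_m_le p1 C0 bT (leq0n m) mc mc c1 c1.
have -> : avg (sz 0) (fun c => cen (sz 0) 0 c * cen (sz 0) 0 c) = 4^-1 :> R.
  by rewrite /avg /cen /sz !big_ord_recr big_ord0/=; field.
by rewrite normrM [`|4^-1|]ger0_norm ?invr_ge0// ler_pdivrMr// mulrC.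
Qed.

(** [h] records the earlier copies. Both directions of the interaction are tested, as [T] need not
    be symmetric. *)
Definition stage_ok (j : nat) (eta lam : R) (h : nat -> nat * (nat -> nat))
    (x : nat * (nat -> nat)) : Prop :=
  [/\ forall i, (i < j)%N -> ((h i).1 < x.1)%N,
      @equidistributed R (sz x.1) (sz j) x.2,
      forall i b b', (i < j)%N -> (b < sz i)%N -> (b' < sz j)%N ->
        `|Zf x.1 x.2 (cen (sz j) b') (h i).1 (h i).2 (cen (sz i) b)| <= eta /\
        `|Zf (h i).1 (h i).2 (cen (sz i) b) x.1 x.2 (cen (sz j) b')| <= eta
    & forall b b', (b < sz j)%N -> (b' < sz j)%N ->
        `|Zf x.1 x.2 (cen (sz j) b') x.1 x.2 (cen (sz j) b) -
          lam * avg (sz j) (fun c => cen (sz j) b c * cen (sz j) b' c)| <= eta].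

(** One half of [eta] pays for the fluctuations of the sample, the other for the distance from
    [lam_m m] to [lam]. *)
Lemma stage j eta lam h : 0 < eta ->
  (forall e n, 0 < e -> exists2 m, (n <= m)%N & `|lam - lam_m m| <= e) ->
  (forall i, (i < j)%N -> @equidistributed R (sz (h i).1) (sz i) (h i).2) ->
  exists x, stage_ok j eta lam h x.
Proof.
move=> eta0 lamE hE; have eta20 : 0 < eta / 2 by rewrite divr_gt0.
(* Test indices: an earlier stage [i < j] with a direction, or [i = j] for the entries of the new
   copy with itself, and two points. The range of points is that of block [j] throughout; [W] is set
   to 0 beyond block [i]. *)
pose I := ('I_j.+1 * bool * 'I_(sz j) * 'I_(sz j))%type.
have cY0 : 0 <= #|{: I}|%:R * (6 * C ^+ 2) by rewrite !mulr_ge0// sqr_ge0.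
(* The summand 1 keeps the divisor positive when [C = 0]. *)
have d0 : 0 < (eta / 2) ^+ 2 / (#|{: I}|%:R * (6 * C ^+ 2) + 1).
  by rewrite divr_gt0 ?exprn_gt0//; lra.
have [m0 hm0] := kap_small p1 d0.
(* From [n0] on, [m] is at least [j] and [m0] and exceeds every earlier block index, so block
   [2 * m] is new. *)
pose n0 := (j + m0 + \sum_(i < j) (h i).1.+1)%N.
have [m nm lamm] := lamE _ n0 eta20.
have jm : (j <= m)%N by apply: leq_trans nm; rewrite /n0 -addnA leq_addr.
have m0m : (m0 <= m)%N by apply: leq_trans nm; rewrite /n0 -addnA addnCA leq_addr.
have kd := hm0 m m0m.
(* A common bound for the three kinds of variance. *)
set Y := 6 * C ^+ 2 * ((@kap R p m)^-1 + @kap R p m / (2 ^ m)%:R).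
have kp := @kap_gt0 R p m.
have kK0 : 0 <= @kap R p m / (2 ^ m)%:R :> R by rewrite divr_ge0// ltW.
have kV0 : 0 <= (@kap R p m)^-1 by rewrite invr_ge0 ltW.
have C20 : 0 <= C ^+ 2 by rewrite sqr_ge0.
have hY : #|{: I}|%:R * Y < (eta / 2) ^+ 2.
  rewrite /Y mulrA; set q := #|{: I}|%:R * _ in cY0 d0 kd *.
  move: kd; rewrite ltr_pdivlMr; last by lra.
  set z := _ + _ => kd; have z0 : 0 <= z by rewrite addr_ge0.
  apply: le_lt_trans kd; move: (q) z0 => q'; move: (z) => z'; lra.
have Y1 : 6 * (C ^+ 2 / @kap R p m) <= Y.
  by rewrite /Y mulrDr mulrA lerDl mulr_ge0// mulr_ge0.
have Y2 : C ^+ 2 * (@kap R p m / (2 ^ m)%:R) <= Y.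
  rewrite /Y mulrDr -!mulrA -[X in X <= _]add0r; apply: lerD.
    by rewrite !mulr_ge0.
  by rewrite ler_peMl ?mulr_ge0//; lra.
have Y3 : C ^+ 2 / @kap R p m <= Y.
  apply: le_trans Y1; rewrite ler_peMl ?mulr_ge0//; lra.
have mzc i b : (i < j)%N -> (b < sz i)%N ->
    mz (sz (h i).1) (fun a => cen (sz i) b ((h i).2 a) : R).
  move=> ij bi; apply: (@mz_comp _ _ (sz i) (h i).2 (cen (sz i) b)); rewrite ?sz_gt0//.
    exact: hE.
  exact: cen_mz.
pose N := (2 * m)%N.
pose W (i : I) (g : {ffun 'I_(2 ^ m) -> {perm 'I_(sz m)}}) : R :=
  let: (i, t, b, b') := i in
  if (i < j)%N then
    if (b < sz i)%N then
      if t then Zf N (crho j g) (cen (sz j) b') (h i).1 (h i).2 (cen (sz i) b)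
      else Zf (h i).1 (h i).2 (cen (sz i) b) N (crho j g) (cen (sz j) b')
    else 0
  else Zf N (crho j g) (cen (sz j) b') N (crho j g) (cen (sz j) b) -
       lam_m m * avg (sz j) (fun c => cen (sz j) b' c * cen (sz j) b c).
have c1 i b c : `|cen (sz i) b c| <= 1 :> R by exact: cen_le1 (sz_gt0 i).
have sm : (1 < sz m)%N.
  by rewrite /sz expnS -{1}[2%N]muln1 leq_mul2l expn_gt0.
have cardS : 0 <= #|{: {ffun 'I_(2 ^ m) -> {perm 'I_(sz m)}}}|%:R :> R by [].
have [g gW] : exists g, forall i, `|W i g| <= eta / 2.
  apply: (exists_all_small eta20 _ hY) => -[[[i t] b] b']; rewrite /W.
  case ij: (i < j)%N; last first.
    apply: le_trans (self_variance p1 C0 bT jm _ _ _ _) _ => //.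
    - exact: cen_mz.
    - exact: cen_mz.
    - by rewrite ler_wpM2l.
  case bi: (b < sz i)%N; last first.
    rewrite big1; last by move=> g _; rewrite expr0n.
    by rewrite mulr_ge0//; apply: le_trans Y3; rewrite mulr_ge0.
  have mz1 := mzc i b ij bi; have Xz := blk_X S mz1.
  have nz : snm (u (h i).1 (fun a => cen (sz i) b ((h i).2 a))) <= 1.
    by apply: (snm_u_le p1).
  case: t.
    apply: le_trans (new_target_variance p1 C0 jm _ _ (TX Xz) _) _ => //.
    - exact: cen_mz.
    - by apply: le_trans (Tbd Xz) _; rewrite ler_piMr.
    - by rewrite ler_wpM2l.
  apply: le_trans (new_source_variance p1 C0 bT jm _ _ (h i).1
    (w' := fun a => cen (sz i) b ((h i).2 a)) _) _ => //.
  - exact: cen_mz.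
  - by rewrite ler_wpM2l.
exists (N, crho j g); split => /=.
- move=> i ij; rewrite /N; apply: (@leq_trans m); last exact: leq_pmull.
  apply: leq_trans nm; by rewrite /n0 (bigD1 (Ordinal ij))//= addnCA leq_addr.
- exact: crho_equidistributed.
- move=> i b b' ij bi b'j.
  have ij' : (i < j.+1)%N by exact: ltnW.
  have bj : (b < sz j)%N.
    by apply: leq_trans bi _; rewrite leq_exp2l.
  have e2 : eta / 2 <= eta by lra.
  split; apply: le_trans e2.
    have := gW (Ordinal ij', true, Ordinal bj, Ordinal b'j).
    by rewrite /W/= ij bi.
  have := gW (Ordinal ij', false, Ordinal bj, Ordinal b'j).
  by rewrite /W/= ij bi.
- move=> b b' bj b'j.
  have := gW (Ordinal (ltnSn j), true, Ordinal bj, Ordinal b'j).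
  rewrite /W/= ltnn => h1.
  set A := avg _ _.
  have AE : avg (sz j) (fun c => cen (sz j) b' c * cen (sz j) b c) = A :> R.
    by apply: eq_avg => c _; rewrite mulrC.
  have A1 : `|A| <= 1.
    apply: le_trans (norm_avg _ _) _.
    rewrite -[X in _ <= X](@avg_cst _ (sz j) _ (sz_gt0 j)); apply: le_avg => c _.
    by rewrite normrM -[X in _ <= X]mulr1; apply: ler_pM.
  rewrite AE in h1.
  have -> : Zf N (crho j g) (cen (sz j) b') N (crho j g) (cen (sz j) b) - lam * A =
    (Zf N (crho j g) (cen (sz j) b') N (crho j g) (cen (sz j) b) - lam_m m * A) -
    (lam - lam_m m) * A by ring.
  apply: le_trans (ler_normB _ _) _.
  have : `|(lam - lam_m m) * A| <= eta / 2.
    by rewrite normrM -[X in _ <= X]mulr1; apply: ler_pM.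
  lra.
Qed.

(** The interaction of two copies is controlled when the later one is chosen, which is why the
    tolerance is [etol (maxn i j)]. *)
Lemma scalar_compression : exists A B lam,
  [/\ bounded_op (S1 := S) (S2 := S) A 1, bounded_op (S1 := S) (S2 := S) B 1,
      forall f, sX f -> snm (A (B f) - f) = 0
    & forall f, sX f -> snm (A (T (B f)) - lam *: f) <= 4^-1 * snm f].
Proof.
have [lam lamE] := cluster_point lam_m_bounded.
(* Equidistribution of the history is a premise inside [P], so that a choice exists for every
   history; it is recovered afterwards by induction. *)
pose P j (h : nat -> nat * (nat -> nat)) x :=
  (forall i, (i < j)%N -> @equidistributed R (sz (h i).1) (sz i) (h i).2) ->
  stage_ok j (etol j) lam h x.
have et0 j : 0 < etol j :> R by rewrite invr_gt0 !mulr_gt0// exprn_gt0.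
have Pex j h : exists x, P j h x.
  have [hE|nh] := pselect (forall i, (i < j)%N ->
      @equidistributed R (sz (h i).1) (sz i) (h i).2).
    by have [x ?] := stage (et0 j) lamE hE; exists x.
  by exists (0%N, id) => /nh.
have [|f fP] := history_choice (0%N, id) Pex.
  move=> j h h' x hh Ph hE'; have [|a b c d] := Ph.
    by move=> i ij; rewrite hh//; exact: hE'.
  split => //.
    by move=> i ij; rewrite -hh//; exact: a.
  by move=> i b1 b2 ij h1 h2; rewrite -hh//; exact: c.
have fE n : forall i, (i < n)%N -> @equidistributed R (sz (f i).1) (sz i) (f i).2.
  elim: n => // n IH i; rewrite ltnS leq_eqVlt => /orP[/eqP->|/IH//].
  by have [] := fP n IH.
have fS n := fP n (fE n).
pose N n := (f n).1; pose rho n := (f n).2.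
have Nincr i j : (i < j)%N -> (N i < N j)%N by move=> ij; have [h _ _ _] := fS j; exact: h.
have rhoE n : @equidistributed R (sz (N n)) (sz n) (rho n) by have [] := fS n.
have Zsmall i j b b' : (b < sz i)%N -> (b' < sz j)%N ->
  `|Zf (N j) (rho j) (cen (sz j) b') (N i) (rho i) (cen (sz i) b) -
    (if i == j then lam * avg (sz i) (fun c => cen (sz i) b c * cen (sz i) b' c) else 0)|
  <= etol (maxn i j).
  move=> bi bj; case: (ltngtP i j) => [ij|ji|ij].
  - by rewrite subr0; have [_ _ h _] := fS j; have [] := h i b b' ij bi bj.
  - by rewrite subr0; have [_ _ h _] := fS i; have [] := h j b' b ji bj bi.
  - by subst j; have [_ _ _ h] := fS i; exact: h.
exists (project p1 (S := S) Nincr rhoE), (embed p1 (S := S) Nincr rhoE), lam; split.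
- exact: project_bounded.
- exact: embed_bounded.
- exact: project_embed.
- exact: (almost_scalar C0 bT Nincr rhoE Zsmall).
Qed.

(** Divided by [mu], the compression differs from the identity by at most [2 * 4^-1 = 2^-1]. The
    left factor is the Neumann inverse, of norm at most 2, composed with [mu^-1 A], of norm at most
    2. *)
Lemma invert_compression U D A B mu : 0 <= D ->
  bounded_op (S1 := S) (S2 := S) U D ->
  bounded_op (S1 := S) (S2 := S) A 1 -> bounded_op (S1 := S) (S2 := S) B 1 ->
  2^-1 <= `|mu| ->
  (forall f, sX f -> snm (A (U (B f)) - mu *: f) <= 4^-1 * snm f) ->
  exists A', bounded_op (S1 := S) (S2 := S) A' 4 /\
    forall f, sX f -> snm (A' (U (B f)) - f) = 0.
Proof.
move=> D0 bU bA bB hmu hV.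
have mu0 : mu != 0 by rewrite -normr_gt0; lra.
have muV : `|mu^-1| <= 2.
  by rewrite normfV -[2]invrK lef_pV2// posrE; lra.
have bV := bounded_op_comp ler01 (bounded_op_comp D0 bB bU) bA.
have [VX _ _] := bV; have [AX _ _] := bA; have [UX _ _] := bU; have [BX _ _] := bB.
pose E f := mu^-1 *: A (U (B f)) + (-1) *: f.
have bE : bounded_op (S1 := S) (S2 := S) E 2^-1.
  have [h1 h2 _] := bounded_op_lin mu^-1 (-1) bV (@bounded_op_id _ S).
  split => // f Xf.
  have -> : E f = mu^-1 *: (A (U (B f)) - mu *: f).
    rewrite /E; apply/funext => x; rewrite !fctE /GRing.scale/=.
    by field.
  rewrite snmZ; last by apply: sXB; [exact: VX|exact: sXZ].
  apply: (@le_trans _ _ (2 * (4^-1 * snm f))); last by lra.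
  by apply: ler_pM => //; [exact: snm_ge0|exact: hV].
have [W [bW WE]] := neumann bE.
(* The coefficient 0 lets [bounded_op_lin] express a scalar multiple of [A]. *)
have bA' := bounded_op_lin mu^-1 0 bA (@bounded_op_id _ S).
have := bounded_op_comp (ler0n R 2) bA' bW.
set A' := fun f => W _ => bAA.
exists A'; split.
  have [h1 h2 h3] := bAA; split => // f Xf; apply: le_trans (h3 f Xf) _.
  rewrite ler_wpM2r ?snm_ge0// normr0 mul0r addr0 mulr1; lra.
move=> f Xf; have := WE f Xf.
have -> : f + E f = mu^-1 *: A (U (B f)) + 0 *: U (B f) by rewrite /E; fring.
by [].
Qed.

(** As [A B = I], the same [A] and [B] compress [I - T] to nearly [(1 - lam) I]. *)
Theorem factor_T_or_IT : exists U, (U = T \/ U = (fun f => f - T f)) /\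
  exists A B, [/\ bounded_op (S1 := S) (S2 := S) A 4,
    bounded_op (S1 := S) (S2 := S) B 1
    & forall f, sX f -> snm (A (U (B f)) - f) = 0].
Proof.
have [A [B [lam [bA bB AB ATB]]]] := scalar_compression.
have [AX Alin _] := bA; have [BX _ _] := bB.
case: (leP 2^-1 `|lam|) => hl.
  have [A' [bA' h]] := invert_compression C0 bT bA bB hl ATB.
  by exists T; split; [left|exists A', B].
pose U (f : sdom S -> R) := f - T f.
have bU : bounded_op (S1 := S) (S2 := S) U (1 + C).
  have := bounded_op_lin 1 (-1) (@bounded_op_id _ S) bT.
  rewrite normrN normr1 !mul1r.
  by have -> : (fun f => 1 *: f + (-1) *: T f) = U by apply/funext => f; rewrite /U; fring.
have hl' : 2^-1 <= `|1 - lam|.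
  have := ler_normD (1 - lam) lam; rewrite subrK normr1; lra.
have hU f : sX f -> snm (A (U (B f)) - (1 - lam) *: f) <= 4^-1 * snm f.
  move=> Xf; have XB := BX f Xf; have XTB := TX XB.
  have n1 := Alin _ _ 1 (-1) XB XTB.
  have e1 : 1 *: B f + (-1) *: T (B f) = U (B f) by rewrite /U; fring.
  rewrite e1 in n1.
  have XU : sX (U (B f)) by exact: sXB.
  set X1 := A (U (B f)) in n1 *; set X2 := A (B f) in n1; set X3 := A (T (B f)) in n1.
  have -> : X1 - (1 - lam) *: f = (X1 - (1 *: X2 + (-1) *: X3)) +
     ((X2 - f) - (X3 - lam *: f)) by fring.
  have Y1 : sX X1 by exact: AX.
  have Y2 : sX X2 by exact: AX.
  have Y3 : sX X3 by exact: AX.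
  apply: le_trans (snm_triangle (sXB Y1 (sX_lin 1 (-1) Y2 Y3))
    (sXB (sXB Y2 Xf) (sXB Y3 (sXZ lam Xf)))) _.
  rewrite n1 add0r.
  apply: le_trans (snmB_le (sXB Y2 Xf) (sXB Y3 (sXZ lam Xf))) _.
  by rewrite AB// add0r; exact: ATB.
have D0 : 0 <= 1 + C by rewrite addr_ge0.
have [A' [bA' h]] := invert_compression D0 bU bA bB hl' hU.
by exists U; split; [right|exists A', B].
Qed.

End Select.

(** * Completeness of Lp *)

Section LimInf.
Context {R : realType}.
Implicit Types u : (\bar R)^nat.
Local Open Scope ereal_scope.

Lemma limn_einf_le u c : (forall n, u n <= c) -> limn_einf u <= c.
Proof.
move=> uc; rewrite limn_einf_lim; apply: lime_le; first exact: is_cvg_einfs.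
apply: nearW => n; apply: le_trans (uc n); apply: ereal_inf_lbound.
by exists n => /=.
Qed.

Lemma limn_einf_ge u c : (\forall n \near \oo, c <= u n) -> c <= limn_einf u.
Proof.
move=> [n0 _ cu]; rewrite limn_einf_lim; apply: lime_ge; first exact: is_cvg_einfs.
exists n0 => // n /= n0n; apply: le_ereal_inf_tmp => _ [m /= nm <-].
by apply: cu => /=; exact: leq_trans nm.
Qed.

End LimInf.

Section Lp.
Context d (T : measurableType d) (R : realType) (mu : {measure set T -> \bar R}).
Variable p : R.
Hypothesis p1 : (1 < p)%R.
Local Notation Np f := (Lnorm mu p%:E (EFin \o f)).
Local Open Scope ereal_scope.

Let p0 : (0 < p)%R. Proof. exact: lt_trans ltr01 p1. Qed.

Lemma Lp_pow (f : T -> R) : Np f `^ p = \int[mu]_x (`|f x| `^ p)%:E.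
Proof. by rewrite poweR_Lnorm ?gt_eqF. Qed.

Lemma Lp_le (f : T -> R) (c : R) : (0 <= c)%R ->
  \int[mu]_x (`|f x| `^ p)%:E <= (c `^ p)%:E -> Np f <= c%:E.
Proof.
move=> c0; rewrite -Lp_pow -poweR_EFin => h.
have : (Np f `^ p) `^ p^-1 <= (c%:E `^ p) `^ p^-1.
  apply: gt0_ler_poweR => //; first by rewrite invr_ge0 ltW.
  - by rewrite in_itv/= leey poweR_ge0.
  - by rewrite in_itv/= leey lee_fin powR_ge0.
by rewrite -!poweRrM mulfV ?gt_eqF// !poweRe1// ?lee_fin// Lnorm_ge0.
Qed.

Lemma measurable_powR_norm (f : T -> R) : measurable_fun setT f ->
  measurable_fun setT (EFin \o (fun x => (`|f x| `^ p : R))%R).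
Proof.
move=> mf; apply/measurable_EFinP.
apply: (@measurableT_comp _ _ _ _ _ _ (fun x : R => x `^ p)%R) => //.
exact: measurableT_comp.
Qed.

Lemma LpZ (f : T -> R) (a : R) : measurable_fun setT f ->
  Np (fun x => a * f x)%R = `|a|%:E * Np f.
Proof.
move=> mf; rewrite unlock/=.
under eq_integral => x _.
  rewrite normrM powRM// EFinM; over.
have h0 x : setT x -> 0 <= (EFin \o (fun x => (`|f x| `^ p : R))%R) x.
  by rewrite lee_fin powR_ge0.
have ha : 0 <= (`|a| `^ p)%:E by rewrite lee_fin powR_ge0.
have /= -> := ge0_integralZl mu measurableT (measurable_powR_norm mf) h0 ha.
rewrite poweRM//; last first.
  by apply: integral_ge0 => x _; rewrite lee_fin powR_ge0.
by rewrite poweR_EFin -powRrM mulfV ?gt_eqF// powRr1.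
Qed.

Lemma LpD (f g : T -> R) : measurable_fun setT f -> measurable_fun setT g ->
  Np (fun x => f x + g x)%R <= Np f + Np g.
Proof. by move=> mf mg; apply: minkowski_EFin => //; exact: ltW. Qed.

Lemma eq_ae_Lp (f g : T -> R) : measurable_fun setT f -> measurable_fun setT g ->
  {ae mu, forall x, f x = g x} -> Np f = Np g.
Proof.
move=> mf mg fg; rewrite unlock/=; congr (_ `^ _).
apply: ge0_ae_eq_integral.
- exact: measurableT.
- exact: measurable_powR_norm.
- exact: measurable_powR_norm.
- by move=> x _; rewrite /= lee_fin powR_ge0.
- by move=> x _; rewrite /= lee_fin powR_ge0.
- by apply: filterS fg => x fgx _; rewrite /= fgx.
Qed.

Lemma Lp_eq0 (f : T -> R) : measurable_fun setT f -> Np f = 0 ->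
  {ae mu, forall x, f x = 0%R}.
Proof.
move=> mf /Lnorm_eq0_eq0; rewrite lte_fin => /(_ _ p0) h.
have : measurable_fun setT (EFin \o f) by exact/measurable_EFinP.
move/h; apply: filterS => x /(_ I) /= /eqP.
by rewrite eqe => /eqP.
Qed.

Hypothesis mu1 : mu setT = 1.

Lemma L1_le_Lp (f : T -> R) : measurable_fun setT f ->
  \int[mu]_x `|f x|%:E <= Np f.
Proof.
move=> mf; have q0 : (0 < p / (p - 1))%R by rewrite divr_gt0// subr_gt0.
have pq : (p^-1 + (p / (p - 1))^-1 = 1)%R.
  by rewrite invf_div; field; rewrite gt_eqF.
have := hoelder mu mf (measurable_cst (1%R : R)) p0 q0 pq.
rewrite Lnorm1.
have -> : Lnorm mu (p / (p - 1))%:E (EFin \o @cst T R 1%R) = 1.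
  by rewrite (_ : EFin \o cst 1%R = cst 1)// Lnorm_cst1 mu1 poweR1r.
rewrite mule1; apply: le_trans.
by under [X in _ <= X]eq_integral => x _ do rewrite /= mulr1.
Qed.

Lemma sum_geo_le (a n : nat) :
  (\sum_(a <= k < n) 2^-1 ^+ k <= 2 * 2^-1 ^+ a :> R)%R.
Proof.
have x0 k : (0 <= 2^-1 ^+ k :> R)%R by rewrite exprn_ge0// invr_ge0.
case: (leqP a n) => [an|na]; last by rewrite big_geq ?mulr_ge0// ltnW.
suff -> : (\sum_(a <= k < n) 2^-1 ^+ k = 2 * 2^-1 ^+ a - 2 * 2^-1 ^+ n :> R)%R.
  by rewrite gerBl mulr_ge0.
elim: n an => [|n IH]; first by rewrite leqn0 => /eqP->; rewrite big_geq ?subrr.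
rewrite leq_eqVlt => /orP[/eqP<-|an]; first by rewrite big_geq ?subrr.
by rewrite big_nat_recr// IH//= exprS; field.
Qed.

(** The Riesz-Fischer argument: on a probability space the increments are summable in L1, so the
    sequence converges almost everywhere, and Fatou's lemma carries the geometric bound to the
    limit. *)
Lemma Lp_complete (x : nat -> T -> R) : (forall k, measurable_fun setT (x k)) ->
  (forall k, Np (fun t => x k.+1 t - x k t)%R <= (2^-1 ^+ k)%:E) ->
  exists2 y : T -> R, measurable_fun setT y &
    forall k, Np (fun t => y t - x k t)%R <= (2 * 2^-1 ^+ k)%:E.
Proof.
move=> mx hx; pose df k t := (x k.+1 t - x k t)%R.
have mdf k : measurable_fun setT (df k) by exact: measurable_funB.
have madf k : measurable_fun setT (EFin \o (fun t => (`|df k t| : R))%R).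
  by apply/measurable_EFinP; exact: measurableT_comp.
pose s t := \sum_(0 <= k <oo) `|df k t|%:E.
have s_int : \int[mu]_t s t <= 2%:E.
  rewrite integral_nneseries//.
  apply: lime_le; first by apply: is_cvg_nneseries => n _ _; exact: integral_ge0.
  apply: nearW => n.
  apply: (@le_trans _ _ (\sum_(0 <= k < n) (2^-1 ^+ k)%:E)).
    apply: lee_sum => k _; apply: le_trans (hx k).
    exact: L1_le_Lp.
  by rewrite sumEFin lee_fin; have := sum_geo_le 0 n; rewrite expr0 mulr1.
have ms : measurable_fun setT s.
  apply: (@ge0_emeasurable_sum _ T R setT (fun k t => `|df k t|%:E) xpredT).
    by move=> k t _ _; rewrite lee_fin.
  by move=> k _; exact: madf.
have s0 t : 0 <= s t by exact: nneseries_ge0.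
have s_fin : {ae mu, forall t, s t \is a fin_num}.
  have : mu.-integrable setT s.
    apply/integrableP; split => //.
    under eq_integral do rewrite gee0_abs//.
    exact: le_lt_trans s_int (ltry _).
  by move/(integrable_ae measurableT); apply: filterS => t; exact.
(* The upper limit gives a function measurable everywhere that equals the limit almost
   everywhere. *)
pose y t := fine (limn_esup (fun n => (x n t)%:E)).
have my : measurable_fun setT y.
  apply: measurableT_comp => //.
  apply: measurable_fun_limn_esup => n; exact/measurable_EFinP.
have ylim : {ae mu, forall t, x n t @[n --> \oo] --> y t}.
  apply: filterS s_fin => t st.
  have cd : cvgn (series (fun k => df k t)).
    apply: normed_cvg; apply: nondecreasing_is_cvgn.
      apply: nondecreasing_series => n _ _; exact: normr_ge0.
    exists (fine (s t)) => _ [n _ <-]; rewrite -lee_fin fineK//.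
    rewrite /series/= -sumEFin; exact: nneseries_lim_ge.
  have xE n : x n t = (x 0%N t + series (fun k => df k t) n)%R.
    by rewrite seriesEnat/= telescope_sumr// addrC subrK.
  have : cvgn (x^~ t).
    rewrite (_ : x^~ t = (fun n => x 0%N t + series (fun k => df k t) n)%R).
      by apply: is_cvgD => //; exact: is_cvg_cst.
    by apply/funext => n; exact: xE.
  move=> /cvg_ex[l xl].
  have xlE : (x n t)%:E @[n --> \oo] --> l%:E by apply: cvg_EFin; [exact: nearW|exact: xl].
  by rewrite /y (cvg_limn_einf_sup xlE).2.
exists y => // k.
apply: Lp_le; first by rewrite mulr_ge0// exprn_ge0// invr_ge0.
pose f n t := (`|x (n + k)%N t - x k t| `^ p)%:E.
have mf n : measurable_fun setT (f n).
  by apply: (measurable_powR_norm (f := fun t => (x (n + k)%N t - x k t)%R));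
     exact: measurable_funB.
have fint n : \int[mu]_t f n t <= ((2 * 2^-1 ^+ k) `^ p)%:E.
  rewrite -(@Lp_pow (fun t => (x (n + k)%N t - x k t)%R)) -poweR_EFin.
  apply: gt0_ler_poweR.
  - exact: ltW.
  - by rewrite in_itv/= leey Lnorm_ge0.
  - by rewrite in_itv/= leey lee_fin mulr_ge0// exprn_ge0// invr_ge0.
  apply: (@le_trans _ _ (\sum_(k <= j < n + k) (2^-1 ^+ j)%:E)); last first.
    by rewrite sumEFin lee_fin sum_geo_le.
  elim: n => [|n IH].
    rewrite add0n big_geq// (_ : (fun t => x k t - x k t)%R = cst 0%R).
      by rewrite (_ : EFin \o cst 0%R = cst 0)// Lnorm0// eqe gt_eqF.
    by apply/funext => t; rewrite subrr.
  rewrite addSn big_nat_recr ?leq_addl//=.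
  have -> : (fun t => x (n + k).+1 t - x k t)%R =
    (fun t => (x (n + k)%N t - x k t) + (x (n + k).+1 t - x (n + k)%N t))%R.
    by apply/funext => t; ring.
  apply: le_trans (LpD _ _) _.
  - exact: measurable_funB.
  - exact: measurable_funB.
  - by apply: leeD.
apply: (@le_trans _ _ (\int[mu]_t limn_einf (f^~ t))); last first.
  apply: le_trans (fatou mu measurableT mf _) _.
    by move=> n t _; rewrite lee_fin powR_ge0.
  by apply: limn_einf_le.
apply: ae_ge0_le_integral.
- exact: measurableT.
- by move=> t _; rewrite lee_fin powR_ge0.
- by apply: (measurable_powR_norm (f := fun t => (y t - x k t)%R)); exact: measurable_funB.
- by move=> t _; apply: limn_einf_ge; apply: nearW => n; rewrite lee_fin powR_ge0.
- apply: (@measurableT_comp _ _ _ _ _ _ oppe) => //.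
  apply: (@measurable_fun_limn_esup _ _ _ _ (fun n t => - f n t)) => n.
  exact: (@measurableT_comp _ _ _ _ _ _ oppe).
apply: filterS ylim => t yt _.
(* Lower semicontinuity of the power is read off its supporting line at the limit. *)
have [sl hsl] := supported_powR p1 (y t - x k t)%R.
apply/lee_addgt0Pr => e e0.
rewrite -leeBlDr//; apply: limn_einf_ge.
have sl0 : (0 < e / (`|sl| + 1))%R by rewrite divr_gt0// ltr_wpDl.
move/cvgrPdist_le : yt => /(_ _ sl0)[n0 _ hn0].
exists n0 => // n /= n0n; rewrite /f -EFinB lee_fin.
apply: le_trans (hsl (x (n + k)%N t - x k t)%R); rewrite lerD2l.
have /= := hn0 (n + k)%N (leq_trans n0n (leq_addr _ _)) => h.
have -> : (x (n + k)%N t - x k t - (y t - x k t) = - (y t - x (n + k)%N t))%R by ring.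
rewrite mulrN lerN2; apply: le_trans (ler_norm _) _; rewrite normrM.
apply: (@le_trans _ _ (`|sl| * (e / (`|sl| + 1)))%R); first by rewrite ler_wpM2l.
rewrite mulrCA ger_pMr// ler_pdivrMr ?ltr_wpDl// mul1r lerDl//.
Qed.

End Lp.

(** * Distribution of the Haar blocks *)

Section Dyadic.
Context {R : realType}.

(** The index of the dyadic interval of length [2^-L] containing [x], for [x >= 0]. *)
Definition dig (L : nat) (x : R) : nat := Num.truncn (x * 2 ^+ L).

(** The Haar function in position [i] of its level, read on the intervals of the next level, where
    its two halves have the indices [2 * i] and [2 * i + 1]. *)
Definition hval (i c : nat) : R := (c == 2 * i)%N%:R - (c == 2 * i + 1)%N%:R.

(* The value of the Haar function of index (k, i) on the a-th dyadic interval of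
   length 2^-(n+1), for k <= n. *)
Definition hd (n k i a : nat) : R := hval i (a %/ 2 ^ (n - k)).

Lemma haar_dig k i (x : R) : 0 <= x -> haar k i x = hval i (dig k.+1 x).
Proof.
move=> x0; have y0 : 0 <= x * 2 ^+ k.+1 by rewrite mulr_ge0// exprn_ge0.
have t0 j : 0 < 2 ^+ j :> R by rewrite exprn_gt0.
rewrite /haar /hval /dig !indicE !mem_setE !truncn_eq// !in_itv/=.
rewrite !ler_pdivrMr// !ltr_pdivlMr//.
have E : x * 2 ^+ k.+1 = 2 * (x * 2 ^+ k) by rewrite exprS mulrCA.
congr (_%:R - _%:R).
  congr (nat_of_bool (_ && _)); last by rewrite addn1.
  by rewrite E natrM ler_pM2l.
congr (nat_of_bool (_ && _)).
rewrite E -[X in X < _](@mulKf _ 2)// -(ltr_pM2l (x := 2))// mulVKf//.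
by have -> : (2 * i + 1).+1%:R = 2 * i.+1%:R :> R; [rewrite -natrM; congr (_%:R); lia|].
Qed.

Lemma dig_div n k (x : R) : 0 <= x -> (k <= n)%N ->
  dig k.+1 x = (dig n.+1 x %/ 2 ^ (n - k))%N.
Proof.
move=> x0 kn; rewrite /dig.
have E : x * 2 ^+ n.+1 = x * 2 ^+ k.+1 * 2 ^+ (n - k).
  by rewrite -mulrA -exprD addSn subnKC.
rewrite E; set y := x * 2 ^+ k.+1.
have y0 : 0 <= y by rewrite mulr_ge0// exprn_ge0.
set t := (2 ^ (n - k))%N; have t0 : (0 < t)%N by rewrite expn_gt0.
rewrite -natrX -/t; set m := Num.truncn (y * t%:R).
have yt0 : 0 <= y * t%:R by rewrite mulr_ge0.
have /andP[h1 h2] := truncn_itv yt0.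
have t0' : 0 < t%:R :> R by rewrite ltr0n.
apply: truncn_def; apply/andP; split.
  rewrite -(ler_pM2r t0') -natrM; apply: le_trans h1.
  by rewrite ler_nat leq_divM.
rewrite -(ltr_pM2r t0') -natrM; apply: lt_le_trans h2 _.
by rewrite ler_nat -/m ltn_ceil.
Qed.

(** The finest Haar function over [a] takes a nonzero value there and takes it nowhere else, so the
    joint values of a block determine the point. *)
Lemma hval_sep (a c : nat) : hval (a %/ 2) c = hval (a %/ 2) a -> c = a.
Proof.
have aE : a = (2 * (a %/ 2) + odd a)%N by rewrite -modn2 mulnC -divn_eq.
move: aE; set i := (a %/ 2)%N => aE; rewrite /hval.
by case: (c =P (2 * i)%N) => c1; case: (c =P (2 * i + 1)%N) => c2;
   case: (a =P (2 * i)%N) => a1; case: (a =P (2 * i + 1)%N) => a2 /= H;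
   first [lia | exfalso; clear -H; lra].
Qed.

Lemma half_lt n a : (a < sz n)%N -> (a %/ 2 < 2 ^ n)%N.
Proof. by move=> an; rewrite ltn_divLR// mulnC -expnS. Qed.

Lemma hd_mz n k i : (k <= n)%N -> (i < 2 ^ k)%N -> mz (sz n) (hd n k i).
Proof.
move=> kn ik; rewrite /mz /hd.
have E : sz n = (2 ^ k.+1 * 2 ^ (n - k))%N by rewrite /sz -expnD addSn subnKC.
rewrite E (sum_mul (fun a => hval i (a %/ 2 ^ (n - k)))).
have t0 : (0 < 2 ^ (n - k))%N by rewrite expn_gt0.
have -> : \sum_(j < 2 ^ k.+1) \sum_(c < 2 ^ (n - k)) hval i ((j * 2 ^ (n - k) + c) %/ 2 ^ (n - k)) =
   \sum_(j < 2 ^ k.+1) hval i j *+ (2 ^ (n - k)).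
  apply: eq_bigr => j _; rewrite -[in RHS](card_ord (2 ^ (n - k))) -sumr_const.
  by apply: eq_bigr => c _; rewrite divnMDl// divn_small// addn0.
rewrite sumrMnl /hval sumrB.
have D b : (b < 2 ^ k.+1)%N -> \sum_(j < 2 ^ k.+1) (j == b :> nat)%:R = 1 :> R.
  move=> bk; rewrite -[RHS](sum_delta (fun=> 1) bk).
  by apply: eq_bigr => j _; rewrite mul1r.
rewrite !D ?subrr ?mul0rn// expnS; lia.
Qed.

(** The averages of neighbours form a mean-zero function one level up, expanded by induction; the
    half-differences are the coefficients of the finest level. *)
Lemma haar_expansion n (f : nat -> R) : mz (sz n) f -> exists c : nat -> nat -> R,
  forall a, (a < sz n)%N ->
    f a = \sum_(k < n.+1) \sum_(i < 2 ^ k) c k i * hd n k i a.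
Proof.
elim: n f => [|n IH] f mf.
  exists (fun _ _ => f 0%N) => a a2.
  rewrite big_ord_recr big_ord0/= add0r big_ord_recr big_ord0/= add0r.
  move: mf; rewrite /mz /sz !big_ord_recr big_ord0/= add0r => /eqP.
  rewrite addr_eq0 => /eqP f01.
  rewrite /hd /hval/= divn1 muln0 add0n.
  by case: a a2 => [|[|//]] _ /=; rewrite ?f01; ring.
pose f' i := (f (2 * i)%N + f (2 * i + 1)%N) / 2.
have E2 : sz n.+1 = (sz n * 2)%N by rewrite /sz expnS mulnC.
have mf' : mz (sz n) f'.
  move: mf; rewrite /mz E2 (sum_mul f) => mf; rewrite /f' -mulr_suml.
  rewrite [X in X / 2](_ : _ = 0) ?mul0r// -[RHS]mf; apply: eq_bigr => i _.
  by rewrite !big_ord_recr big_ord0/= add0r addn0 mulnC.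
have [c cE] := IH _ mf'.
exists (fun k i => if (k <= n)%N then c k i else (f (2 * i)%N - f (2 * i + 1)%N) / 2) => a an.
have a2 : (a %/ 2 < sz n)%N by rewrite ltn_divLR// -E2.
rewrite big_ord_recr/= ltnn.
have -> : \sum_(k < n.+1) \sum_(i < 2 ^ k)
    (if (k <= n)%N then c k i else (f (2 * i)%N - f (2 * i + 1)%N) / 2) * hd n.+1 k i a =
    f' (a %/ 2)%N.
  rewrite cE//; apply: eq_bigr => k _; apply: eq_bigr => i _.
  have kn : (k <= n)%N by rewrite -ltnS.
  by rewrite kn /hd subSn// expnS divnMA.
have i0 : (a %/ 2 < 2 ^ n.+1)%N by [].
rewrite (bigD1 (Ordinal i0))//= big1 ?addr0; last first.
  move=> i; rewrite -val_eqE/= => ia; rewrite /hd /hval subnn expn0 divn1.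
  have aE : a = (2 * (a %/ 2) + odd a)%N by rewrite -modn2 mulnC -divn_eq.
  have -> : (a == 2 * i)%N = false by apply/eqP => ai; move/eqP: ia; lia.
  have -> : (a == 2 * i + 1)%N = false by apply/eqP => ai; move/eqP: ia; lia.
  by rewrite subrr mulr0.
rewrite /f' /hd subnn expn0 divn1 /hval.
have aE : a = (2 * (a %/ 2) + odd a)%N by rewrite -modn2 mulnC -divn_eq.
move: aE; set i := (a %/ 2)%N => ->; case: (odd a) => /=; rewrite ?addn0 eqxx.
  have -> : (2 * i + 1 == 2 * i)%N = false by lia.
  by rewrite /=; field.
have -> : (2 * i == 2 * i + 1)%N = false by lia.
by rewrite /=; field.
Qed.

End Dyadic.

Lemma sigma_algebra_bigcap_nat (T : Type) (D : set T) (G : set (set T))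
    (A : nat -> set T) (P : set nat) : sigma_algebra D G ->
  (forall i, P i -> G (D `&` A i)) -> G (D `&` \bigcap_(i in P) A i).
Proof.
move=> [G0 GC GU] GA.
have -> : D `&` \bigcap_(i in P) A i =
    D `\` \bigcup_i (if `[< P i >] then D `\` (D `&` A i) else set0).
  apply/seteqP; split => x.
    move=> [Dx Ax]; split => // -[i _]; case: asboolP => // Pi [_]; apply; split => //.
    exact: Ax.
  move=> [Dx nx]; split => // i Pi; apply: contrapT => nA; apply: nx.
  exists i => //; rewrite (asboolT Pi); split => // -[_ Ai]; exact: nA.
apply: (GC); apply: GU => i; case: asboolP => // Pi; apply: (GC); exact: GA.
Qed.

(** * The cells of a block and their independence *)

Section Concrete.
Context {R : realType} (h : nat -> nat -> nat -> R -> R).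
Hypothesis mh : forall n k i, Domega (n, k, i) -> measurable_fun setT (h n k i).
Hypothesis hdist : same_joint_dist h.
Hypothesis hindep : indep_blocks h.
Local Notation mu := (@mu01 R).
Local Notation I01 := (`[(0:R), 1]%classic).

Lemma mu01E A : mu A = lebesgue_measure (A `&` I01).
Proof. by []. Qed.

Lemma mu01_01 A : mu (I01 `&` A) = mu A.
Proof. by rewrite !mu01E -setIA setIC -setIA setIid. Qed.

Lemma mu01_setT : mu setT = 1%E.
Proof. by rewrite mu01E setTI lebesgue_measure_itv/= lte01 oppr0 adde0. Qed.

(* Blocks are numbered from 0: the n-th one is the family [h n.+1], which takes
   [sz n] joint values. *)
Definition cell (n a : nat) : set R :=
  \bigcap_(k in [set k | (k < n.+1)%N]) \bigcap_(i in [set i | (i < 2 ^ k)%N])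
    (h n.+1 k i @^-1` [set hd n k i a]).

Lemma cell_value n a k i x : cell n a x -> (k <= n)%N -> (i < 2 ^ k)%N ->
  h n.+1 k i x = hd n k i a.
Proof. by move=> cx kn ik; apply: (cx k) => //=; rewrite ltnS. Qed.

Lemma cell_disjoint n a b x : (a < sz n)%N -> cell n a x -> cell n b x -> a = b.
Proof.
move=> an ca cb.
have := cell_value ca (leqnn n) (half_lt an).
rewrite (cell_value cb (leqnn n) (half_lt an)) /hd subnn expn0 !divn1.
by move/hval_sep.
Qed.

Lemma measurable_cell n a : measurable (cell n a).
Proof.
apply: bigcap_measurable; first by exists 0%N.
move=> k /= kn; apply: bigcap_measurable; first by exists 0%N; rewrite /= expn_gt0.
move=> i /= ik; rewrite -[X in measurable X]setTI; apply: mh => //.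
by rewrite /Domega /= kn ik.
Qed.

(** Equality of the joint distributions moves the event to the Haar functions themselves, where it
    is a dyadic interval of length [2^-(n+1)]. *)
Lemma mu01_cell n a : (a < sz n)%N -> mu (cell n a) = ((sz n)%:R^-1)%:E.
Proof.
move=> an.
have := hdist (ltn0Sn n) (B := fun k i => [set hd n k i a]).
rewrite -/(cell n a) => -> //.
rewrite mu01E.
have t0 : 0 < 2 ^+ n.+1 :> R by rewrite exprn_gt0.
set D := (X in lebesgue_measure X).
have -> : D = `[a%:R / 2 ^+ n.+1, a.+1%:R / 2 ^+ n.+1[%classic.
  have dE x : 0 <= x -> (dig n.+1 x == a) =
      (x \in `[a%:R / 2 ^+ n.+1, a.+1%:R / 2 ^+ n.+1[ : bool).
    move=> x0; rewrite /dig truncn_eq ?mulr_ge0 ?exprn_ge0//.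
    by rewrite in_itv/= ler_pdivrMr// ltr_pdivlMr.
  rewrite /D; apply/seteqP; split => x /=.
    move=> [hx]; rewrite in_itv/= => /andP[x0 _].
    rewrite -dE//; apply/eqP.
    have := hx n (ltnSn n) (a %/ 2)%N (half_lt an).
    rewrite /= haar_dig// /hd subnn expn0 divn1.
    exact: hval_sep.
  move=> xI; have := xI; rewrite in_itv/= => /andP[x1 x2].
  have x0 : 0 <= x by apply: le_trans x1; rewrite divr_ge0// ltW.
  split.
    move=> k /= kn i /= ik; rewrite haar_dig// /hd; congr (hval _ _).
    rewrite (dig_div x0 (n := n))//.
    by have /eqP -> : dig n.+1 x == a by rewrite dE.
  rewrite in_itv/= x0/=; apply: (le_trans (ltW x2)).
  by rewrite ler_pdivrMr// mul1r -natrX ler_nat.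
rewrite lebesgue_measure_itv/= lte_fin ltr_pM2r ?invr_gt0// ltr_nat ltnSn.
by rewrite -EFinB -mulrBl -natrB// subSn// subnn mul1r -natrX.
Qed.

Lemma cell_gen_sigma n a : gen_sigma h n.+1 (I01 `&` cell n a).
Proof.
have sG := smallest_sigma_algebra I01 [set A | exists k i (B : set R),
  [/\ (k < n.+1)%N, (i < 2 ^ k)%N, measurable B &
   A = `[(0:R), 1] `&` (h n.+1 k i @^-1` B)]].
apply: (sigma_algebra_bigcap_nat sG) => k kn.
apply: (sigma_algebra_bigcap_nat sG) => i ik.
by apply: sub_sigma_algebra; exists k, i, [set hd n k i a]; split.
Qed.

(** Independence applies to the cells cut down to [0,1], which belong to the generated
    sigma-algebras; [map S] passes from block numbers to families counted from 1. *)
Lemma mu01_cells (s : seq nat) (y : nat -> nat) : uniq s ->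
  (forall n, n \in s -> (y n < sz n)%N) ->
  mu (\bigcap_(n in [set` s]) cell n (y n)) = (\prod_(n <- s) (sz n)%:R^-1)%:E.
Proof.
move=> us ys.
have us' : uniq (map S s) by rewrite map_inj_uniq//; exact: succn_inj.
have al : all (fun n => (0 < n)%N) (map S s) by apply/allP => m /mapP[n _ ->].
have gs m : m \in map S s -> gen_sigma h m (I01 `&` cell m.-1 (y m.-1)).
  by move=> /mapP[n _ ->]; exact: cell_gen_sigma.
have := hindep us' al gs; rewrite big_map => H.
transitivity (mu (\bigcap_(n in [set` map S s]) (I01 `&` cell n.-1 (y n.-1)))).
  rewrite !mu01E; congr (lebesgue_measure _); apply/seteqP; split => x [cx Ix].
    split => // m /= /mapP[n ns ->]; split => //; exact: cx.
  split => // n /= ns; have [] := cx n.+1 => //=.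
  by apply/mapP; exists n.
rewrite H (eq_big_seq (fun n => ((sz n)%:R^-1)%:E)).
  by rewrite prodEFin.
by move=> n ns; rewrite -[n.+1.-1]/n mu01_01 mu01_cell// ys.
Qed.

Lemma integral01_cst1 A : measurable A ->
  (\int[mu]_(x in A) (cst 1 : R -> \bar R) x)%E = mu A.
Proof. by move=> mA; rewrite (@integral_cst _ _ _ mu A mA 1%E) mul1e. Qed.

(** The value is 0 off the cells, which miss only a null set. *)
Definition cellf (n : nat) (f : nat -> R) : R -> R :=
  fun x => \sum_(a < sz n) f a * \1_(cell n a) x.

Lemma cu_cell n f a x : (a < sz n)%N -> cell n a x -> cellf n f x = f a.
Proof.
move=> an cx; rewrite /cellf (bigD1 (Ordinal an))//= indicE mem_set// mulr1.
rewrite big1 ?addr0// => b ba; rewrite indicE memNset ?mulr0//.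
move=> cb; move/eqP: ba; apply; apply: val_inj => /=.
exact: (cell_disjoint (ltn_ord b) cb cx).
Qed.

Lemma measurable_cu n f : measurable_fun setT (cellf n f).
Proof.
apply: measurable_sum => a; apply: measurable_funM => //.
by apply: measurable_indic; exact: measurable_cell.
Qed.

Lemma measurable_sum_cu M (G : nat -> nat -> R) :
  measurable_fun setT (fun x => \sum_(n < M) cellf n (G n) x).
Proof. by apply: measurable_sum => n; exact: measurable_cu. Qed.

(** * The p-th moment of a block sum *)

Section Law.
Variable p : R.
Hypothesis p1 : 1 < p.

Lemma sumr_cst_ord (r : R) m : (0 < m)%N -> \sum_(a < m) r / m%:R = r.
Proof.
move=> m0; rewrite sumr_const card_ord -[LHS]mulr_natl mulrCA mulfV ?mulr1//.
by rewrite pnatr_eq0 -lt0n.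
Qed.

(** [F] has measure [r] and is independent of the cells of the first [M] blocks. In the induction
    [F] is cut by the cells of the last block, each piece having an equal share of [r]; on a piece
    that block is constant and is absorbed into [t]. *)
Lemma law_rec (G : nat -> nat -> R) M (F : set R) (r t : R) : measurable F ->
  (forall s y, uniq s -> (forall n, n \in s -> (n < M)%N /\ (y n < sz n)%N) ->
    mu (F `&` \bigcap_(n in [set` s]) cell n (y n)) =
    (r * \prod_(n <- s) (sz n)%:R^-1)%:E) ->
  (\int[mu]_(x in F) (`|t + \sum_(n < M) cellf n (G n) x| `^ p)%:E)%E =
  (r * Phi p G M t)%:E.
Proof.
elim: M F r t => [|M IH] F r t mF HF.
  rewrite (eq_integral (cst (`|t| `^ p)%:E)); last first.
    by move=> x _; rewrite /= big_ord0 addr0.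
  rewrite integral_cst//.
  have := HF [::] id isT; rewrite big_nil mulr1.
  rewrite (_ : [set` [::]] = set0); last by apply/seteqP; split.
  by rewrite bigcap_set0 setIT => -> //; rewrite -EFinM mulrC.
pose Fa (a : 'I_(sz M)) := F `&` cell M a.
have mFa a : measurable (Fa a) by apply: measurableI => //; exact: measurable_cell.
have rF : mu F = r%:E.
  have := HF [::] id isT; rewrite big_nil mulr1.
  rewrite (_ : [set` [::]] = set0); last by apply/seteqP; split.
  by rewrite bigcap_set0 setIT => ->.
have HFa (a : 'I_(sz M)) s y : uniq s ->
    (forall n, n \in s -> (n < M)%N /\ (y n < sz n)%N) ->
    mu (Fa a `&` \bigcap_(n in [set` s]) cell n (y n)) =
    (r / (sz M)%:R * \prod_(n <- s) (sz n)%:R^-1)%:E.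
  move=> us ys; pose y' n := if n == M then a : nat else y n.
  have Ms : M \notin s by apply/negP => /ys[]; rewrite ltnn.
  have := HF (M :: s) y'; rewrite /= Ms us => /(_ isT).
  rewrite big_cons mulrA => <-.
    congr (mu _); apply/seteqP; split => x.
      move=> [[Fx cx] sx]; split => // n /=; rewrite inE => /orP[/eqP->|ns].
        by rewrite /y' eqxx.
      rewrite /y'; case: eqP => [nM|_]; last exact: sx.
      by move: ns; rewrite nM (negbTE Ms).
    move=> [Fx sx]; split.
      by split => //; have := sx M; rewrite /= inE eqxx /y' eqxx => /(_ isT).
    move=> n /= ns; have := sx n; rewrite /= inE ns orbT /y' => /(_ isT).
    by case: eqP => // nM; move: ns; rewrite nM (negbTE Ms).
  move=> n; rewrite inE => /orP[/eqP->|ns].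
    by rewrite /y' eqxx; split.
  have [nM yn] := ys _ ns; split; first exact: ltnW.
  by rewrite /y' ltn_eqF.
pose D := \big[setU/set0]_(a <- index_enum 'I_(sz M)) Fa a.
have mD : measurable D by apply: bigsetU_measurable => a _; exact: mFa.
have triv : trivIset [set` index_enum 'I_(sz M)] Fa.
  move=> a b _ _ [x [[_ ca] [_ cb]]]; apply: val_inj.
  exact: (cell_disjoint (ltn_ord a) ca cb).
have uI := index_enum_uniq 'I_(sz M).
have DF : D `<=` F.
  by rewrite /D -bigcup_seq => x [a _ []].
have muFa a : mu (Fa a) = (r / (sz M)%:R)%:E.
  have := HFa a [::] id isT; rewrite big_nil mulr1.
  rewrite (_ : [set` [::]] = set0); last by apply/seteqP; split.
  by rewrite bigcap_set0 setIT => ->.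
have muD : mu D = r%:E.
  have := ge0_integral_bigsetU mu (F := Fa) (f := cst 1%E) mFa uI triv.
  have mc1 : measurable_fun D (cst 1%E : R -> \bar R) by exact: measurable_cst.
  rewrite -/D => /(_ mc1) /(_ (fun x _ => lee01)).
  rewrite integral01_cst1// => ->.
  rewrite (eq_bigr (fun a => (r / (sz M)%:R)%:E)); last first.
    by move=> a _; rewrite integral01_cst1; [exact: muFa|exact: mFa].
  by rewrite sumEFin sumr_cst_ord// sz_gt0.
pose phi x := (`|t + \sum_(n < M.+1) cellf n (G n) x| `^ p)%:E.
have mphi : measurable_fun setT phi.
  apply: (measurable_powR_norm p (f := fun x => t + \sum_(n < M.+1) cellf n (G n) x)).
  by apply: measurable_funD => //; exact: measurable_sum_cu.
have phi0 x : (0 <= phi x)%E by rewrite lee_fin powR_ge0.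
have FE : F = D `|` (F `\` D).
  apply/seteqP; split => x; last by move=> [/DF|[]].
  by move=> Fx; case: (pselect (D x)) => Dx; [left|right].
have mFD : measurable (F `\` D) by exact: measurableD.
(* What the cells miss of [F] is null, since the pieces have total measure [r]. *)
have -> : (\int[mu]_(x in F) phi x = \int[mu]_(x in D) phi x)%E.
  rewrite {1}FE ge0_integral_setU//; last 2 first.
  - by apply: measurable_funTS.
  - by apply/disj_setPS => x [Dx [_]].
  rewrite [X in (_ + X)%E]null_set_integral ?adde0//.
    by apply: measurable_funTS.
  have Foo : (mu F < +oo)%E by rewrite rF ltry.
  have -> : mu (F `\` D) = (mu F - mu (F `&` D))%E by exact: measureD.
  have -> : F `&` D = D by apply/setIidPr.
  by rewrite rF muD subee.
rewrite ge0_integral_bigsetU//; last by apply: measurable_funTS.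
rewrite (eq_bigr (fun a : 'I_(sz M) =>
    (r / (sz M)%:R * Phi p G M (t + G M a))%:E)).
  by rewrite sumEFin -mulr_sumr -mulrA.
move=> a _; rewrite -(IH _ _ _ (mFa a) (HFa a)).
apply: eq_integral => x; rewrite inE => -[_ cx].
by rewrite /phi big_ord_recr/= (cu_cell _ (ltn_ord a) cx) addrA addrAC.
Qed.

Lemma law (G : nat -> nat -> R) M :
  (\int[mu]_x (`|\sum_(n < M) cellf n (G n) x| `^ p)%:E)%E = (Phi p G M 0)%:E.
Proof.
have := @law_rec G M setT 1 0 measurableT; rewrite mul1r => <-.
  by apply: eq_integral => x _; rewrite add0r.
move=> s y us ys; rewrite setTI mul1r mu01_cells// => n ns.
by have [] := ys n ns.
Qed.

End Law.

Lemma ae_cell n : {ae mu, forall x, exists2 a, (a < sz n)%N & cell n a x}.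
Proof.
pose D := \big[setU/set0]_(a <- index_enum 'I_(sz n)) cell n a.
have mc (a : 'I_(sz n)) : measurable (cell n a) by exact: measurable_cell.
have mD : measurable D by apply: bigsetU_measurable.
have triv : trivIset [set` index_enum 'I_(sz n)] (fun a : 'I_(sz n) => cell n a).
  move=> a b _ _ [x [ca cb]]; apply: val_inj.
  exact: (cell_disjoint (ltn_ord a) ca cb).
have uI := index_enum_uniq 'I_(sz n).
have muD : mu D = 1%E.
  have := ge0_integral_bigsetU mu (f := cst 1%E) mc uI triv.
  have mc1 : measurable_fun D (cst 1%E : R -> \bar R) by exact: measurable_cst.
  rewrite -/D => /(_ mc1) /(_ (fun x _ => lee01)).
  rewrite integral01_cst1// => ->.
  rewrite (eq_bigr (fun a => (1 / (sz n)%:R)%:E)); last first.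
    by move=> a _; rewrite integral01_cst1; [rewrite mul1r mu01_cell|exact: mc].
  by rewrite sumEFin sumr_cst_ord// sz_gt0.
exists (~` D); split.
- exact: measurableC.
- have Too : (mu setT < +oo)%E by rewrite mu01_setT ltry.
  have H : mu (setT `\` D) = (mu setT - mu (setT `&` D))%E by exact: measureD.
  by rewrite -setTD H setTI muD mu01_setT subee.
- move=> x nx Dx; apply: nx.
  move: Dx; rewrite /D -bigcup_seq => -[a _ cx].
  by exists a.
Qed.

End Concrete.

(** * The space spanned by the Haar blocks *)

Section Final.
Context {R : realType} (p : R) (h : nat -> nat -> nat -> R -> R).
Hypothesis p1 : 1 < p.
Hypothesis mh : forall n k i, Domega (n, k, i) -> measurable_fun setT (h n k i).
Hypothesis hdist : same_joint_dist h.
Hypothesis hindep : indep_blocks h.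
Local Notation mu := (@mu01 R).
Local Notation Np f := (pnorm p f).
Local Notation cu := (cellf h).

Let p0 : 0 < p. Proof. exact: lt_trans ltr01 p1. Qed.

Lemma ae_imply (P Q : R -> Prop) : (forall x, P x -> Q x) ->
  {ae mu, forall x, P x} -> {ae mu, forall x, Q x}.
Proof.
move=> PQ [A [mA A0 AP]]; exists A; split => // x nQ; apply: AP => /= Px.
exact/nQ/PQ.
Qed.

Definition bsum (M : nat) (G : nat -> nat -> R) : R -> R :=
  fun x => \sum_(n < M) cu n (G n) x.

Lemma measurable_bsum M G : measurable_fun setT (bsum M G).
Proof. exact: measurable_sum_cu. Qed.

Lemma bsum_norm M G : Np (bsum M G) = (Phi p G M 0 `^ p^-1)%:E.
Proof.
have : (Np (bsum M G) `^ p = (Phi p G M 0)%:E)%E.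
  by rewrite (Lp_pow mu p1) -(law mh hdist hindep).
move/(congr1 (fun z => z `^ p^-1)%E); rewrite -poweRrM mulfV ?gt_eqF//.
by rewrite poweRe1// Lnorm_ge0.
Qed.

Lemma ae_cells : {ae mu, forall x, exists a : nat -> nat,
  forall n, (a n < sz n)%N /\ cell h n (a n) x}.
Proof.
have := ae_foralln (fun n => ae_cell mh hdist n).
apply: filterS => x hx.
have /choice[a aP] : forall n, exists a, (a < sz n)%N /\ cell h n a x.
  by move=> n; have [a ? ?] := hx n; exists a.
by exists a.
Qed.

Lemma in_span_measurable g : in_span h g -> measurable_fun setT g.
Proof.
move=> [s [c [+ ->]]]; elim: s => [|j s IH] /=.
  by move=> _; under eq_fun do rewrite big_nil; exact: measurable_cst.
move=> /andP[dj /IH ms]; under eq_fun do rewrite big_cons.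
apply: measurable_funD => //; apply: measurable_funM => //.
by apply: mh; move: dj; case: (j) => -[].
Qed.

(** Almost every point lies in a cell of each block, and there the given functions take the
    tabulated values [hd]. *)
Lemma in_span_bsum g : in_span h g ->
  exists M G, mzG G /\ {ae mu, forall x, g x = bsum M G x}.
Proof.
(* The sum of all family indices is at least each of them, so every block that occurs lies below
   [M]. *)
move=> [s [c [ds ->]]]; pose M := (\sum_(j <- s) j.1.1)%N.
pose G n a := \sum_(j <- s | j.1.1.-1 == n) c j * hd n j.1.2 j.2 a : R.
have dj j : j \in s -> [/\ (0 < j.1.1)%N, (j.1.2 < j.1.1)%N & (j.2 < 2 ^ j.1.2)%N].
  by move/allP: ds => /(_ j) + js => /(_ js); case: (j) => -[n k] i /= /and3P[].
exists M, G; split.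
  move=> n; rewrite /mz /G exchange_big/= big_seq_cond big1// => j /andP[js /eqP jn].
  have [h1 h2 h3] := dj j js.
  rewrite -mulr_sumr (@hd_mz _ n j.1.2 j.2) ?mulr0//.
  by rewrite -jn -ltnS prednK.
have := ae_cells; apply: ae_imply => x [a aP].
rewrite /bsum.
transitivity (\sum_(n < M) \sum_(j <- s)
    (if j.1.1.-1 == n then c j * hd n j.1.2 j.2 (a n) else 0)); last first.
  apply: eq_bigr => n _; have [h1 h2] := aP n.
  by rewrite (cu_cell _ h1 h2) /G [RHS]big_mkcond.
rewrite exchange_big/= big_seq [RHS]big_seq; apply: eq_bigr => j js.
have [h1 h2 h3] := dj j js.
have jM : (j.1.1.-1 < M)%N.
  rewrite prednK// /M (big_rem j)//=; exact: leq_addr.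
rewrite (bigD1 (Ordinal jM))//= eqxx big1 ?addr0; last first.
  move=> n; rewrite -val_eqE/= eq_sym => /negbTE nj.
  by rewrite nj.
congr (_ * _); have [a1 a2] := aP j.1.1.-1.
rewrite -{1}(prednK h1); apply: (cell_value a2) => //.
by rewrite -ltnS prednK.
Qed.

Lemma bsum_in_span M G : mzG G ->
  exists2 g, in_span h g & {ae mu, forall x, bsum M G x = g x}.
Proof.
move=> mG.
have [c cE] := choice (fun n => haar_expansion (mG n)).
pose ki n := [seq (k, i) | k <- index_iota 0 n.+1, i <- index_iota 0 (2 ^ k)].
pose s := [seq (n.+1, q.1, q.2) | n <- index_iota 0 M, q <- ki n].
pose cc (j : nat * nat * nat) := c j.1.1.-1 j.1.2 j.2.
exists (fun x => \sum_(j <- s) cc j * h j.1.1 j.1.2 j.2 x).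
  exists s, cc; split => //; apply/allP => j /allpairsPdep[n [q [nM + ->]]].
  move=> /allpairsPdep[k [i [+ + ->]]]; rewrite !mem_index_iota/= => kn ik.
  by rewrite kn ik.
have := ae_cells; apply: ae_imply => x [a aP].
rewrite /bsum /s big_allpairs_dep big_mkord; apply: eq_bigr => n _.
have [h1 h2] := aP n.
rewrite (cu_cell _ h1 h2) cE// /ki big_allpairs_dep big_mkord; apply: eq_bigr => k _.
rewrite big_mkord; apply: eq_bigr => i _; rewrite /cc/=; congr (_ * _).
by rewrite (cell_value h2)// -ltnS.
Qed.

Lemma RpO_bsumP f : RpO h p f <-> measurable_fun setT f /\
  forall e : R, 0 < e -> exists M G, mzG G /\
    (Np (fun x => f x - bsum M G x)%R < e%:E)%E.
Proof.
split=> -[mf hf]; split => // e e0.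
  have [g [sg fg]] := hf e e0; have [M [G [mG gE]]] := in_span_bsum sg.
  have mg := in_span_measurable sg; have mb := measurable_bsum M G.
  exists M, G; split => //; apply: le_lt_trans fg.
  rewrite le_eqVlt; apply/orP; left; apply/eqP.
  apply: eq_ae_Lp; [exact: measurable_funB..|].
  by move: gE; apply: ae_imply => x ->.
have [M [G [mG fb]]] := hf e e0; have [g sg gE] := bsum_in_span M mG.
have mg := in_span_measurable sg; have mb := measurable_bsum M G.
exists g; split => //; apply: le_lt_trans fb.
rewrite le_eqVlt; apply/orP; left; apply/eqP.
apply: eq_ae_Lp; [exact: measurable_funB..|].
by move: gE; apply: ae_imply => x ->.
Qed.

Lemma Np0 : Np (fun=> 0) = 0%E.
Proof. by rewrite /pnorm (_ : EFin \o _ = cst 0%E)// Lnorm0// eqe gt_eqF. Qed.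

Lemma NpD (f g : R -> R) : measurable_fun setT f -> measurable_fun setT g ->
  (Np (fun x => f x + g x)%R <= Np f + Np g)%E.
Proof. by move=> mf mg; exact: (LpD mu p1). Qed.

Lemma NpZ a (f : R -> R) : measurable_fun setT f -> Np (fun x => a * f x) = (`|a|%:E * Np f)%E.
Proof. by move=> mf; exact: (LpZ mu p1). Qed.

Lemma bsum_RpO M G : mzG G -> RpO h p (bsum M G).
Proof.
move=> mG; apply/RpO_bsumP; split; first exact: measurable_bsum.
move=> e e0; exists M, G; split => //.
rewrite (_ : (fun x => _) = fun=> 0); last by apply/funext => x; rewrite subrr.
by rewrite Np0 lte_fin.
Qed.

Lemma RpO_fin f : RpO h p f -> Np f \is a fin_num.
Proof.
move/RpO_bsumP => [mf /(_ 1 ltr01)[M [G [mG fb]]]].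
rewrite ge0_fin_numE ?Lnorm_ge0//.
have mb := measurable_bsum M G.
have -> : f = fun x => (f x - bsum M G x) + bsum M G x.
  by apply/funext => x; rewrite subrK.
apply: le_lt_trans (NpD _ mb) _; first exact: measurable_funB.
by rewrite bsum_norm lte_add_pinfty ?ltry// (lt_trans fb)// ltry.
Qed.

Lemma bsum_lin M M' G G' a b : mzG G -> mzG G' -> exists M'' G'', mzG G'' /\
  forall x, bsum M'' G'' x = a * bsum M G x + b * bsum M' G' x.
Proof.
move=> mG mG'; pose tr M (G : nat -> nat -> R) n c := if (n < M)%N then G n c else 0.
have mtr K F : mzG F -> mzG (tr K F).
  by move=> mF n; rewrite /tr; case: ltnP => _ //; exact: mz0.
have trE K K' F x : (K <= K')%N -> bsum K' (tr K F) x = bsum K F x.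
  move=> KK'; rewrite /bsum (big_ord_widen _ (fun n => cu n (F n) x) KK') [RHS]big_mkcond.
  apply: eq_bigr => n _; rewrite /tr /cellf; case: ltnP => _ //.
  by apply: big1 => c _; rewrite mul0r.
exists (maxn M M'), (fun n c => a * tr M G n c + b * tr M' G' n c); split.
  by move=> n; apply: mz_lin; exact: mtr.
move=> x; rewrite -(trE M (maxn M M') G x (leq_maxl _ _)).
rewrite -(trE M' (maxn M M') G' x (leq_maxr _ _)) /bsum !mulr_sumr -big_split/=.
apply: eq_bigr => n _; rewrite /cellf !mulr_sumr -big_split/=.
by apply: eq_bigr => c _; ring.
Qed.

Lemma RpO_lin a b f g : RpO h p f -> RpO h p g -> RpO h p (fun x => a * f x + b * g x).
Proof.
move=> Rf Rg; have /RpO_bsumP[mf hf] := Rf; have /RpO_bsumP[mg hg] := Rg.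
apply/RpO_bsumP; split.
  by apply: measurable_funD; apply: measurable_funM.
move=> e e0; pose c := `|a| + `|b| + 1.
have c0 : 0 < c by rewrite ltr_wpDl ?addr_ge0.
have [M [G [mG fG]]] := hf _ (divr_gt0 e0 c0).
have [M' [G' [mG' gG]]] := hg _ (divr_gt0 e0 c0).
have [M'' [G'' [mG'' E]]] := bsum_lin M M' a b mG mG'.
exists M'', G''; split => //.
have mb := measurable_bsum M G; have mb' := measurable_bsum M' G'.
have -> : (fun x => a * f x + b * g x - bsum M'' G'' x) =
    (fun x => a * (f x - bsum M G x) + b * (g x - bsum M' G' x)).
  by apply/funext => x; rewrite E; ring.
have m1 : measurable_fun setT (fun x => f x - bsum M G x) by exact: measurable_funB.
have m2 : measurable_fun setT (fun x => g x - bsum M' G' x) by exact: measurable_funB.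
apply: le_lt_trans (NpD _ _) _; [exact: measurable_funM..|].
rewrite !NpZ//.
apply: (@le_lt_trans _ _ (`|a|%:E * (e / c)%:E + `|b|%:E * (e / c)%:E)%E).
  by apply: leeD; apply: lee_pmul2l_fin || (apply: lee_wpmul2l => //; exact: ltW).
rewrite -!EFinM -EFinD lte_fin -mulrDl mulrCA gtr_pMr// ltr_pdivrMr// mul1r /c; lra.
Qed.

(** Meaningful on [RpO], where the norm is finite by [RpO_fin]. *)
Definition rnm (f : R -> R) : R := fine (Np f).

Lemma rnmE f : RpO h p f -> (rnm f)%:E = Np f.
Proof. by move=> Rf; rewrite /rnm fineK// RpO_fin. Qed.

Lemma RpO_measurable f : RpO h p f -> measurable_fun setT f.
Proof. by case. Qed.

Lemma small_pow (e : R) : 0 < e -> exists K, forall k, (K <= k)%N -> 2 * 2^-1 ^+ k < e.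
Proof.
move=> e0; have e20 : 0 < e / 2 by rewrite divr_gt0.
have z1 : `|2^-1 : R| < 1 by rewrite ger0_norm; lra.
have /cvgrPdist_lt/(_ _ e20)[K _ hK] := cvg_expr z1.
exists K => k Kk; have := hK k Kk; rewrite /= sub0r normrN ger0_norm ?exprn_ge0 ?invr_ge0//.
by lra.
Qed.

Lemma rnm_complete (x : nat -> R -> R) : (forall k, RpO h p (x k)) ->
  (forall k, rnm (x k.+1 - x k) <= 2^-1 ^+ k) ->
  exists2 y, RpO h p y &
    forall e, 0 < e -> exists K, forall k, (K <= k)%N -> rnm (y - x k) <= e.
Proof.
move=> Rx hx; have mx k := RpO_measurable (Rx k).
have [|y my hy] := Lp_complete p1 (mu := mu) (mu01_setT (R := R)) mx.
  move=> k; have RB : RpO h p (fun t => x k.+1 t - x k t).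
    rewrite (_ : (fun t => _) = fun t => 1 * x k.+1 t + (-1) * x k t).
      exact: RpO_lin.
    by apply/funext => t; ring.
  by have := hx k; rewrite -lee_fin rnmE.
have Ry : RpO h p y.
  apply/RpO_bsumP; split => // e e0; have e20 : 0 < e / 2 by rewrite divr_gt0.
  have [K hK] := small_pow e20.
  have /RpO_bsumP[_ /(_ _ e20)[M [G [mG xG]]]] := Rx K.
  exists M, G; split => //; have mb := measurable_bsum M G.
  have -> : (fun t => y t - bsum M G t) =
      (fun t => (y t - x K t) + (x K t - bsum M G t)).
    by apply/funext => t; ring.
  apply: le_lt_trans (NpD _ _) _; [exact: measurable_funB..|].
  have -> : e = e / 2 + e / 2 by field.
  rewrite EFinD; apply: lteD => //; apply: le_lt_trans (hy K) _.
  by rewrite lte_fin; exact: hK.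
exists y => // e e0; have [K hK] := small_pow e0; exists K => k Kk.
have RB : RpO h p (y - x k).
  rewrite (_ : y - x k = fun t => 1 * y t + (-1) * x k t); first exact: RpO_lin.
  by apply/funext => t; rewrite !fctE; ring.
rewrite -lee_fin rnmE//; apply: le_trans (hy k) _.
by rewrite lee_fin ltW// hK.
Qed.

Definition Rspace : sspace R.
Proof.
refine (@SSpace R R (RpO h p) rnm _ _ _ _ _ _).
- have := @bsum_RpO 0 (fun _ _ => 0) (fun n => mz0 _).
  by rewrite (_ : bsum 0 _ = 0)//; apply/funext => x; rewrite /bsum big_ord0.
- by move=> a b f g; exact: RpO_lin.
- by move=> f; apply: fine_ge0; exact: Lnorm_ge0.
- move=> f g Rf Rg.
  have RD : RpO h p (f + g).
    rewrite (_ : f + g = fun t => 1 * f t + 1 * g t); first exact: RpO_lin.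
    by apply/funext => t; rewrite !fctE; ring.
  rewrite -lee_fin EFinD !rnmE//; apply: NpD; exact: RpO_measurable.
- move=> a f Rf.
  have RZ : RpO h p (a *: f).
    rewrite (_ : a *: f = fun t => a * f t + 0 * f t); first exact: RpO_lin.
    by apply/funext => t; rewrite !fctE /GRing.scale/=; ring.
  apply: EFin_inj; rewrite EFinM !rnmE//; apply: NpZ; exact: RpO_measurable.
- exact: rnm_complete.
Defined.

Lemma sum_fctE M (F : nat -> R -> R) : \sum_(n < M) F n = fun x => \sum_(n < M) F n x.
Proof. by apply/funext => x; rewrite fct_sumE. Qed.

Definition Rblocks : block_space p.
Proof.
refine (@BlockSpace R p Rspace cu _ _ _ _ _).
- move=> n x y f g; apply/funext => t; rewrite !fctE /GRing.scale/= /cellf.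
  rewrite !mulr_sumr -big_split/=; apply: eq_bigr => a _; ring.
- move=> n f g fg; apply/funext => t; apply: eq_bigr => a _.
  by rewrite fg.
- move=> n f mf; have [mG _] := single_fin mf.
  have := bsum_RpO n.+1 mG; rewrite (_ : bsum _ _ = cu n f)//.
  apply/funext => x; rewrite /bsum big_ord_recr/= big1 ?add0r.
    by rewrite /single eqxx.
  move=> k _; rewrite /cellf /single ltn_eqF//.
  by apply: big1 => a _; rewrite mul0r.
- move=> M G mG.
  rewrite /= (sum_fctE M (fun n => cu n (G n))) -/(bsum M G) /rnm bsum_norm/=.
  rewrite -powRrM mulVf ?gt_eqF// powRr1//.
  apply: le_trans (Phi_le p1 0 mG (leq0n M)); exact: powR_ge0.
- move=> f Rf e e0; have /RpO_bsumP[mf /(_ e e0)[M [G [mG fG]]]] := Rf.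
  exists M, G; split => //=.
  rewrite (sum_fctE M (fun n => cu n (G n))) -/(bsum M G) -lte_fin rnmE//.
  rewrite (_ : f - _ = fun t => 1 * f t + (-1) * bsum M G t).
    by apply: RpO_lin => //; exact: bsum_RpO.
  by apply/funext => t; rewrite !fctE; ring.
Defined.

Lemma rnm0_aeq f g : RpO h p f -> RpO h p g -> rnm (f - g) = 0 <-> aeq f g.
Proof.
move=> Rf Rg.
have RB : RpO h p (f - g).
  rewrite (_ : f - g = fun t => 1 * f t + (-1) * g t); first exact: RpO_lin.
  by apply/funext => t; rewrite !fctE; ring.
have mB := RpO_measurable RB.
split => [h0|fg].
  have N0 : Np (f - g) = 0%E by rewrite -rnmE// h0.
  have := Lp_eq0 (mu := mu) p1 mB N0.
  by apply: ae_imply => x /eqP; rewrite !fctE subr_eq0 => /eqP.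
apply: EFin_inj; rewrite rnmE//; transitivity (Np (fun=> 0)); last exact: Np0.
apply: eq_ae_Lp => //.
by move: fg; apply: ae_imply => x fgx; rewrite !fctE fgx subrr.
Qed.

(** The maximum with 0 supplies the nonnegative bound asked for by the abstract factorization. *)
Lemma bdd_op_bounded T C : bdd_op h p T C ->
  bounded_op (S1 := Rspace) (S2 := Rspace) T (Num.max C 0).
Proof.
move=> [TX Tlin Tbd]; split => //=.
- move=> f g a b Rf Rg; apply/rnm0_aeq; last exact: Tlin.
    by apply: TX; exact: RpO_lin.
  by apply: RpO_lin; exact: TX.
- move=> f Rf; rewrite -lee_fin EFinM !rnmE//; last exact: TX.
  apply: le_trans (Tbd f Rf) _; apply: lee_wpmul2r; first exact: Lnorm_ge0.
  by rewrite lee_fin le_max lexx.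
Qed.

Lemma bounded_bdd_op T C : bounded_op (S1 := Rspace) (S2 := Rspace) T C ->
  bdd_op h p T C.
Proof.
move=> [TX Tlin Tbd]; split => //=.
- move=> f g a b Rf Rg; apply/rnm0_aeq; last exact: (Tlin f g a b Rf Rg).
    by apply: TX; exact: RpO_lin.
  by apply: RpO_lin; exact: TX.
- move=> f Rf; rewrite -!rnmE//; last exact: TX.
  by rewrite -EFinM lee_fin; exact: Tbd.
Qed.

End Final.

(** * The constant and the factorization *)

(** One of [p] and its conjugate exponent is at least 2, hence so is [pstar p]; the factors after
    [4 / (1 - eps)] are then at least 1. *)
Lemma fact_const_ge4 (R : realType) (p eps : R) : 1 < p -> 0 < eps -> eps < 1 ->
  4 <= fact_const p eps.
Proof.
move=> p1 e0 e1; have q1 : 0 < p - 1 by lra.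
have ps2 : 2 <= pstar p.
  rewrite /pstar /qconj le_max; apply/orP; case: (leP 2 p) => p2; [by left|right].
  by rewrite ler_pdivlMr//; lra.
have f1 : 4 <= 4 / (1 - eps) by rewrite ler_pdivlMr; lra.
have f2 : 1 <= (pstar p - 1) ^+ 2 by rewrite exprn_ege1//; lra.
have f3 : 1 <= (pstar p / 2) `^ (3 / 2).
  apply: (@le_trans _ _ ((pstar p / 2) `^ 0)); first by rewrite powRr0.
  by apply: ler_powR; [rewrite ler_pdivlMr//; lra|lra].
rewrite /fact_const.
have h1 : 4 * 1 <= 4 / (1 - eps) * (pstar p - 1) ^+ 2 by apply: ler_pM.
have h2 : 4 * 1 * 1 <= 4 / (1 - eps) * (pstar p - 1) ^+ 2 * (pstar p / 2) `^ (3 / 2).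
  by apply: ler_pM.
by move: h2; rewrite !mulr1.
Qed.

Theorem mainTheorem14 (R : realType) (p : R) (h : nat -> nat -> nat -> R -> R)
    (T : (R -> R) -> (R -> R)) (eps : R) :
  1 < p ->
  (forall n k i, Domega (n, k, i) -> measurable_fun setT (h n k i)) ->
  same_joint_dist h ->
  indep_blocks h ->
  (exists C : R, bdd_op h p T C) ->
  0 < eps -> eps < 1 ->
  exists S : (R -> R) -> (R -> R), (S = T \/ S = IminusOp T) /\
    exists (A B : (R -> R) -> (R -> R)) (a b : R),
      [/\ 0 <= a, 0 <= b, bdd_op h p A a, bdd_op h p B b
        & a * b <= fact_const p eps] /\
      (forall f, RpO h p f -> aeq (A (S (B f))) f).
Proof.
move=> p1 mh hdist hindep [C bT] e0 e1.
pose S0 := Rblocks p1 mh hdist hindep.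
have bT' : bounded_op (S1 := S0) (S2 := S0) T (Num.max C 0).
  exact: (bdd_op_bounded p1 mh hdist hindep bT).
have C0 : 0 <= Num.max C 0 by rewrite le_max lexx orbT.
have [U [UE [A [B [bA bB AUB]]]]] := factor_T_or_IT p1 C0 bT'.
have UE' : U = T \/ U = IminusOp T by case: UE => ->; [left|right].
exists U; split => //; exists A, B, 4, 1; split; first split.
- by [].
- by [].
- exact: (bounded_bdd_op bA).
- exact: (bounded_bdd_op bB).
- by rewrite mulr1; exact: fact_const_ge4.
move=> f Rf.
have [BX _ _] := bB; have [AX _ _] := bA; have [TX _ _] := bT'.
have UX : RpO h p (U (B f)).
  have RB := BX f Rf.
  case: UE' => ->; first exact: TX.
  have RT := TX _ RB.
  rewrite (_ : IminusOp T (B f) = fun t => 1 * B f t + (-1) * T (B f) t).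
    exact: (RpO_lin p1 mh hdist).
  by apply/funext => t; rewrite /IminusOp; ring.
apply/(rnm0_aeq p1 mh hdist hindep) => //; first exact: AX.
exact: AUB.
Qed.
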